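(* Let $G=(K,I)$ be a connected $K_{1,4}$-free split graph of order $n$, where $|I|\ge 1$ and $n\ge \max\{5,2|I|\}$. Let $H=\Gamma'_{n,2}$ if $|I|=2$ and $n=5$; $H=\Gamma'_{n,3}$ if $|I|=3$ and $n=6$; and $H=\Gamma_{n,|I|}$ otherwise. If $\rho(G)\ge \rho(H)$, then $G$ is Hamiltonian, unless $G\cong H$.
   Context: All graphs are finite and simple. A split graph $G=(K,I)$ is a graph whose vertex set is partitioned into a clique $K$ and an independent set $I$, where $K$ is chosen to be a maximum clique of $G$. A graph is $K_{1,4}$-free if no vertex has four pairwise nonadjacent neighbours (i.e. no induced $K_{1,4}$). $\rho(G)$ denotes the spectral radius of the adjacency matrix of $G$. A graph is Hamiltonian if it has a cycle through all its vertices. For $n\ge 5$ and $1\le t\le \lfloor n/2\rfloor$, $\Gamma_{n,t}$ is the split graph with clique $K=\{v_1,\dots,v_{n-t}\}$ (all pairs adjacent) and independent set $I=\{u_1,\dots,u_t\}$, whose edges between $K$ and $I$ are: - $t=1$: $u_1v_1$; - $t=2$: $u_1v_i$ for $i=1,\dots,n-3$, and $u_2v_{n-3}$; - $t=3$: $u_iv_j$ for $i=1,2$ and $j=1,\dots,n-4$, and $u_3v_{n-3}$; - $t=4$: $u_iv_j$ for $i=1,2$ and $j=1,\dots,n-5$; $u_3v_k$ for $k=2,\dots,n-4$; and $u_4v_{n-4}$; - $t=5$: $u_1v_1$, $u_1v_{n-5}$; $u_iv_j$ for $i=2,3$ and $j=1,\dots,n-6$; $u_4v_k$ for $k=2,\dots,n-5$;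 and $u_5v_{n-5}$; - $6\le t\le\lfloor n/2\rfloor$: $u_iv_i$ for $i=1,\dots,t-5$; $u_{t-4}v_j$ for $j=1,\dots,n-t-1$; $u_{t-3}v_k$ for $k\in\{1,\dots,n-t-2\}\cup\{n-t\}$; $u_{t-2}v_\ell$ for $\ell=t-4,\dots,n-t$; $u_{t-1}v_{n-t-1}$; and $u_tv_{n-t}$. $\Gamma'_{n,2}$ is obtained from $K_{n-2}$ on $\{v_1,\dots,v_{n-2}\}$ and two new vertices $u_1,u_2$ by adding the edges $u_iv_j$ for $i,j\in\{1,2\}$. $\Gamma'_{n,3}$ is obtained from $K_{n-3}$ on $\{v_1,\dots,v_{n-3}\}$ and three new vertices $u_1,u_2,u_3$ by adding the edges $u_iv_j$ for $i,j\in\{1,2\}$ and $u_3v_k$ for $k=2,\dots,n-3$. *)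

(* Defs.v *)
From mathcomp Require Import all_boot all_order all_algebra all_field.

Set Implicit Arguments.
Unset Strict Implicit.
Unset Printing Implicit Defensive.

Import Order.TTheory GRing.Theory Num.Theory.

(* A finite simple graph is a symmetric irreflexive relation e on a finType. *)

Section Graphs.
Variables (T : finType) (e : rel T).

Definition clique (C : {set T}) : Prop :=
  forall x y, x \in C -> y \in C -> x != y -> e x y.

Definition independent (S : {set T}) : Prop :=
  forall x y, x \in S -> y \in S -> ~~ e x y.

Definition maximum_clique (C : {set T}) : Prop :=
  clique C /\ forall D : {set T}, clique D -> #|D| <= #|C|.

Definition split_partition (K I : {set T}) : Prop :=
  [/\ K :|: I = [set: T], [disjoint K & I], maximum_clique K & independent I].

Definition connected_graph : Prop := forall x y, connect e x y.

Definition K14_free : Prop :=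
  ~ exists (x : T) (S : {set T}),
      [/\ #|S| = 4, forall y, y \in S -> e x y & independent S].

Definition hamiltonian : Prop :=
  exists c : seq T, [/\ 3 <= size c, ucycle e c & forall x, x \in c].

End Graphs.

Definition graph_iso (T1 T2 : finType) (e1 : rel T1) (e2 : rel T2) : Prop :=
  exists2 f : T1 -> T2, bijective f & {mono f : x y / e1 x y >-> e2 x y}.

Section Spectral.
Local Open Scope ring_scope.

Definition adjacency_mx (T : finType) (e : rel T) : 'M[algC]_#|T| :=
  \matrix_(i, j) (e (enum_val i) (enum_val j))%:R.

Definition eigenvalues n (A : 'M[algC]_n) : seq algC :=
  sval (closed_field_poly_normal (char_poly A)).

(* Num.max is used on norms only, which are pairwise comparable in algC. *)
Definition spectral_radius n (A : 'M[algC]_n) : algC :=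
  \big[Num.max/0]_(z <- eigenvalues A) `|z|.

Lemma mem_eigenvalues n (A : 'M[algC]_n) z :
  (z \in eigenvalues A) = eigenvalue A z.
Proof.
rewrite eigenvalue_root_char /eigenvalues.
case: closed_field_poly_normal => r /= rE.
by rewrite [in RHS]rE (monicP (char_poly_monic A)) scale1r root_prod_XsubC.
Qed.

Definition rho (T : finType) (e : rel T) : algC :=
  spectral_radius (adjacency_mx e).

End Spectral.

(* The graph made of a clique on 'I_k, an independent set on 'I_t and the
   cross edges c. Ordinals count from 0 whereas c i j, which says that u_i and
   v_j are adjacent, uses indices counting from 1: v_j is inl (j - 1) and u_i
   is inr (i - 1). *)
Definition split_rel (k t : nat) (c : nat -> nat -> bool) :
    rel ('I_k + 'I_t)%type :=
  fun x y => match x, y with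
  | inl j1, inl j2 => j1 != j2
  | inl j, inr i | inr i, inl j => c i.+1 j.+1
  | inr _, inr _ => false
  end.

Lemma split_rel_sym k t c : symmetric (@split_rel k t c).
Proof. by case=> [j|i] [j'|i'] //=; rewrite eq_sym. Qed.

Lemma split_rel_irr k t c : irreflexive (@split_rel k t c).
Proof. by case=> [j|i] //=; rewrite eqxx. Qed.

Definition Gamma_cross (n t i j : nat) : bool :=
  match t with
  | 0 => false
  | 1 => (i == 1) && (j == 1)
  | 2 => (i == 1) && (1 <= j <= n - 3)
      || (i == 2) && (j == n - 3)
  | 3 => ((i == 1) || (i == 2)) && (1 <= j <= n - 4)
      || (i == 3) && (j == n - 3)
  | 4 => ((i == 1) || (i == 2)) && (1 <= j <= n - 5)
      || (i == 3) && (2 <= j <= n - 4)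
      || (i == 4) && (j == n - 4)
  | 5 => (i == 1) && ((j == 1) || (j == n - 5))
      || ((i == 2) || (i == 3)) && (1 <= j <= n - 6)
      || (i == 4) && (2 <= j <= n - 5)
      || (i == 5) && (j == n - 5)
  | _ => (1 <= i <= t - 5) && (j == i)
      || (i == t - 4) && (1 <= j <= n - t - 1)
      || (i == t - 3) && ((1 <= j <= n - t - 2) || (j == n - t))
      || (i == t - 2) && (t - 4 <= j <= n - t)
      || (i == t - 1) && (j == n - t - 1)
      || (i == t) && (j == n - t)
  end.

Definition Gamma'2_cross (i j : nat) : bool :=
  (1 <= i <= 2) && (1 <= j <= 2).

Definition Gamma'3_cross (n i j : nat) : bool :=
  (1 <= i <= 2) && (1 <= j <= 2) || (i == 3) && (2 <= j <= n - 3).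

Definition Gamma (n t : nat) : rel ('I_(n - t) + 'I_t)%type :=
  split_rel (Gamma_cross n t).

Definition Gamma'2 (n : nat) : rel ('I_(n - 2) + 'I_2)%type :=
  split_rel Gamma'2_cross.

Definition Gamma'3 (n : nat) : rel ('I_(n - 3) + 'I_3)%type :=
  split_rel (Gamma'3_cross n).

Arguments Gamma : clear implicits.
Arguments Gamma'2 : clear implicits.
Arguments Gamma'3 : clear implicits.

Definition extremal_graph (n t : nat) : rel ('I_(n - t) + 'I_t)%type :=
  match t return rel ('I_(n - t) + 'I_t)%type with
  | 2 => if n == 5 then Gamma'2 n else Gamma n 2
  | 3 => if n == 6 then Gamma'3 n else Gamma n 3
  | t' => Gamma n t'
  end.

Arguments extremal_graph : clear implicits.

(* Main.v *)
Require Import Defs.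
From mathcomp Require Import all_boot all_order all_algebra all_field.
From mathcomp Require Import spectral sesquilinear ring lra zify.

(**
Let [w > 0] be a Perron eigenvector of the given graph [G], with eigenvalue
[r]. Any bijection from the vertices of the extremal graph [H] to those of [G]
carries [w] to a test vector for [H], so [rho H <= rho G] bounds the quadratic
form of [H] at that vector by that of [G]; equality makes it an eigenvector of
[H]. When clique goes to clique and independent set to independent set, only
the edges between them matter. Write [P] for the total weight of [K] and call
the neighbours in [I] of a clique vertex [v] its column. The eigenvalue
equations [(r + 1) w(v) = P + w(column of v)] and [r w(u) = w(N(u))] imply that
the largest weight in [K] is less than twice the smallest, and they identify
the deficiency [3 P - r w(I)] with the sum of the [w(v) (3 - |column of v|)].
As [G] is K_{1,4}-free, columns have size at most 3 and a column of size 3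
meets every other column.

For four or more independent vertices one places the defects of [H] on the
lightest clique vertices. If [|I| >= 5] the form of [H] is then never smaller
than that of [G], and equality forces an isomorphism. The same holds for
[|I| = 4] unless at most one column has size less than 3, in which case a
Hamiltonian cycle is written down explicitly. For [|I| <= 3] the same comparison
leaves, among the non-Hamiltonian graphs, only a few exceptions, for which the
eigenvalue equations can be solved: one family and one graph for [|I| = 3], and
one graph for [|I| = 2].
*)

Set Implicit Arguments.
Unset Strict Implicit.
Unset Printing Implicit Defensive.

Import Order.TTheory GRing.Theory Num.Theory.

Local Open Scope ring_scope.
Local Open Scope sesquilinear_scope.

(** * Rayleigh quotients of a Hermitian matrix *)

(** After the transport the clique parts of the two forms cancel: the form of H exceeds r times the
    squared norm by twice the sum of w(u) (h(u) - r w(u)) over u in I, where h(u) is the weight of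
    the row of H given to u. The bound on the radii makes this sum nonpositive. A listing for which
    it is also nonnegative makes it zero, and then h(u) = r w(u) for every u. A set of clique
    vertices that weighs as much as one clique vertex is a single vertex, since two clique weights
    exceed any third; this turns equal weights into equal rows.

    Nonnegativity comes from summation by parts around a pivot row z: the summands become (w(u) -
    w(z)) (h(u) - r w(u)), and w(z) multiplies the total of h(u) - r w(u), which is the deficiency
    of G minus that of H. Hence the case distinction. For |I| >= 5 all columns of H have size 3 and
    its deficiency is 0. For |I| = 4 two columns of H have size 2, so G needs two short columns as
    well. For |I| = 3 and n > 6 all columns of H have size 2 except one of size 1, and deficiency is
    measured against 2 instead of 3. *)

Lemma bigmax_norm_ge (C : numClosedFieldType) (s : seq C) z :
  z \in s -> `|z| <= \big[Num.max/0]_(x <- s) `|x|.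
Proof.
have bigR (r : seq C) : \big[Num.max/0]_(x <- r) `|x| \is Num.real.
  by apply: (big_ind (fun y => y \is Num.real)) => // [a b|i _];
    [exact: max_real | exact: normr_real].
elim: s => // a s IHs; rewrite inE big_cons => /orP[/eqP->|/IHs le_z];
  by rewrite comparable_le_max ?real_comparable ?normr_real ?lexx ?le_z ?orbT.
Qed.

Lemma bigmax_norm_attained (C : numClosedFieldType) (s : seq C) :
  (0 < size s)%N -> exists2 z, z \in s & \big[Num.max/0]_(x <- s) `|x| = `|z|.
Proof.
elim: s => // a [|b s] IHs _.
  by exists a; rewrite ?mem_head // big_cons big_nil max_l.
have [//|z zs def_z] := IHs; rewrite big_cons def_z maxEle; case: ifP => _.
  by exists z; rewrite // inE zs orbT.
by exists a; rewrite ?mem_head.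
Qed.

Section RayleighMatrix.
Variables (C : numClosedFieldType) (n : nat) (A : 'M[C]_n) (r : C).
Hypothesis hermA : A \is hermsymmx.
Hypothesis r_ge : forall a, eigenvalue A a -> `|a| <= r.

Let P := spectralmx A.
Let D := spectral_diag A.
Let unitP : P \is unitarymx := spectral_unitarymx A.
Let defA : A = P^t* *m diag_mx D *m P.
Proof.
by rewrite -invmx_unitary //; apply/orthomx_spectralP/hermitian_normalmx.
Qed.

Let D_le i : D 0 i <= r.
Proof.
have Dreal : D 0 i \is Num.real.
  by have /mxOverP := hermitian_spectral_diag_real hermA; apply.
apply: (le_trans (real_ler_norm Dreal)); apply: r_ge.
apply/eigenvalueP; exists (row i P).
  rewrite -row_mul {1}defA !mulmxA (unitarymxP unitP) mul1mx.
  by apply/rowP => j; rewrite mul_diag_mx !mxE.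
apply/eqP => /rowP Pi0.
have /matrixP/(_ i i) := unitarymxP unitP; rewrite !mxE eqxx big1 => [|j _].
  by move/eqP; rewrite eq_sym oner_eq0.
by have := Pi0 j; rewrite !mxE => ->; rewrite mul0r.
Qed.

(** In an orthonormal eigenbasis the gap is a sum of nonnegative terms. This gives the inequality;
    and when the gap is zero, [y] is supported on the coordinates whose eigenvalue is [r]. *)
Let formE (v : 'rV[C]_n) (y := v *m P^t*) :
  r * (v *m v^t*) 0 0 - (v *m A *m v^t*) 0 0 =
  \sum_i (r - D 0 i) * `|y 0 i| ^+ 2.
Proof.
have -> : v *m v^t* = y *m y^t*.
  rewrite /y trmx_mul map_mxM trmxCK !mulmxA -(mulmxA v).
  by rewrite -invmx_unitary // mulVmx ?mulmx1 // spectral_unit.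
have -> : v *m A *m v^t* = y *m diag_mx D *m y^t*.
  by rewrite /y {1}defA trmx_mul map_mxM trmxCK !mulmxA.
rewrite mul_mx_diag ![(_ *m _^t*) _ _]mxE mulr_sumr -sumrB.
apply: eq_bigr => i _; rewrite !mxE normCK; set a := (\sum_(j < n) _).
by rewrite mulrBl !mulrA [D 0 i * _]mulrC.
Qed.

Lemma rayleigh_mx (v : 'rV[C]_n) :
  (v *m A *m v^t*) 0 0 <= r * (v *m v^t*) 0 0.
Proof.
rewrite -subr_ge0 formE sumr_ge0 // => i _.
by rewrite mulr_ge0 ?exprn_ge0 // subr_ge0.
Qed.

Lemma rayleigh_mx_eq (v : 'rV[C]_n) :
  (v *m A *m v^t*) 0 0 = r * (v *m v^t*) 0 0 -> v *m A = r *: v.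
Proof.
move=> eqv; have := formE v; rewrite -eqv subrr => /esym/eqP.
rewrite psumr_eq0; last first.
  by move=> i _; rewrite mulr_ge0 ?exprn_ge0 // subr_ge0.
move=> /allP y0.
have yE : v *m P^t* *m diag_mx D = r *: (v *m P^t*).
  rewrite mul_mx_diag; apply/rowP => i; rewrite 2![in LHS]mxE [in RHS]mxE.
  have := y0 i (mem_index_enum i); rewrite mulf_eq0 expf_eq0 normr_eq0 subr_eq0.
  by rewrite mxE; case/orP => /eqP->; rewrite ?mulr0 ?mul0r // mulrC.
rewrite {1}defA !mulmxA yE -scalemxAl -mulmxA.
by rewrite -invmx_unitary // mulVmx ?mulmx1 // spectral_unit.
Qed.
End RayleighMatrix.

(** * Perron vectors of graphs *)

Section GraphRayleigh.
Variables (C : numClosedFieldType) (T : finType) (e : rel T) (r : C).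
Let A : 'M[C]_#|T| := \matrix_(i, j) (e (enum_val i) (enum_val j))%:R.
Hypothesis e_sym : symmetric e.
Hypothesis r_ge : forall a, eigenvalue A a -> `|a| <= r.

Let reindexT (F : T -> C) : \sum_(i < #|T|) F (enum_val i) = \sum_x F x.
Proof. by rewrite [RHS](reindex _ (onW_bij _ (@enum_val_bij T))). Qed.

Let hermA : A \is hermsymmx.
Proof.
apply: realsym_hermsym.
  apply/is_hermitianmxP; rewrite scale1r; apply/matrixP => i j.
  by rewrite !mxE e_sym.
by apply/mxOverP => i j; rewrite mxE realn.
Qed.

Let row_of (w : T -> C) : 'rV[C]_#|T| := \row_i w (enum_val i).

Let mulA w j : (row_of w *m A) 0 j = \sum_(x | e (enum_val j) x) w x.
Proof.
rewrite mxE; under eq_bigr do rewrite !mxE.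
rewrite (reindexT (fun x => w x * (e x (enum_val j))%:R)) [RHS]big_mkcond /=.
apply: eq_bigr => x _; rewrite e_sym.
by case: (e _ x); rewrite ?mulr1 ?mulr0.
Qed.

Let formE (w : T -> C) : (row_of w *m A *m (row_of w)^t*) 0 0 =
  \sum_x (\sum_(y | e x y) w y) * (w x)^*.
Proof.
rewrite mxE -(reindexT (fun x => (\sum_(y | e x y) w y) * (w x)^*)).
by apply: eq_bigr => i _; rewrite mulA !mxE.
Qed.

Let normE (w : T -> C) :
  (row_of w *m (row_of w)^t*) 0 0 = \sum_x `|w x| ^+ 2.
Proof.
rewrite mxE -(reindexT (fun x => `|w x| ^+ 2)).
by apply: eq_bigr => i _; rewrite !mxE normCK.
Qed.

Lemma rayleighC (w : T -> C) :
  \sum_x (\sum_(y | e x y) w y) * (w x)^* <= r * \sum_x `|w x| ^+ 2.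
Proof. by rewrite -formE -normE rayleigh_mx. Qed.

Lemma rayleighC_eq (w : T -> C) :
  \sum_x (\sum_(y | e x y) w y) * (w x)^* = r * \sum_x `|w x| ^+ 2 ->
  forall x, \sum_(y | e x y) w y = r * w x.
Proof.
rewrite -formE -normE => /(rayleigh_mx_eq hermA r_ge)/rowP wE x.
by have := wE (enum_rank x); rewrite mulA !mxE enum_rankK.
Qed.

(** Passing to moduli keeps the squared norm, and by the triangle inequality the form stays at least
    [r] times it. So [rayleighC_eq] applies, and the vector of moduli is itself an eigenvector. *)
Lemma perron_nneg a : eigenvalue A a -> `|a| = r ->
  exists w : T -> C, [/\ forall x, 0 <= w x, exists x, w x != 0
    & forall x, \sum_(y | e x y) w y = r * w x].
Proof.
case/eigenvalueP => v vA v0 ar; pose w x := v 0 (enum_rank x).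
have wE x : \sum_(y | e x y) w y = a * w x.
  have rw : row_of w = v by apply/rowP => i; rewrite !mxE /w enum_valK.
  have := congr1 (fun u : 'rV_#|T| => u 0 (enum_rank x)) vA.
  by rewrite -{1}rw mulA [in RHS]mxE enum_rankK.
exists (fun x => `|w x|); split=> [x||]; first exact: normr_ge0.
  have [i vi] : exists i, v 0 i != 0.
    by apply/existsP; apply: contraNT v0 => /existsPn v0; apply/eqP/rowP => i;
       rewrite mxE; apply/eqP; have := v0 i; rewrite negbK.
  by exists (enum_val i); rewrite normr_eq0 /w enum_valK.
apply: rayleighC_eq; apply/eqP; rewrite eq_le rayleighC /=.
rewrite mulr_sumr; apply: ler_sum => x _.
rewrite (CrealP (normr_real _)) normr_id expr2 mulrA ler_wpM2r //.
by rewrite -ar -normrM -wE; apply: ler_norm_sum.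
Qed.
End GraphRayleigh.

Section GraphSpectrum.
Variables (T : finType) (e : rel T).

Lemma rho_real : rho e \is Num.real.
Proof.
apply: (big_ind (fun y => y \is Num.real)) => // [a b|i _];
  [exact: max_real | exact: normr_real].
Qed.

(** The order of [algC] is partial; in its real subfield [algR] it is total and linear arithmetic
    applies. *)
Definition rhoR : algR := in_algR rho_real.

Hypothesis e_sym : symmetric e.

Let rho_ge a : eigenvalue (adjacency_mx e) a -> `|a| <= rho e.
Proof. by rewrite -mem_eigenvalues; apply: bigmax_norm_ge. Qed.

Let valM (a b : algR) : algRval (a * b) = algRval a * algRval b.
Proof. by []. Qed.

Let valS (P : pred T) (F : T -> algR) :
  algRval (\sum_(x | P x) F x) = \sum_(x | P x) algRval (F x).
Proof. exact: (big_morph algRval (id1 := 0) (op1 := +%R)). Qed.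

Let valE (w : T -> algR) :
  (algRval (\sum_x w x * \sum_(y | e x y) w y) =
    \sum_x (\sum_(y | e x y) algRval (w y)) * (algRval (w x))^*)
  * (algRval (rhoR * \sum_x w x ^+ 2) =
    rho e * \sum_x `|algRval (w x)| ^+ 2).
Proof.
split.
  rewrite valS; apply: eq_bigr => x _.
  by rewrite valM valS mulrC (CrealP (algRvalP _)).
rewrite valM valS; congr (_ * _); apply: eq_bigr => x _.
by rewrite expr2 valM -expr2 real_normK // algRvalP.
Qed.

Lemma rayleigh (w : T -> algR) :
  \sum_x w x * \sum_(y | e x y) w y <= rhoR * \sum_x w x ^+ 2.
Proof.
have := rayleighC e_sym rho_ge (fun x => algRval (w x)).
by rewrite -!valE.
Qed.

Lemma rayleigh_eq (w : T -> algR) :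
  \sum_x w x * \sum_(y | e x y) w y = rhoR * \sum_x w x ^+ 2 ->
  forall x, \sum_(y | e x y) w y = rhoR * w x.
Proof.
move/(congr1 algRval); rewrite !valE => /(rayleighC_eq e_sym rho_ge) wE x.
exact/val_inj/(etrans (valS _ _) (wE x)).
Qed.

(** Where a nonnegative eigenvector vanishes, its equation is a vanishing sum of nonnegative terms,
    so it vanishes at all neighbours too. Along a path this would reach the vertex [x0], where it
    does not vanish. *)
Lemma perron : connected_graph e -> (0 < #|T|)%N -> exists w : T -> algR,
  (forall x, 0 < w x) /\ forall x, \sum_(y | e x y) w y = rhoR * w x.
Proof.
move=> conn T_gt0.
have [a aA ra] : exists2 a, eigenvalue (adjacency_mx e) a & rho e = `|a|.
  have [|a] := @bigmax_norm_attained _ (eigenvalues (adjacency_mx e)).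
    have [a] := eigenvalue_closed (adjacency_mx e) T_gt0.
    by rewrite -mem_eigenvalues; case: eigenvalues.
  by rewrite mem_eigenvalues => aA ra; exists a.
have [w [w_ge0 [x0 wx0] wE]] := perron_nneg e_sym rho_ge aA (esym ra).
have wR x : w x \is Num.real by rewrite realE w_ge0.
have w_gt0 x : 0 < w x.
  rewrite lt0r w_ge0 andbT; apply: contraNneq wx0 => wx.
  have /connectP[p] := conn x x0; elim: p x wx => [|z p IHp] x wx /=.
    by move=> _ ->; rewrite wx.
  case/andP=> exz; apply: IHp; apply/eqP; have := wE x; rewrite wx mulr0.
  move/eqP; rewrite psumr_eq0 => [/allP/(_ z (mem_index_enum z))|y _]; last exact: w_ge0.
  by rewrite exz.
exists (fun x => in_algR (wR x)); split=> x; first exact: w_gt0.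
by apply: val_inj; rewrite [LHS]valS; apply: wE.
Qed.
End GraphSpectrum.

Local Close Scope sesquilinear_scope.

Local Close Scope ring_scope.

(** * Split graphs and Hamiltonian cycles *)

Definition column (T : finType) (e : rel T) (I : {set T}) (v : T) : {set T} :=
  [set u in I | e v u].

(** The form in which the comparisons use the hypotheses on G: [ks_miss] comes from the maximality
    of [K], [ks_row] from connectedness, [ks_col] and [ks_meet] from the absence of an induced
    K_{1,4}. *)
Record K14_split (T : finType) (e : rel T) (K I : {set T}) : Prop := {
  ks_sym : symmetric e;
  ks_irr : irreflexive e;
  ks_clique : clique e K;
  ks_indep : independent e I;
  ks_mem : forall x, (x \in I) = (x \notin K);
  ks_row : forall u, u \in I -> exists2 v, v \in K & e u v;
  ks_miss : forall u, u \in I -> exists2 v, v \in K & ~~ e u v;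
  ks_col : forall v, v \in K -> #|column e I v| <= 3;
  ks_meet : forall v v', v \in K -> v' \in K -> #|column e I v| = 3 ->
    exists2 u, u \in column e I v & u \in column e I v' }.

Section Combinatorics.
Variables (T : finType) (e : rel T) (K I : {set T}).

(** A vertex of [I] joined to all of [K] would enlarge the clique. Four members of a column would
    form a K_{1,4} at [v]; so would three members together with a clique vertex [v'] adjacent to
    none of them. *)
Lemma K14_split_of : symmetric e -> irreflexive e -> split_partition e K I ->
  connected_graph e -> K14_free e -> 1 < #|K| -> K14_split e K I.
Proof.
move=> e_sym e_irr [KI disjKI [cliqueK maxK] indepI] conn free K_gt1.
have memI x : (x \in I) = (x \notin K).
  have := in_setT x; rewrite -KI inE; case xK: (x \in K) => //=.
  by rewrite (disjointFr disjKI xK).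
split=> // [u uI|u uI|v vK|v v' vK v'K].
- have [v vK] : exists v, v \in K by apply/card_gt0P; apply: leq_trans K_gt1.
  have /connectP[[|y p] /= ep def_v] := conn u v.
    by move: vK; rewrite def_v; move: uI; rewrite memI => /negP.
  have /andP[euy _] := ep; exists y => //.
  by apply: contraLR euy; rewrite -memI => yI; apply: indepI.
- apply/exists_inP; apply/exists_inPn => /= full_u.
  have cl : clique e (u |: K).
    move=> a b; rewrite !inE => /orP[/eqP->|aK] /orP[/eqP->|bK] ab.
    + by rewrite eqxx in ab.
    + by have := full_u b bK; rewrite negbK.
    + by have := full_u a aK; rewrite negbK e_sym.
    + exact: cliqueK.
  by have := maxK _ cl; rewrite cardsU1 -memI uI ltnn.
- rewrite leqNgt; apply/negP => lt3; apply: free.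
  have [S SC cS] : exists2 S : {set T}, S \subset column e I v & #|S| = 4.
    have [s [us ss sub]] := card_geqP lt3.
    exists [set x in s]; first by apply/subsetP => x; rewrite inE; apply: sub.
    by rewrite cardsE -ss; apply/card_uniqP.
  exists v, S; split=> // [y /(subsetP SC)|y z /(subsetP SC) + /(subsetP SC)].
    by rewrite inE => /andP[].
  by rewrite !inE => /andP[yI _] /andP[zI _]; apply: indepI.
move=> c3; apply/exists_inP; apply/exists_inPn => /= nomeet; apply: free.
have nev' y : y \in column e I v -> ~~ e v' y.
  by move=> yv; have := nomeet y yv; rewrite !inE; move: yv; rewrite !inE => /andP[->].
have v'v : v' != v.
  have /card_gt0P[y yv] : 0 < #|column e I v| by rewrite c3.
  apply/eqP => vv; have := nev' y yv; rewrite vv.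
  by move: yv; rewrite !inE => /andP[_ ->].
exists v, (v' |: column e I v); split.
- by rewrite cardsU1 c3 !inE memI v'K.
- move=> y; rewrite !inE => /orP[/eqP->|/andP[]//].
  by apply: cliqueK; rewrite // eq_sym.
move=> y z; rewrite !inE => /orP[/eqP->|yc] /orP[/eqP->|zc].
- by rewrite e_irr.
- by apply: nev'; rewrite inE.
- by rewrite e_sym; apply: nev'; rewrite inE.
- by case/andP: yc zc => yI _ /andP[zI _]; apply: indepI.
Qed.

Hypothesis KS : K14_split e K I.

Lemma ks_notK u : u \in I -> u \notin K. Proof. by rewrite (ks_mem KS). Qed.

Lemma ks_notI v : v \in K -> v \notin I.
Proof. by rewrite (ks_mem KS) negbK. Qed.

Lemma ks_neighborK u y : u \in I -> e u y -> y \in K.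
Proof.
move=> uI euy; apply: contraLR euy; rewrite -(ks_mem KS) => yI.
exact: (ks_indep KS).
Qed.

Lemma clique_path x s : uniq (x :: s) -> {subset x :: s <= K} -> path e x s.
Proof.
elim: s x => //= y s IHs x /andP[xs us] sub.
rewrite IHs // ?andbT => [|z zs]; last by apply: sub; rewrite inE zs orbT.
apply: (ks_clique KS); rewrite ?sub ?inE ?eqxx ?orbT //.
by apply: contraNneq xs => ->; rewrite mem_head.
Qed.

(** Both ends lie in [K], so the path closes up through the clique vertices that it has not visited,
    taken in any order. *)
Lemma hamiltonian_path x c : 2 < #|T| -> uniq (x :: c) -> path e x c ->
  c != [::] -> x \in K -> last x c \in K -> {subset I <= x :: c} ->
  hamiltonian e.
Proof.
move=> T_gt2 uc ec c0 xK lK sub.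
pose rest := enum (K :\: [set y in x :: c]).
have mem_rest y : (y \in rest) = (y \notin x :: c) && (y \in K).
  by rewrite mem_enum !inE.
have uall : uniq (x :: c ++ rest).
  rewrite -cat_cons cat_uniq uc enum_uniq andbT; apply/hasPn => y.
  by rewrite mem_rest => /andP[].
have all_in y : y \in x :: c ++ rest.
  rewrite -cat_cons mem_cat mem_rest; case yc: (y \in x :: c) => //=.
  by rewrite -[_ \in K]negbK -(ks_mem KS); apply: contraFN yc => /sub.
exists (x :: c ++ rest); split=> //.
  suff -> : size (x :: c ++ rest) = #|T| by [].
  by rewrite -(card_uniqP uall); apply: eq_card => y; apply: all_in.
rewrite /ucycle uall andbT /= rcons_cat cat_path ec /=.
apply: clique_path => [|y].
  have lc : last x c \in c by case: (c) c0 => //= y c' _; rewrite mem_last.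
  rewrite /= mem_rcons inE negb_or mem_rest rcons_uniq enum_uniq.
  rewrite mem_rest !inE lc orbT eqxx /= !andbT.
  by apply: contraTneq uc => <-; rewrite /= lc.
rewrite inE mem_rcons inE mem_rest => /orP[/eqP->//|/orP[/eqP->//|/andP[]//]].
Qed.

(** If a clique vertex [f] is off the cycle, take a neighbour [u] of it in [I], cut the cycle after
    [u] and go on to [f] instead. The old successor of [u] lies in [K], so this is a path with both
    ends in [K] to which [hamiltonian_path] applies. *)
Lemma hamiltonian_cycle c : 3 <= size c -> ucycle e c -> {subset I <= c} ->
  (forall f, f \in K -> f \notin c -> exists2 u, u \in I & e f u) ->
  hamiltonian e.
Proof.
move=> c3 uc sub ext.
have [allK|] := boolP [forall f in K, f \in c].
  exists c; split=> // x; have := ks_mem KS x.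
  have [xK _|_ /sub//] := boolP (x \in K).
  by have /forall_inP := allK; apply.
case/forall_inPn => f fK fc; have [u uI efu] := ext f fK fc.
have [i c' def_c] := rot_to (sub u uI).
have memc : u :: c' =i c by move=> y; rewrite -def_c mem_rot.
have : ucycle e (u :: c') by rewrite -def_c rot_ucycle.
have : 3 <= size (u :: c') by rewrite -def_c size_rot.
case: c' memc {def_c} => // v p memc _ /andP[].
rewrite /= rcons_path => /andP[euv /andP[evp elu]] /andP[uvp /andP[vp up]].
move: uvp; rewrite inE negb_or => /andP[uv u_p].
have {fc} := fc; rewrite -memc !inE !negb_or => /and3P[fu fv f_p].
have uniq_all : uniq (v :: rcons (rcons p u) f).
  rewrite /= !(rcons_uniq, mem_rcons, inE, negb_or) up u_p vp f_p fu.
  by rewrite [v == f]eq_sym fv [v == u]eq_sym uv.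
apply: (hamiltonian_path (x := v) (c := rcons (rcons p u) f)) => //.
- apply: leq_trans (max_card (mem (v :: rcons (rcons p u) f))).
  by rewrite (card_uniqP uniq_all) /= !size_rcons.
- by rewrite !rcons_path last_rcons evp elu (ks_sym KS).
- by case: (rcons p u).
- exact: ks_neighborK euv.
- by rewrite last_rcons.
move=> y /sub; rewrite -memc !(inE, mem_rcons) => /or3P[->|->|->];
  by rewrite ?orbT.
Qed.

(** Adjacency inside [K] and inside [I] is forced, so a listing of each that matches the cross edges
    suffices. *)
Lemma graph_iso_split (k t : nat) (c : nat -> nat -> bool) (x0 : T) (s q : seq T) :
  size s = k -> size q = t -> uniq s -> uniq q -> s =i K -> q =i I ->
  (forall i j, i < t -> j < k -> e (nth x0 q i) (nth x0 s j) = c i.+1 j.+1) ->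
  graph_iso e (@split_rel k t c).
Proof.
move=> sk qt us uq sK qI cE.
pose g (x : 'I_k + 'I_t) := match x with inl j => nth x0 s j | inr i => nth x0 q i end.
have gK (j : 'I_k) : nth x0 s j \in K by rewrite -sK mem_nth // sk.
have gI (i : 'I_t) : nth x0 q i \in I by rewrite -qI mem_nth // qt.
have g_inj : injective g.
  case=> [j|i] [j'|i'] /=.
  - by move/eqP; rewrite nth_uniq ?sk // => /eqP/val_inj->.
  - by move=> gg; have := gI i'; rewrite -gg (negPf (ks_notI (gK j))).
  - by move=> gg; have := gI i; rewrite gg (negPf (ks_notI (gK j'))).
  - by move/eqP; rewrite nth_uniq ?qt // => /eqP/val_inj->.
have cardT : #|T| <= #|{: 'I_k + 'I_t}|.
  rewrite card_sum !card_ord -sk -qt -size_cat.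
  have us2 : uniq (s ++ q).
    by rewrite cat_uniq us uq andbT; apply/hasPn => y; rewrite qI sK (ks_mem KS).
  rewrite -(card_uniqP us2); apply/subset_leq_card/subsetP => y _.
  by rewrite mem_cat sK qI (ks_mem KS) orbN.
have [h gh hg] := inj_card_bij g_inj cardT.
exists h; first by exists g.
move=> x y; rewrite -[in RHS](hg x) -[in RHS](hg y).
case: (h x) (h y) => [j|i] [j'|i'] /=; last 1 first.
- by apply/esym/negbTE/(ks_indep KS).
- have [->|jj'] := eqVneq j j'; first by rewrite (ks_irr KS).
  apply/esym/(ks_clique KS) => //; rewrite nth_uniq ?sk //.
- by rewrite (ks_sym KS) cE.
- by rewrite cE.
Qed.
End Combinatorics.

Local Open Scope ring_scope.

(** * Arrangements of the extremal graph *)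

(** In [pw_col] the weight of [v] has been added to both sides of its eigenvalue equation, so that
    the clique contributes the same amount for every [v] and clique vertices compare through their
    columns alone. *)
Record perron_weights (R : realFieldType) (T : finType) (e : rel T)
    (K I : {set T}) (w : T -> R) (r : R) : Prop := {
  pw_gt0 : forall x, 0 < w x;
  pw_row : forall u, u \in I -> \sum_(v in K | e u v) w v = r * w u;
  pw_col : forall v, v \in K ->
    \sum_(x in K) w x + \sum_(u in column e I v) w u = (r + 1) * w v }.

(** What a spectral radius of at most [r] provides, stated over any real field: the Rayleigh bound,
    and the fact that a vector attaining it is an eigenvector for [r]. *)
Definition rayleigh_bounded (R : realFieldType) (U : finType) (h : rel U)
    (r : R) : Prop := forall v : U -> R,
  \sum_x v x * (\sum_(y | h x y) v y) <= r * \sum_x v x ^+ 2 /\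
  (\sum_x v x * (\sum_(y | h x y) v y) = r * \sum_x v x ^+ 2 ->
   forall x, \sum_(y | h x y) v y = r * v x).

Lemma rayleigh_bounded_rho (T U : finType) (e : rel T) (h : rel U) :
  symmetric h -> rho h <= rho e -> rayleigh_bounded h (rhoR e).
Proof.
move=> h_sym le_rho v; have le_rhoR : rhoR h <= rhoR e by [].
have sq_ge0 : 0 <= \sum_x v x ^+ 2 by apply: sumr_ge0 => x _; apply: sqr_ge0.
have ray := rayleigh h_sym v; have le2 := ler_wpM2r sq_ge0 le_rhoR.
split=> [|eqv]; first exact: le_trans le2.
have eq_rho : rhoR h * \sum_x v x ^+ 2 = rhoR e * \sum_x v x ^+ 2.
  by apply/eqP; rewrite eq_le le2 -eqv.
(* A nonzero vector attaining the larger radius forces the two radii to be equal; the zero vector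
   satisfies the equations anyway. *)
have [sq0|sq_neq0] := eqVneq (\sum_x v x ^+ 2) 0.
  have v0 x : v x = 0.
    move/eqP: sq0; rewrite psumr_eq0 => [/allP/(_ x (mem_index_enum x))|y _].
      by rewrite sqrf_eq0 => /eqP.
    exact: sqr_ge0.
  by move=> x; rewrite v0 mulr0 big1 // => y _; rewrite v0.
have <- : rhoR h = rhoR e by apply: (mulIf sq_neq0).
by apply: rayleigh_eq; rewrite ?eqv ?eq_rho.
Qed.

Lemma perron_weights_of (T : finType) (e : rel T) (K I : {set T})
    (w : T -> algR) : K14_split e K I -> (forall x, 0 < w x) ->
  (forall x, \sum_(y | e x y) w y = rhoR e * w x) ->
  perron_weights e K I w (rhoR e).
Proof.
move=> KS w_gt0 wE; split=> // [u uI|v vK].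
  rewrite -wE; apply: eq_bigl => v; apply/andP/idP => [[]//|euv].
  by rewrite (ks_neighborK KS uI euv).
rewrite mulrDl mul1r -wE (bigD1 v vK) /= -addrA addrC; congr (_ + _).
rewrite [RHS](bigID (mem I)) /= addrC; congr (_ + _).
  by apply: eq_bigl => x; rewrite !inE andbC.
apply: eq_bigl => x; rewrite (ks_mem KS) negbK.
have [->|xv] := eqVneq x v; first by rewrite (ks_irr KS) andbF.
have [xK|xK] := boolP (x \in K); rewrite ?andbF !andbT; last exact/negbTE.
by rewrite (ks_clique KS vK xK) // eq_sym.
Qed.

Lemma eq_pred2_left (j j0 j1 : nat) : j0 != j1 ->
  ((j == j0) || (j == j1)) && (j != j0) = (j == j1).
Proof. lia. Qed.

Section Weights.
Variables (R : realFieldType) (T : finType) (e : rel T) (K I : {set T}).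
Variables (w : T -> R) (r : R).
Hypothesis KS : K14_split e K I.
Hypothesis PW : perron_weights e K I w r.

Definition wt (A : {set T}) : R := \sum_(x in A) w x.
Definition nbr (u : T) : {set T} := [set v in K | e u v].
Definition missed (u : T) : {set T} := [set v in K | ~~ e u v].

Let w_gt0 x : 0 < w x := pw_gt0 PW x.
Let w_ge0 x : 0 <= w x := ltW (w_gt0 x).

Lemma wt_ge0 A : 0 <= wt A.
Proof. by apply: sumr_ge0. Qed.

Lemma wt_nbr u : u \in I -> wt (nbr u) = r * w u.
Proof.
by move=> uI; rewrite -(pw_row PW uI); apply: eq_bigl => v; rewrite inE.
Qed.

Lemma wt_missed u : u \in I -> wt (missed u) = wt K - r * w u.
Proof.
move=> uI; rewrite -wt_nbr // /wt [\sum_(x in K) _](bigID (e u)) /=.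
rewrite addrAC (_ : \sum_(x in nbr u) w x = \sum_(i in K | e u i) w i).
  by rewrite subrr add0r; apply: eq_bigl => v; rewrite inE.
by apply: eq_bigl => v; rewrite inE.
Qed.

Lemma wt_ge1 (A : {set T}) v : v \in A -> w v <= wt A.
Proof. by move=> vA; rewrite /wt (bigD1 v) //= lerDl sumr_ge0. Qed.

Lemma wt_ge2 (A : {set T}) v v' : v \in A -> v' \in A -> v != v' -> w v + w v' <= wt A.
Proof.
move=> vA v'A vv'; rewrite /wt (bigD1 v) //= lerD2l (bigD1 v') /=.
  by rewrite lerDl sumr_ge0.
by rewrite v'A eq_sym.
Qed.

Lemma wtK_gt0 v : v \in K -> 0 < wt K.
Proof. by move=> vK; apply: lt_le_trans (wt_ge1 vK). Qed.

(** Sum the clique equations over [K] and drop the column weights. *)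
Lemma r_ge : (0 < #|K|)%N -> #|K|%:R <= r + 1.
Proof.
move=> /card_gt0P[v vK]; rewrite -(ler_pM2r (wtK_gt0 vK)) mulr_natl.
rewrite -sumr_const /wt mulr_sumr; apply: ler_sum => x xK.
by rewrite -(pw_col PW xK) lerDl sumr_ge0.
Qed.

(** Each [u] in [I] misses a clique vertex, so r w(u) < P, where P is the weight of [K]. A column of
    at most [r] vertices therefore weighs less than P, and (r + 1) w(v) < 2 P <= 2 (r + 1) w(v'). *)
Lemma w_lt2 v v' : v \in K -> v' \in K -> 0 < r -> #|column e I v|%:R <= r ->
  w v < w v' + w v'.
Proof.
move=> vK v'K r_gt0 col_le.
have lt_u u : u \in I -> r * w u < wt K.
  move=> uI; have [x xK nux] := ks_miss KS uI.
  have: 0 < wt (missed u) by apply: lt_le_trans (wt_ge1 (_ : x \in _)); rewrite ?inE ?xK.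
  by rewrite wt_missed // subr_gt0.
have Pgt0 := wtK_gt0 vK.
have lt_col : wt (column e I v) < wt K.
  rewrite -(ltr_pM2l r_gt0); have [col0|[u uc]] := set_0Vmem (column e I v).
    by rewrite /wt col0 big_set0 mulr0 mulr_gt0.
  apply: lt_le_trans (ler_wpM2r (ltW Pgt0) col_le).
  rewrite mulr_natl -sumr_const /wt mulr_sumr.
  apply: ltr_sum => [|x]; last by rewrite inE => /andP[/lt_u].
  by apply/hasP; exists u; rewrite ?mem_index_enum.
have := pw_col PW vK; have := pw_col PW v'K; rewrite -![\sum_(x in _) _]/(wt _).
have := wt_ge0 (column e I v'); have r1 : 0 < r + 1 by lra.
move=> c'0 e1 e2; rewrite -(ltr_pM2l r1) mulrDr -e1 -e2; lra.
Qed.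

Lemma sum_rows : \sum_(u in I) r * w u = \sum_(v in K) w v *+ #|column e I v|.
Proof.
under eq_bigr => u uI do rewrite -(pw_row PW uI).
under [RHS]eq_bigr => v vK do rewrite -sumr_const.
rewrite (exchange_big_dep (mem K)) /= => [|u v _ /andP[]//].
apply: eq_bigr => v vK; apply: eq_bigl => u.
by rewrite !inE vK (ks_sym KS) andTb.
Qed.

(** Each element of [A] weighs more than half of [w v], so there is no room for two. *)
Lemma wt_single (A : {set T}) v : A \subset K -> A != set0 -> v \in K ->
  (forall a, a \in K -> w v < w a + w a) -> wt A = w v -> exists a, A = [set a].
Proof.
move=> /subsetP AK /set0Pn[a aA] vK v2 wA; exists a; apply/setP => b.
rewrite inE; apply/idP/eqP => [bA|->//]; apply/eqP/negP => /negP ba.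
have := wt_ge2 aA bA; rewrite eq_sym ba wA => /(_ isT).
by have := v2 a (AK a aA); have := v2 b (AK b bA); lra.
Qed.

Section Arrangement.
Variables (k t : nat) (c : nat -> nat -> bool) (x0 : T) (s q : seq T).
Hypotheses (sk : size s = k) (qt : size q = t) (us : uniq s) (uq : uniq q).
Hypotheses (sK : s =i K) (qI : q =i I).
Hypothesis bdd : rayleigh_bounded (@split_rel k t c) r.

(** The neighbour sum of H at the independent vertex of index [i] (counted from 0), when the clique
    vertices of H carry the weights listed by [s]. *)
Definition hrow (i : nat) : R := \sum_(j < k | c i.+1 j.+1) w (nth x0 s j).

Lemma sum_nth_seq (m : nat) (z : seq T) (A : {set T}) (F : T -> R) :
  size z = m -> uniq z -> z =i A ->
  \sum_(j < m) F (nth x0 z j) = \sum_(v in A) F v.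
Proof.
move=> <- uz zA; rewrite -(eq_bigl _ _ zA) -(big_uniq _ uz) /=.
by rewrite [RHS](big_nth x0) big_mkord.
Qed.

Let f (x : 'I_k + 'I_t) := match x with
  inl j => w (nth x0 s j) | inr i => w (nth x0 q i) end.

Let sum_f (F : R -> R) :
  \sum_x F (f x) = \sum_(v in K) F (w v) + \sum_(u in I) F (w u).
Proof.
rewrite big_sumType /=; congr (_ + _); first exact: (sum_nth_seq (fun v => F (w v))).
exact: (sum_nth_seq (fun v => F (w v))).
Qed.

Lemma wtK_arrange : \sum_(j < k) w (nth x0 s j) = wt K.
Proof. exact: (sum_nth_seq w). Qed.

Let col_sum : \sum_(v in K) w v * (\sum_(x in K) w x + \sum_(u in column e I v) w u) =
  (r + 1) * \sum_(v in K) w v ^+ 2.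
Proof. by rewrite mulr_sumr; apply: eq_bigr => v /(pw_col PW)->; ring. Qed.

Let cross_sum : \sum_(v in K) w v * (\sum_(u in column e I v) w u) =
  r * \sum_(u in I) w u ^+ 2.
Proof.
transitivity (\sum_(u in I) w u * \sum_(v in K | e u v) w v).
  under eq_bigr do rewrite mulr_sumr.
  under [RHS]eq_bigr do rewrite mulr_sumr.
  rewrite (exchange_big_dep (mem I)) /= => [|v u _]; last by rewrite inE => /andP[].
  apply: eq_bigr => u uI; rewrite (eq_bigl (fun v => (v \in K) && e u v)).
    by apply: eq_bigr => v _; rewrite mulrC.
  by move=> v; rewrite !inE uI (ks_sym KS).
by rewrite mulr_sumr; apply: eq_bigr => u /(pw_row PW)->; ring.
Qed.

Let norm_sum : \sum_x f x ^+ 2 = \sum_(v in K) w v ^+ 2 + \sum_(u in I) w u ^+ 2.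
Proof. exact: (sum_f (fun a => a ^+ 2)). Qed.

Let rowE (i : 'I_t) : \sum_(y | split_rel c (inr i) y) f y = hrow i.
Proof. by rewrite big_sumType /= [X in _ + X]big1 ?addr0. Qed.

Let quadE : \sum_x f x * (\sum_(y | split_rel c x y) f y) =
  wt K ^+ 2 - \sum_(v in K) w v ^+ 2
  + 2 * \sum_(i < t) w (nth x0 q i) * hrow i.
Proof.
rewrite big_sumType /=; under [X in _ + X]eq_bigr do rewrite rowE.
under eq_bigr => j _.
  rewrite big_sumType /= mulrDr (_ : \sum_(i | _) _ = wt K - w (nth x0 s j)); last first.
    rewrite -wtK_arrange [in RHS](bigD1 j) //= addrAC subrr add0r.
    by apply: eq_bigl => i; rewrite eq_sym.
  rewrite mulrBr -expr2.
  over.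
rewrite !big_split /= sumrN -mulr_suml wtK_arrange -expr2.
rewrite (sum_nth_seq (fun v => w v ^+ 2) sk us sK) mulr2n mulrDl !mul1r.
rewrite -!addrA; congr (_ + (_ + _)); rewrite addrC [RHS]addrC; congr (_ + _).
under eq_bigr do rewrite mulr_sumr.
under [RHS]eq_bigr do rewrite mulr_sumr.
rewrite (exchange_big_dep xpredT) //=; apply: eq_bigr => i _.
by apply: eq_bigr => j _; rewrite mulrC.
Qed.

(** The eigenvalue equations of G bring [r] times the squared norm to the shape of [quadE], with the
    same clique part; only the cross terms differ. *)
Let normE : r * \sum_x f x ^+ 2 = wt K ^+ 2 - \sum_(v in K) w v ^+ 2
  + 2 * \sum_(i < t) w (nth x0 q i) * (r * w (nth x0 q i)).
Proof.
have := col_sum; under eq_bigr do rewrite mulrDr.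
rewrite big_split /= cross_sum -mulr_suml -[X in X ^+ 2]/(wt K) norm_sum.
rewrite (sum_nth_seq (fun v => w v * (r * w v)) qt uq qI).
have -> : \sum_(u in I) w u * (r * w u) = r * \sum_(u in I) w u ^+ 2.
  by rewrite mulr_sumr; apply: eq_bigr => u _; ring.
rewrite -[\sum_(x in K) w x]/(wt K).
move: (wt K) (\sum_(u in I) _) (\sum_(v in K) _) => a b d; lra.
Qed.

Lemma arrange_le :
  \sum_(i < t) w (nth x0 q i) * (hrow i - r * w (nth x0 q i)) <= 0.
Proof.
have [le_f _] := bdd f; move: le_f; rewrite quadE normE.
under [X in _ -> X <= _]eq_bigr do rewrite mulrBr.
by rewrite sumrB; lra.
Qed.

(** A vanishing sum means that the transported vector attains [r], so it is an eigenvector of H; its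
    equations at the independent vertices are kept. *)
Lemma arrange_eq :
  \sum_(i < t) w (nth x0 q i) * (hrow i - r * w (nth x0 q i)) = 0 ->
  forall i, (i < t)%N -> hrow i = r * w (nth x0 q i).
Proof.
under eq_bigr do rewrite mulrBr.
rewrite sumrB => sum0 i it; have [_ eq_f] := bdd f.
by have := eq_f _ (inr (Ordinal it)); rewrite rowE; apply; rewrite quadE normE; lra.
Qed.

Lemma hrow_all_but i j0 : (j0 < k)%N ->
  (forall j, (j < k)%N -> c i.+1 j.+1 = (j != j0)) ->
  hrow i = wt K - w (nth x0 s j0).
Proof.
move=> j0k cE; rewrite -wtK_arrange [in RHS](bigD1 (Ordinal j0k)) //= addrAC subrr add0r.
by apply: eq_bigl => j; rewrite cE.
Qed.

Lemma hrow_one i j0 : (j0 < k)%N ->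
  (forall j, (j < k)%N -> c i.+1 j.+1 = (j == j0)) -> hrow i = w (nth x0 s j0).
Proof.
move=> j0k cE; rewrite /hrow (big_pred1 (Ordinal j0k)) // => j.
by rewrite cE.
Qed.

Lemma hrow_two i j0 j1 : (j0 < k)%N -> (j1 < k)%N -> j0 != j1 ->
  (forall j, (j < k)%N -> c i.+1 j.+1 = (j == j0) || (j == j1)) ->
  hrow i = w (nth x0 s j0) + w (nth x0 s j1).
Proof.
move=> j0k j1k j01 cE; rewrite /hrow (bigD1 (Ordinal j0k)) /=; last first.
  by rewrite cE ?eqxx.
rewrite (big_pred1 (Ordinal j1k)) // => j; rewrite cE // -!val_eqE [RHS]/(nat_of_ord j == j1) /=.
exact: eq_pred2_left.
Qed.
End Arrangement.
End Weights.

Local Close Scope ring_scope.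

(** * Alternating paths and listings of vertices *)

Fixpoint alternate (T : Type) (z : seq (T * T)) : seq T :=
  if z is (v, u) :: z' then v :: u :: alternate z' else [::].

Section Helpers.
Variables (T : finType) (e : rel T) (K I : {set T}).
Hypothesis KS : K14_split e K I.

Lemma neqKI v u : v \in K -> u \in I -> (v != u) * (u != v).
Proof.
move=> vK uI; rewrite [u == v]eq_sym.
by have -> : v != u by apply: contraTneq vK => ->; apply: (ks_notK KS).
Qed.

Lemma mem_alternate (z : seq (T * T)) x :
  (x \in alternate z) = (x \in unzip1 z) || (x \in unzip2 z).
Proof. by elim: z => [|[v u] z IHz] //=; rewrite !inE IHz; do 2!case: eqP; rewrite ?orbT. Qed.

Lemma uniq_alternate (z : seq (T * T)) : uniq (unzip1 z) -> uniq (unzip2 z) ->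
  {subset unzip1 z <= K} -> {subset unzip2 z <= I} -> uniq (alternate z).
Proof.
elim: z => [|[v u] z IHz] //= /andP[vz uz1] /andP[uz uz2] subK subI.
have vK : v \in K by apply: subK; rewrite mem_head.
have uI : u \in I by apply: subI; rewrite mem_head.
have sK : {subset unzip1 z <= K} by move=> x xz; apply: subK; rewrite inE xz orbT.
have sI : {subset unzip2 z <= I} by move=> x xz; apply: subI; rewrite inE xz orbT.
rewrite IHz // andbT inE !mem_alternate !negb_or vz uz (neqKI vK uI) !andbT /=.
apply/andP; split.
  by apply: contraTN vK => /sI; apply: (ks_notK KS).
by apply: contraTN uI => /sK; apply: (ks_notI KS).
Qed.

Lemma size_alternate (z : seq (T * T)) : size (alternate z) = (size z).*2.
Proof. by elim: z => [|[v u] z IHz] //=; rewrite IHz. Qed.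

Lemma hamiltonian_alternate_path (z : seq (T * T)) l : 0 < size z ->
  uniq (rcons (unzip1 z) l) -> uniq (unzip2 z) ->
  {subset rcons (unzip1 z) l <= K} -> unzip2 z =i I ->
  sorted e (rcons (alternate z) l) -> hamiltonian e.
Proof.
case: z => // -[v u] z _; set z0 := (v, u) :: z; rewrite rcons_uniq => /andP[lz uz1] uz2 subK memI.
have lK : l \in K by apply: subK; rewrite mem_rcons mem_head.
have sK : {subset unzip1 z0 <= K} by move=> x xz; apply: subK; rewrite mem_rcons inE xz orbT.
have sI : {subset unzip2 z0 <= I} by move=> x; rewrite memI.
have u_alt : uniq (rcons (alternate z0) l).
  rewrite rcons_uniq uniq_alternate // andbT mem_alternate negb_or lz.
  by rewrite memI (ks_notI KS).
move=> path_z; apply: (hamiltonian_path KS (x := v) (c := rcons (u :: alternate z) l)) => //.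
- apply: leq_trans (max_card (mem (rcons (alternate z0) l))).
  by rewrite (card_uniqP u_alt) /= size_rcons.
- by apply: sK; rewrite mem_head.
- by rewrite last_rcons.
move=> x; rewrite -memI => xz.
by rewrite -[v :: _]/(rcons (alternate z0) l) mem_rcons inE mem_alternate xz !orbT.
Qed.

Lemma hamiltonian_alternate_cycle (z : seq (T * T)) : 1 < size z ->
  uniq (unzip1 z) -> uniq (unzip2 z) ->
  {subset unzip1 z <= K} -> unzip2 z =i I -> cycle e (alternate z) ->
  (forall f, f \in K -> f \notin unzip1 z -> exists2 u, u \in I & e f u) ->
  hamiltonian e.
Proof.
move=> z1 uz1 uz2 sK memI ez ext; apply: (hamiltonian_cycle KS (c := alternate z)).
- by rewrite size_alternate; lia.
- by rewrite /ucycle ez uniq_alternate // => x; rewrite memI.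
- by move=> x xI; rewrite mem_alternate memI xI orbT.
by move=> f fK; rewrite mem_alternate negb_or => /andP[fz _]; apply: ext.
Qed.

Lemma ex_notin (s : seq T) : size s < #|K| -> exists2 v, v \in K & v \notin s.
Proof.
move=> lt_s; apply/exists_inP; apply: contraLR lt_s => /exists_inPn sK.
rewrite -leqNgt; apply: leq_trans (card_size s); apply/subset_leq_card/subsetP.
by move=> x /sK; rewrite negbK.
Qed.

Lemma mem_column u v : (u \in column e I v) = (u \in I) && e u v.
Proof. by rewrite inE (ks_sym KS). Qed.

Lemma card_column (q : seq T) v : uniq q -> q =i I ->
  #|column e I v| = count (e^~ v) q.
Proof.
move=> uq qI; rewrite -size_filter -(card_uniqP (filter_uniq _ uq)).
by apply: eq_card => u; rewrite mem_filter mem_column qI andbC.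
Qed.

Lemma missed1 u a v : missed e K u = [set a] -> v \in K -> e u v = (v != a).
Proof. by move=> /setP/(_ v); rewrite !inE => + vK; rewrite vK /= => <-; rewrite negbK. Qed.

Lemma nbr1 u a v : nbr e K u = [set a] -> v \in K -> e u v = (v == a).
Proof. by move=> /setP/(_ v); rewrite !inE => + vK; rewrite vK. Qed.

Lemma missed_neq0 u : u \in I -> missed e K u != set0.
Proof. by case/(ks_miss KS) => v vK nuv; apply/set0Pn; exists v; rewrite inE vK. Qed.

Lemma nbr_neq0 u : u \in I -> nbr e K u != set0.
Proof. by case/(ks_row KS) => v vK nuv; apply/set0Pn; exists v; rewrite inE vK. Qed.

Lemma missed_sub u : missed e K u \subset K.
Proof. by apply/subsetP => v; rewrite inE => /andP[]. Qed.

Lemma nbr_sub u : nbr e K u \subset K.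
Proof. by apply/subsetP => v; rewrite inE => /andP[]. Qed.

(** The exceptional clique vertices of H are mostly the first and the last one, so these two places
    are prescribed: [b] comes first and [a] last. *)
Lemma listing_ends a b x0 : a \in K -> b \in K -> a != b -> exists s : seq T,
  [/\ uniq s, s =i K, size s = #|K|, nth x0 s 0 = b & nth x0 s #|K|.-1 = a].
Proof.
move=> aK bK ab; exists (b :: rcons (enum (K :\ a :\ b)) a).
have us : uniq (b :: rcons (enum (K :\ a :\ b)) a).
  rewrite /= rcons_uniq enum_uniq mem_rcons inE negb_or !mem_enum !inE !eqxx.
  by rewrite [b == a]eq_sym ab ?andbF.
have sK : b :: rcons (enum (K :\ a :\ b)) a =i K.
  move=> x; rewrite inE mem_rcons inE mem_enum !inE.
  by case: eqVneq => [->|_]; case: eqVneq => [->|_] //=; rewrite ?aK ?bK.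
have ss : size (b :: rcons (enum (K :\ a :\ b)) a) = #|K|.
  by rewrite -(card_uniqP us); apply: eq_card.
by split; rewrite // -ss /= size_rcons /= nth_rcons ltnn eqxx.
Qed.
Lemma perm_listing (q q' : seq T) : perm_eq q q' -> uniq q -> q =i I ->
  uniq q' /\ q' =i I.
Proof.
by move=> pq; rewrite -(perm_uniq pq) => uq qI; split=> // x; rewrite -(perm_mem pq).
Qed.
End Helpers.

Section OrderHelpers.
Variables (R : realFieldType) (T : finType) (w : T -> R).
Local Open Scope ring_scope.

Lemma min_weight (A : {set T}) : A != set0 ->
  exists2 a, a \in A & forall v, v \in A -> w a <= w v.
Proof.
case/set0Pn => x xA; case: (@arg_minP _ _ _ x (mem A) w xA) => a aA min_a.
by exists a.
Qed.

Lemma min_weight2 (A : {set T}) : (1 < #|A|)%N -> exists a b,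
  [/\ a \in A, b \in A, a != b, forall v, v \in A -> w a <= w v
    & forall v, v \in A -> v != a -> w b <= w v].
Proof.
move=> A1; have [|a aA min_a] := @min_weight A.
  by rewrite -card_gt0; apply: leq_trans A1.
have [|b] := @min_weight (A :\ a).
  by rewrite -card_gt0; move: A1; rewrite (cardsD1 a) aA.
rewrite !inE => /andP[ba bA] min_b; exists a, b; split=> //; first by rewrite eq_sym.
by move=> v vA va; apply: min_b; rewrite !inE va.
Qed.

(** The order is decreasing. With a constant weight the lemma merely enumerates [A]. *)
Lemma sorted_listing (A : {set T}) : exists q : seq T,
  [/\ uniq q, q =i A, size q = #|A| & sorted (fun a b => w b <= w a) q].
Proof.
exists (sort (fun a b => w b <= w a) (enum A)); split.
- by rewrite sort_uniq enum_uniq.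
- by move=> x; rewrite mem_sort mem_enum.
- by rewrite size_sort -cardE.
by apply: sort_sorted => a b; apply: le_total.
Qed.
End OrderHelpers.

(** * Four independent vertices *)

Section FourHam.
Variables (T : finType) (e : rel T) (K I : {set T}).
Hypothesis KS : K14_split e K I.

Lemma neq_row u v v' : ~~ e u v -> e u v' -> (v != v') * (v' != v).
Proof.
move=> nuv uv'; rewrite [v' == v]eq_sym; suff -> : v != v' by [].
by apply: contraNneq nuv => ->.
Qed.

Lemma column_ext v : 0 < #|column e I v| -> exists2 u, u \in I & e v u.
Proof. by case/card_gt0P => u; rewrite inE => /andP[uI evu]; exists u. Qed.

(** Suppose some column has size 3. If the column of [c] is smaller, it consists of [u] and [u'],
    which lie in no other column, so the two columns cannot meet. If it has size 3, its third member
    [g] misses some [v']; the columns of [c] and [v'] must meet in a vertex other than [u], [u'] and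
    [g], a fourth member. *)
Lemma pendants_apart u u' c : u \in I -> u' \in I -> u != u' -> c \in K ->
  nbr e K u = [set c] -> nbr e K u' = [set c] ->
  forall v, v \in K -> (#|column e I v| <= 2)%N.
Proof.
move=> iI jI ij cK Ni Nj v vK; rewrite leqNgt; apply/negP => c3v.
have c3 : #|column e I v| = 3%N by apply/eqP; rewrite eqn_leq c3v (ks_col KS).
have eic : e u c by rewrite (nbr1 Ni) // eqxx.
have ejc : e u' c by rewrite (nbr1 Nj) // eqxx.
have [c3c|c2c] := leqP 3 #|column e I c|.
  have {}c3c : #|column e I c| = 3%N by apply/eqP; rewrite eqn_leq c3c (ks_col KS).
  have [g] : exists g, g \in column e I c :\ u :\ u'.
    apply/card_gt0P; move: c3c; rewrite (cardsD1 u) (cardsD1 u') !inE iI jI.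
    by rewrite !(ks_sym KS c) eic ejc eq_sym ij /=; move: #|_ :\ u'| => -[].
  rewrite !inE => /and4P[gj gi gI ecg].
  have [v' v'K ngv'] := ks_miss KS gI.
  have [y] := ks_meet KS cK v'K c3c; rewrite !(mem_column KS) => /andP[yI eyc] /andP[_ eyv'].
  have v'c : v' != c by apply: contraNneq ngv' => ->; rewrite (ks_sym KS).
  have yg : y != g by apply: contraNneq ngv' => <-.
  have yi : y != u by apply: contraTneq eyv' => ->; rewrite (nbr1 Ni).
  have yj : y != u' by apply: contraTneq eyv' => ->; rewrite (nbr1 Nj).
  have : y |: (g |: (u |: [set u'])) \subset column e I c.
    apply/subsetP => t; rewrite !inE => /or4P[] /eqP->;
    by rewrite ?yI ?gI ?iI ?jI (ks_sym KS c) //= 1?(ks_sym KS g).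
  by move/subset_leq_card; rewrite c3c !cardsU1 !inE !negb_or yg yi yj gi gj ij /= cards1.
have [y] := ks_meet KS vK cK c3; rewrite !(mem_column KS) => /andP[yI eyv] /andP[_ eyc].
have vc : v != c by apply: contraTneq c2c => <-; rewrite c3.
have yi : y != u by apply: contraTneq eyv => ->; rewrite (nbr1 Ni).
have yj : y != u' by apply: contraTneq eyv => ->; rewrite (nbr1 Nj).
have : y |: (u |: [set u']) \subset column e I c.
  apply/subsetP => t; rewrite !inE => /or3P[] /eqP->;
  by rewrite ?yI ?iI ?jI (ks_sym KS c).
move/subset_leq_card; rewrite !cardsU1 !inE !negb_or yi yj ij /= cards1 => le3.
by move: c2c; rewrite ltnNge le3.
Qed.

(** A column of size 3 omits exactly one vertex of [I]. So a clique vertex with such a column that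
    is missed by one row is joined to the three others; vertices of this kind are the joints of the
    cycles. *)
Lemma hamiltonian_four : #|I| = 4 -> 4 <= #|K| ->
  #|[set v in K | #|column e I v| <= 2]| <= 1 -> hamiltonian e.
Proof.
move=> I4 K4 small1.
have col_missed v u u' : v \in K -> #|column e I v| = 3 -> u \in I -> ~~ e u v ->
    u' \in I -> u' != u -> e v u'.
  move=> vK c3 uI nuv u'I u'u.
  have cI : #|I :\ u| = 3 by move: I4; rewrite (cardsD1 u) uI => -[].
  have /eqP : column e I v == I :\ u.
    rewrite eqEcard c3 cI leqnn andbT.
    apply/subsetP => y; rewrite (mem_column KS) !inE => /andP[-> eyv].
    by rewrite andbT; apply: contraNneq nuv => <-.
  by move/setP/(_ u'); rewrite !inE u'I u'u.
have [small0|[s]] := set_0Vmem [set v in K | #|column e I v| <= 2].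
  have all3 v : v \in K -> #|column e I v| = 3.
    move=> vK; apply/eqP; rewrite eqn_leq (ks_col KS vK) ltnNge.
    by apply/negP => c2; have := in_set0 v; rewrite -small0 inE vK c2.
  have /card_gt0P[] : 0 < #|I| by rewrite I4.
  have [q [uq qI sq _]] := @sorted_listing rat _ (fun=> 0%R) I; rewrite I4 in sq.
  case: q uq qI sq => [|x [|y [|z [|j [|? ?]]]]] // uq qI _ _ _.
  have memI : [/\ x \in I, y \in I, z \in I & j \in I] by rewrite -!qI !inE !eqxx !orbT.
  case: memI => xI yI zI jI.
  have := uq; rewrite /= !inE !negb_or => /and4P[/and3P[xy xz xj] /andP[yz yj] zj _].
  have [a aK xa] := ks_miss KS xI; have [b bK yb] := ks_miss KS yI.
  have [c cK zc] := ks_miss KS zI; have [d dK jd] := ks_miss KS jI.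
  have ea u : u \in I -> u != x -> e a u by apply: col_missed xa; rewrite ?all3.
  have eb u : u \in I -> u != y -> e b u by apply: col_missed yb; rewrite ?all3.
  have ec u : u \in I -> u != z -> e c u by apply: col_missed zc; rewrite ?all3.
  have ed u : u \in I -> u != j -> e d u by apply: col_missed jd; rewrite ?all3.
  have sym := ks_sym KS.
  apply: (hamiltonian_alternate_cycle KS (z := [:: (a, y); (c, x); (d, z); (b, j)])) => //.
  - have [xc xd xb] : [/\ e x c, e x d & e x b] by rewrite ![e x _]sym ec ?ed ?eb.
    have [zd zb jb] : [/\ e z d, e z b & e j b].
      by rewrite ![e z _]sym [e j _]sym ed ?eb // eq_sym.
    rewrite /= !inE !negb_or !(neq_row xa xc) !(neq_row xa xd) !(neq_row xa xb).
    by rewrite !(neq_row zc zd) !(neq_row zc zb) !(neq_row jd jb).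
  - by rewrite /= !inE !negb_or [y == x]eq_sym yz xz xy yj xj zj.
  - by move=> v; rewrite !inE => /or4P[] /eqP->.
  - by move=> u; rewrite -qI !inE orbCA.
  - rewrite /= !andbT ea 1?eq_sym // [e y c]sym ec // ec // [e x d]sym ed //.
    by rewrite ed // [e z b]sym eb 1?eq_sym // eb 1?eq_sym // sym ea // eq_sym.
  - by move=> f fK _; apply: column_ext; rewrite all3.
rewrite inE => /andP[sK cs].
have all3 v : v \in K -> v != s -> #|column e I v| = 3.
  move=> vK vs; apply/eqP; rewrite eqn_leq (ks_col KS vK) ltnNge.
  apply/negP => c2; move: small1; rewrite leqNgt => /negP; apply.
  by apply/card_gt1P; exists v, s; rewrite !inE vK sK c2 cs vs.
have meets v : v \in K -> v != s -> exists2 u, u \in column e I v & u \in column e I s.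
  by move=> vK vs; apply: (ks_meet KS) => //; apply: all3.
(* All other columns have size 3 and must meet that of [s]. If that were a single vertex [g], a
   clique vertex missed by [g] would contradict this. *)
have cs2 : #|column e I s| == 2.
  rewrite eqn_leq cs ltnNge; apply/negP => le1.
  have [v vK] := @ex_notin _ K [:: s] (leq_trans (isT : 1 < 4) K4); rewrite inE => vs.
  have [g gv gs] := meets v vK vs.
  have gI : g \in I by move: gs; rewrite inE => /andP[].
  have [v' v'K] := ks_miss KS gI; case/negP.
  have [->|v's] := eqVneq v' s; first by move: gs; rewrite (mem_column KS) => /andP[].
  have [g' + g's] := meets v' v'K v's; rewrite (mem_column KS).
  have /card_le1_eqP/(_ g g' gs g's) -> := le1.
  by case/andP.
have /cards2P[g [h [gh col_s]]] := cs2.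
have [gs hs] : g \in column e I s /\ h \in column e I s by rewrite col_s !inE !eqxx orbT.
move: gs hs; rewrite !inE => /andP[gI esg] /andP[hI esh].
have : #|I :\ g :\ h| == 2.
  by move: I4; rewrite (cardsD1 g) gI (cardsD1 h) !inE hI eq_sym gh => -[] /eqP.
case/cards2P => m [n [mn defI]].
have : [/\ m \in I :\ g :\ h, n \in I :\ g :\ h & true] by rewrite defI !inE !eqxx orbT.
case; rewrite !inE => /and3P[mh mg mI] /and3P[nh ng nI] _.
have memI u : (u \in I) = [|| u == g, u == h, u == m | u == n].
  have /setP/(_ u) := defI; rewrite !inE.
  have [->|ug] := eqVneq u g; first by rewrite gI.
  by have [->|uh] := eqVneq u h; first by rewrite hI.
have [c cK gc] := ks_miss KS gI; have [d dK hd] := ks_miss KS hI.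
have sym := ks_sym KS.
have gs : e g s by rewrite sym.
have hs : e h s by rewrite sym.
have cs' := neq_row gc gs; have ds := neq_row hd hs.
have ec u : u \in I -> u != g -> e c u by apply: col_missed gc; rewrite ?all3 // cs'.
have ed u : u \in I -> u != h -> e d u by apply: col_missed hd; rewrite ?all3 // ds.
have gd : e g d by rewrite sym ed.
have cd := neq_row gc gd.
have [f fK] := @ex_notin _ K [:: s; c; d] K4; rewrite !inE !negb_or => /and3P[fs fc fd].
have f3 := all3 f fK fs.
have ext v : v \in K -> exists2 u, u \in I & e v u.
  move=> vK; apply: column_ext; have [->|vs] := eqVneq v s; last by rewrite all3.
  by rewrite (eqP cs2).
(* Here [m] and [n] are the vertices of [I] that [s] misses. If [f] misses one of them, [f] links
   [g] to the other one; otherwise [f] links [m] to [n]. *)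
have ham_m m' n' : m' \in I -> n' \in I -> m' != g -> m' != h -> n' != g -> n' != h -> m' != n' ->
    (forall u, (u \in I) = [|| u == g, u == h, u == m' | u == n']) -> ~~ e m' f -> hamiltonian e.
  move=> m'I n'I m'g m'h n'g n'h m'n' memI' m'f.
  have ef u : u \in I -> u != m' -> e f u by apply: col_missed m'f.
  apply: (hamiltonian_alternate_cycle KS (z := [:: (s, g); (f, n'); (d, m'); (c, h)])) => //.
  - by rewrite /= !inE !negb_or eq_sym fs !ds !cs' fd fc !cd.
  - by rewrite /= !inE !negb_or [g == n']eq_sym [g == m']eq_sym n'g m'g gh eq_sym m'n' n'h m'h.
  - by move=> v; rewrite !inE => /or4P[] /eqP->.
  - by move=> u; rewrite memI' /= !inE; case: (u == g); case: (u == h); case: (u == m'); case: (u == n').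
  - rewrite /= esg [e g f]sym ef 1?eq_sym // ef 1?eq_sym // [e n' d]sym ed // ed //.
    by rewrite [e m' c]sym ec // ec 1?eq_sym // hs.
  - by move=> v vK _; apply: ext.
have [mf|mf] := boolP (e m f); last exact: (ham_m m n).
have [nf|nf] := boolP (e n f); last first.
  apply: (ham_m n m) => //; first by rewrite eq_sym.
  by move=> u; rewrite memI [_ || (u == n)]orbC.
apply: (hamiltonian_alternate_cycle KS (z := [:: (s, g); (d, m); (f, n); (c, h)])) => //.
- by rewrite /= !inE !negb_or [s == f]eq_sym fs !ds !cs' [d == f]eq_sym fd fc !cd.
- by rewrite /= !inE !negb_or [g == n]eq_sym [g == m]eq_sym ng mg gh mn nh mh.
- by move=> v; rewrite !inE => /or4P[] /eqP->.
- by move=> u; rewrite memI /= !inE; case: (u == g); case: (u == h); case: (u == m); case: (u == n).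
- rewrite /= esg [e g d]sym ed // ed // mf sym nf [e n c]sym ec // ec 1?eq_sym // hs //.
by move=> v vK _; apply: ext.
Qed.
End FourHam.

Local Open Scope ring_scope.

(** * Column equations and deficiency *)

Section ColumnWeights.
Variables (R : realFieldType) (T : finType) (e : rel T) (K I : {set T}).
Variables (w : T -> R) (r : R).
Hypothesis KS : K14_split e K I.
Hypothesis PW : perron_weights e K I w r.

Lemma column_eq (q : seq T) v : uniq q -> q =i I -> v \in K ->
  (r + 1) * w v = wt w K + \sum_(u <- q) (if e u v then w u else 0).
Proof.
move=> uq qI vK; rewrite -(pw_col PW vK); congr (_ + _).
rewrite -big_mkcond /= [RHS]big_mkcond /= (big_uniq _ uq) /= (eq_bigl _ _ qI).
rewrite -big_mkcondr; apply: eq_bigl => u.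
by rewrite (mem_column KS).
Qed.

Lemma sum_rows_seq (q : seq T) : uniq q -> q =i I ->
  \sum_(u <- q) r * w u = \sum_(v in K) w v *+ #|column e I v|.
Proof.
by move=> uq qI; rewrite -(sum_rows KS PW) (big_uniq _ uq) (eq_bigl _ _ qI).
Qed.

(** A weighted double count of the cross edges. The reference size [m] is 3 for four or more rows
    and 2 for three rows. *)
Lemma sum_deficiency (m : nat) (q : seq T) : uniq q -> q =i I ->
  m%:R * wt w K - \sum_(u <- q) r * w u =
  \sum_(v in K) (m%:R - #|column e I v|%:R) * w v.
Proof.
move=> uq qI; rewrite (sum_rows_seq uq qI) mulr_sumr -sumrB.
by apply: eq_bigr => v _; rewrite mulrBl [X in _ = _ - X]mulr_natl.
Qed.

Lemma deficiency_ge (A : {set T}) : (forall v, v \in K -> (#|column e I v| <= 3)%N) ->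
  A \subset K -> (forall v, v \in A -> (#|column e I v| <= 2)%N) ->
  wt w A <= \sum_(v in K) (3 - #|column e I v|%:R) * w v.
Proof.
move=> le3 /subsetP AK le2; rewrite /wt [leRHS](big_setID A) /=.
have -> : \sum_(v in K :&: A) (3 - #|column e I v|%:R) * w v =
          \sum_(v in A) (3 - #|column e I v|%:R) * w v.
  apply: eq_bigl => v; rewrite inE andbC; case vA: (v \in A) => //=.
  exact: AK.
rewrite ler_wpDr //.
  apply: sumr_ge0 => v; rewrite inE => /andP[_ /le3].
  by rewrite -(ler_nat R) => le3v; rewrite mulr_ge0 ?subr_ge0 // ltW // (pw_gt0 PW).
apply: ler_sum => v /le2; rewrite -(ler_nat R) => le2v.
by rewrite ler_peMl ?(ltW (pw_gt0 PW v)) //; lra.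
Qed.
End ColumnWeights.

Lemma Gamma_cross4 n k j : k = (n - 4)%N -> (4 <= k)%N -> (j < k)%N ->
  [/\ Gamma_cross n 4 1 j.+1 = (j != k.-1), Gamma_cross n 4 2 j.+1 = (j != k.-1),
      Gamma_cross n 4 3 j.+1 = (j != 0)%N & Gamma_cross n 4 4 j.+1 = (j == k.-1)].
Proof. by rewrite /Gamma_cross /=; split; lia. Qed.

(** Summation by parts for the order x >= y >= z >= j. Splitting off x - z and y - z leaves z times
    the missed weight of the three heavy rows in excess of 2 a + b; writing z as (z - j) + j then
    brings in the deficiency in excess of a + b, which is that of H. *)
Lemma four_rows_ineq (R : realFieldType) (x y z j r P a b : R) :
  y <= x -> z <= y -> j <= z -> 0 < j -> a <= P - r * x -> a <= P - r * y ->
  a + a + b <= P - r * x + (P - r * y) + (P - r * z) ->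
  a + b <= 3 * P - (r * x + (r * y + (r * z + (r * j + 0)))) ->
  0 <= x * (P - a - r * x) + y * (P - a - r * y) + z * (P - b - r * z)
       + j * (a - r * j).
Proof.
move=> yx zy jz j0 Ax Ay key1 key2.
have t1 : 0 <= (x - z) * (P - r * x - a) by apply: mulr_ge0; lra.
have t2 : 0 <= (y - z) * (P - r * y - a) by apply: mulr_ge0; lra.
have t3 : 0 <= (z - j) * (P - r * x + (P - r * y) + (P - r * z) - (a + a + b)).
  by apply: mulr_ge0; lra.
have t4 : 0 <= j * (3 * P - (r * x + (r * y + (r * z + (r * j + 0)))) - (a + b)).
  by apply: mulr_ge0; lra.
by lra.
Qed.

Lemma perm_eq4 (T : eqType) (x y z j : T) :
  [/\ perm_eq [:: x; y; z; j] [:: x; z; y; j],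
      perm_eq [:: x; y; z; j] [:: y; z; x; j],
      perm_eq [:: x; y; z; j] [:: z; x; y; j]
    & perm_eq [:: x; y; z; j] [:: z; y; x; j]].
Proof. by split; apply/permP => p /=; lia. Qed.

Section Four.
Variables (T : finType) (e : rel T) (K I : {set T}).
Hypothesis KS : K14_split e K I.

Lemma iso_Gamma4 n k g g' h j c d : k = (n - 4)%N -> #|K| = k -> (4 <= k)%N ->
  uniq [:: g; g'; h; j] -> [:: g; g'; h; j] =i I ->
  missed e K g = [set c] -> missed e K g' = [set c] -> missed e K h = [set d] ->
  nbr e K j = [set c] -> c \in K -> d \in K -> c != d ->
  graph_iso e (@split_rel k 4 (Gamma_cross n 4)).
Proof.
move=> kn Kk k4 uq qI Mg Mg' Mh Nj cK dK cd.
have [s [us sK ss s0 sl]] := listing_ends g cK dK cd.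
rewrite Kk in ss sl.
have nthE i j0 : (i < k)%N -> (j0 < k)%N -> (nth g s i == nth g s j0) = (i == j0).
  by move=> ik jk; rewrite nth_uniq ?ss.
apply: (graph_iso_split KS (x0 := g) (s := s) (q := [:: g; g'; h; j])) => //.
move=> i l i4 lk; have lK : nth g s l \in K by rewrite -sK mem_nth ?ss.
have [c0 c1 c2 c3] := Gamma_cross4 kn k4 lk; have k0 : (k.-1 < k)%N by rewrite prednK ?leqnn ?(leq_trans _ k4).
case: i i4 => [|[|[|[|//]]]] _; rewrite ?c0 ?c1 ?c2 ?c3 /= ?(missed1 Mg) ?(missed1 Mg') ?(missed1 Mh) ?(nbr1 Nj) //.
1,2,4: by rewrite -sl nthE.
by rewrite -s0 nthE // (leq_trans _ k4).
Qed.
End Four.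

Section FourWeights.
Variables (R : realFieldType) (T : finType) (e : rel T) (K I : {set T}).
Variables (w : T -> R) (r : R).
Hypothesis KS : K14_split e K I.
Hypothesis PW : perron_weights e K I w r.
Hypothesis r_gt0 : 0 < r.

(** The column of [c] is {g, g', j}. If a = b, the column of [a] is {h} and the two do not meet. If
    a and b differ, the column of [b] is {g, h}; since w(b) = w(c), the columns weigh the same and
    the missed vertices give w(g') = w(h), whence w(j) = 0. *)
Lemma no_spread4 g g' h j c a b :
  uniq [:: g; g'; h; j] -> [:: g; g'; h; j] =i I ->
  missed e K g = [set a] -> missed e K g' = [set b] -> missed e K h = [set c] ->
  nbr e K j = [set c] -> a \in K -> b \in K -> c \in K ->
  a != c -> b != c -> w b = w c -> False.
Proof.
move=> uq qI Mg Mg' Mh Nj aK bK cK ac bc wbc.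
have eg v : v \in K -> e g v = (v != a) by apply: missed1.
have eg' v : v \in K -> e g' v = (v != b) by apply: missed1.
have eh v : v \in K -> e h v = (v != c) by apply: missed1.
have ej v : v \in K -> e j v = (v == c) by apply: nbr1.
have c3 : #|column e I c| = 3%N.
  by rewrite (card_column KS c uq qI) /= eg // eg' // eh // ej // ![c == _]eq_sym ac bc eqxx.
have [ab|ab] := eqVneq a b.
  have [u] := ks_meet KS cK aK c3; rewrite !(mem_column KS) => /andP[uI euc] /andP[_].
  move: uI; rewrite -qI !inE => /or4P[] /eqP def_u; rewrite def_u in euc *.
  - by rewrite eg ?eqxx.
  - by rewrite eg' // ab eqxx.
  - by move: euc; rewrite eh ?eqxx.
  - by rewrite ej // (negPf ac).
have Ec := column_eq KS PW uq qI cK; have Eb := column_eq KS PW uq qI bK.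
have uI u : u \in [:: g; g'; h; j] -> u \in I by rewrite qI.
have Wg' := wt_missed PW (uI g' _); have Wh := wt_missed PW (uI h _).
move: Ec Eb Wg' Wh; rewrite !big_cons !big_nil eg // eg' // eh // ej // Mg' Mh !inE !eqxx ?orbT.
rewrite /wt !big_set1 ![c == _]eq_sym ac bc eg // eg' // eh // ej // [b == a]eq_sym ab eqxx (negPf bc) /=.
rewrite -wbc -/(wt w K) => Ec Eb /(_ isT) Wg' /(_ isT) Wh.
have /(mulfI (lt0r_neq0 r_gt0)) gh : r * w g' = r * w h by lra.
have wj0 : w j = 0 by lra.
by have := pw_gt0 PW j; rewrite wj0 ltxx.
Qed.

Lemma wt_single_in (A : {set T}) v :
  (forall v v', v \in K -> v' \in K -> w v < w v' + w v') ->
  A \subset K -> A != set0 -> v \in K -> wt w A = w v ->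
  exists2 a, A = [set a] & a \in K.
Proof.
move=> w2 AK A0 vK /(wt_single PW AK A0 vK (fun b => @w2 v b vK))[a Aa].
by exists a => //; apply: (subsetP AK); rewrite Aa inE.
Qed.

Section Equality.
Variables (n k : nat) (x y z j a b : T).
Hypotheses (kn : k = (n - 4)%N) (Kk : #|K| = k) (k4 : (4 <= k)%N).
Hypotheses (uq : uniq [:: x; y; z; j]) (qI : [:: x; y; z; j] =i I).
Hypotheses (aK : a \in K) (bK : b \in K).
Hypothesis w2 : forall v v', v \in K -> v' \in K -> w v < w v' + w v'.
Hypotheses (Ex : wt w (missed e K x) = w a) (Ey : wt w (missed e K y) = w a).
Hypotheses (Ez : wt w (missed e K z) = w b) (Ej : wt w (nbr e K j) = w a).

(** Each of the rows x, y, z misses one vertex and [j] is pendant at [c]; one of the missed vertices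
    is [c], or its column would have size 4. If all three are [c], that column is {j} and the others
    are {x, y, z}, so they do not meet. If just one is, [no_spread4] applies. Two of them give H. *)
Lemma four_rows_eq : graph_iso e (@split_rel k 4 (Gamma_cross n 4)).
Proof.
have memI : [/\ x \in I, y \in I, z \in I & j \in I] by rewrite -!qI !inE !eqxx !orbT.
case: memI => xI yI zI jI.
have [al Mx alK] := @wt_single_in _ a w2 (missed_sub e K x) (missed_neq0 KS xI) aK Ex.
have [be My beK] := @wt_single_in _ a w2 (missed_sub e K y) (missed_neq0 KS yI) aK Ey.
have [ga Mz gaK] := @wt_single_in _ b w2 (missed_sub e K z) (missed_neq0 KS zI) bK Ez.
have [c Nj cK] := @wt_single_in _ a w2 (nbr_sub e K j) (nbr_neq0 KS jI) aK Ej.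
move: Ex Ey Ez Ej; rewrite Mx My Mz Nj /wt !big_set1 => wx wy wz wj.
have c_in : [|| c == al, c == be | c == ga].
  apply: contraT; rewrite !negb_or => /and3P[ca cb cg].
  have := ks_col KS cK; rewrite (card_column KS c uq qI) /=.
  by rewrite (missed1 Mx) // (missed1 My) // (missed1 Mz) // (nbr1 Nj) // ca cb cg eqxx.
have [p1 p2 p3 p4] := perm_eq4 x y z j.
have [uq1 qI1] := perm_listing p1 uq qI; have [uq2 qI2] := perm_listing p2 uq qI.
have [uq3 qI3] := perm_listing p3 uq qI; have [uq4 qI4] := perm_listing p4 uq qI.
have [cal|cal] := eqVneq c al; have [cbe|cbe] := eqVneq c be; have [cga|cga] := eqVneq c ga.
- subst al be ga; have [v vK] := @ex_notin _ K [:: c] ltac:(rewrite Kk; exact: leq_trans k4).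
  rewrite inE => vc; have c3 : #|column e I v| = 3%N.
    rewrite (card_column KS v uq qI) /= (missed1 Mx) // (missed1 My) // (missed1 Mz) //.
    by rewrite (nbr1 Nj) // vc (negPf vc).
  have [u] := ks_meet KS vK cK c3; rewrite !(mem_column KS) => /andP[uI euv] /andP[_ euc].
  move: uI euv euc; rewrite -qI !inE => /or4P[] /eqP ->.
  + by rewrite (missed1 Mx cK) eqxx.
  + by rewrite (missed1 My cK) eqxx.
  + by rewrite (missed1 Mz cK) eqxx.
  + by rewrite (nbr1 Nj vK) (negPf vc).
- by subst al be; apply: (iso_Gamma4 KS kn Kk k4 uq qI Mx My Mz Nj).
- by subst al ga; apply: (iso_Gamma4 KS kn Kk k4 uq1 qI1 Mx Mz My Nj).
- subst al; case: (@no_spread4 z y x j c ga be uq4 qI4) => //;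
    by rewrite ?[_ == c]eq_sym // wy wj.
- by subst be ga; apply: (iso_Gamma4 KS kn Kk k4 uq2 qI2 My Mz Mx Nj).
- subst be; case: (@no_spread4 z x y j c ga al uq3 qI3) => //;
    by rewrite ?[_ == c]eq_sym // wx wj.
- subst ga; case: (@no_spread4 x y z j c al be uq qI) => //;
    by rewrite ?[_ == c]eq_sym // wy wj.
- by move: c_in; rewrite (negPf cal) (negPf cbe) (negPf cga).
Qed.
End Equality.

(** The bound fails only if the three rows miss no vertex except [a]. Then all other columns contain
    {x, y, z} and leave no room for [j], which is pendant at [a]; so the column of [a] meets none of
    them. *)
Lemma four_rows_key1 k x y z j a b : #|K| = k -> (4 <= k)%N ->
  uniq [:: x; y; z; j] -> [:: x; y; z; j] =i I -> a \in K ->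
  (forall v, v \in K -> w a <= w v) -> (forall v, v \in K -> v != a -> w b <= w v) ->
  w a + w a + w b <=
  wt w (missed e K x) + wt w (missed e K y) + wt w (missed e K z).
Proof.
move=> Kk k4 uq qI aK min_a min_b.
have memI : [/\ x \in I, y \in I, z \in I & j \in I] by rewrite -!qI !inE !eqxx !orbT.
case: memI => xI yI zI jI.
have miss_ge u : u \in I -> w a <= wt w (missed e K u).
  case/(ks_miss KS) => v vK nuv; apply: le_trans (min_a v vK) _.
  by apply: (wt_ge1 PW); rewrite inE vK.
have big_ge u v : u \in I -> v \in K -> v != a -> ~~ e u v -> w b <= wt w (missed e K u).
  move=> uI vK va nuv; apply: le_trans (min_b v vK va) _.
  by apply: (wt_ge1 PW); rewrite inE vK.
have [/exists_inP[v vK /andP[va /or3P[] nuv]]|] :=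
  boolP [exists v in K, (v != a) && [|| ~~ e x v, ~~ e y v | ~~ e z v]].
- by rewrite addrC addrA; apply: lerD (miss_ge z zI); apply: lerD (miss_ge y yI); apply: (big_ge x v).
- by rewrite addrAC; apply: lerD (miss_ge z zI); apply: lerD (miss_ge x xI) _; apply: (big_ge y v).
- by apply: lerD (lerD (miss_ge x xI) (miss_ge y yI)) _; apply: (big_ge z v).
move/exists_inPn => all_in; exfalso.
have all3 v : v \in K -> v != a -> [/\ e x v, e y v & e z v].
  by move=> vK va; have := all_in v vK; rewrite va /= !negb_or !negbK => /and3P[].
have nja v : v \in K -> e j v -> v = a.
  move=> vK ejv; apply/eqP/negPn/negP => va; have [ex ey ez] := all3 v vK va.
  by have := ks_col KS vK; rewrite (card_column KS v uq qI) /= ex ey ez ejv.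
have [v vK va] : exists2 v, v \in K & v != a.
  by have [v vK] := @ex_notin _ K [:: a] ltac:(rewrite Kk; exact: leq_trans k4); rewrite inE; exists v.
have c3 : #|column e I v| = 3%N.
  have [ex ey ez] := all3 v vK va; rewrite (card_column KS v uq qI) /= ex ey ez.
  by case ejv: (e j v) => //; rewrite (nja v vK ejv) eqxx in va.
have [u] := ks_meet KS vK aK c3; rewrite !(mem_column KS) => /andP[uI euv] /andP[_ eua].
have aMiss u' : u' \in I -> (forall v, v \in K -> v != a -> e u' v) -> ~~ e u' a.
  move=> u'I full; have [v' v'K nv'] := ks_miss KS u'I.
  by have [<-//|v'a] := eqVneq v' a; rewrite full in nv'.
move: uI; rewrite -qI !inE => /or4P[] /eqP def_u; rewrite def_u in eua euv.
- by have /negP := aMiss x xI (fun v vK va => let: And3 h _ _ := all3 v vK va in h).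
- by have /negP := aMiss y yI (fun v vK va => let: And3 _ h _ := all3 v vK va in h).
- by have /negP := aMiss z zI (fun v vK va => let: And3 _ _ h := all3 v vK va in h).
- by rewrite (nja v vK euv) eqxx in va.
Qed.

Lemma small_pair_weight a b v1 v2 : v1 \in K -> v2 \in K -> v1 != v2 ->
  (forall v, v \in K -> w a <= w v) -> (forall v, v \in K -> v != a -> w b <= w v) ->
  w a + w b <= w v1 + w v2.
Proof.
move=> v1K v2K v12 min_a min_b; have [v1a|v1a] := eqVneq v1 a.
  by apply: lerD; [exact: min_a | apply: min_b; rewrite // -v1a eq_sym].
by rewrite addrC; apply: lerD; [exact: min_b | exact: min_a].
Qed.

Lemma column_weights_lt2 : 3 <= r ->
  forall v v', v \in K -> v' \in K -> w v < w v' + w v'.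
Proof.
move=> r3 v v' vK v'K; apply: (w_lt2 KS PW) => //; apply: le_trans r3.
by rewrite ler_nat (ks_col KS).
Qed.

Lemma r_ge3 : (4 <= #|K|)%N -> 3 <= r.
Proof.
move=> K4; have := r_ge PW (leq_trans _ K4); have : 4%:R <= #|K|%:R :> R by rewrite ler_nat.
by move=> h /(_ isT); lra.
Qed.

(** The columns of size 2 in H sit at its last and first clique vertices, where the two lightest
    clique vertices [a] and [b] of G are placed. Two short columns of G weigh at least as much,
    which is [key2]. *)
Lemma four_rows n k : k = (n - 4)%N -> #|K| = k -> #|I| = 4%N -> (4 <= k)%N ->
  rayleigh_bounded (@split_rel k 4 (Gamma_cross n 4)) r ->
  (exists v v', [/\ v \in K, v' \in K, v != v', (#|column e I v| <= 2)%N
    & (#|column e I v'| <= 2)%N]) ->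
  graph_iso e (@split_rel k 4 (Gamma_cross n 4)).
Proof.
move=> kn Kk I4 k4 bdd [v1 [v2 [v1K v2K v12 c1 c2]]].
have K4 : (4 <= #|K|)%N by rewrite Kk.
have [q [uq qI sq]] := sorted_listing w I; rewrite I4 in sq.
case: q uq qI sq => [|x [|y [|z [|j [|? ?]]]]] // uq qI _ /= /and4P[yx zy jz _].
have memI : [/\ x \in I, y \in I, z \in I & j \in I] by rewrite -!qI !inE !eqxx !orbT.
case: memI => xI yI zI jI.
have [a [b [aK bK ab min_a min_b]]] := min_weight2 w (leq_trans (isT : 1 < 4)%N K4).
have [s [us sK ss s0 sl]] := listing_ends x aK bK ab; rewrite Kk in ss sl.
have w2 := column_weights_lt2 (r_ge3 K4).
have miss_ge u : u \in I -> w a <= wt w K - r * w u.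
  move=> uI; rewrite -(wt_missed PW uI); case/(ks_miss KS): uI => v vK nuv.
  apply: le_trans (min_a v vK) _; by apply: (wt_ge1 PW); rewrite inE vK.
have key2 : w a + w b <= 3 * wt w K - (r * w x + (r * w y + (r * w z + (r * w j + 0)))).
  have := sum_deficiency KS PW 3 uq qI; rewrite !big_cons big_nil => ->.
  apply: le_trans (deficiency_ge PW (A := [set v1; v2]) (@ks_col _ _ _ _ KS) _ _).
  - by rewrite /wt big_setU1 ?inE //= big_set1; apply: small_pair_weight.
  - by apply/subsetP => v; rewrite !inE => /orP[]/eqP->.
  - by move=> v; rewrite !inE => /orP[]/eqP->.
have := four_rows_key1 Kk k4 uq qI aK min_a min_b.
rewrite (wt_missed PW xI) (wt_missed PW yI) (wt_missed PW zI) => key1.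
have k0 : (0 < k)%N by apply: leq_trans k4.
have kl : (k.-1 < k)%N by rewrite prednK.
have hr0 : hrow w k (Gamma_cross n 4) x s 0 = wt w K - w a.
  by rewrite -sl; apply: hrow_all_but => // l lk; have [] := Gamma_cross4 kn k4 lk.
have hr1 : hrow w k (Gamma_cross n 4) x s 1 = wt w K - w a.
  by rewrite -sl; apply: hrow_all_but => // l lk; have [] := Gamma_cross4 kn k4 lk.
have hr2 : hrow w k (Gamma_cross n 4) x s 2 = wt w K - w b.
  by rewrite -s0; apply: hrow_all_but => // l lk; have [] := Gamma_cross4 kn k4 lk.
have hr3 : hrow w k (Gamma_cross n 4) x s 3 = w a.
  by rewrite -sl; apply: hrow_one => // l lk; have [] := Gamma_cross4 kn k4 lk.
have le0 := arrange_le KS PW x ss (erefl : size [:: x; y; z; j] = 4%N) us uq sK qI bdd.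
have eq0 := arrange_eq KS PW (x0 := x) ss (erefl : size [:: x; y; z; j] = 4%N) us uq sK qI bdd.
move: le0 eq0; rewrite !big_ord_recr big_ord0 /= hr0 hr1 hr2 hr3 add0r => le0 eq0.
have ge0 := four_rows_ineq yx zy jz (pw_gt0 PW j) (miss_ge x xI) (miss_ge y yI) key1 key2.
(* The sum is bounded by zero from both sides, so each row weighs in G what its place weighs in
   H. *)
have {}eq0 := eq0 (le_anti (introT andP (conj le0 ge0))).
move: (eq0 0%N isT) (eq0 1%N isT) (eq0 2%N isT) (eq0 3%N isT).
rewrite /= hr0 hr1 hr2 hr3 => E0 E1 E2 E3.
apply: (four_rows_eq kn Kk k4 uq qI aK bK w2).
- by rewrite (wt_missed PW xI) -E0 opprB addrC subrK.
- by rewrite (wt_missed PW yI) -E1 opprB addrC subrK.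
- by rewrite (wt_missed PW zI) -E2 opprB addrC subrK.
- by rewrite (wt_nbr PW jI) -E3.
Qed.
End FourWeights.

(** * Five independent vertices *)

Lemma Gamma_cross5 n k j : k = (n - 5)%N -> (5 <= k)%N -> (j < k)%N ->
  [/\ Gamma_cross n 5 1 j.+1 = (j == 0)%N || (j == k.-1),
      Gamma_cross n 5 2 j.+1 = (j != k.-1) /\ Gamma_cross n 5 3 j.+1 = (j != k.-1),
      Gamma_cross n 5 4 j.+1 = (j != 0)%N & Gamma_cross n 5 5 j.+1 = (j == k.-1)].
Proof. by rewrite /Gamma_cross /=; do 2?split; lia. Qed.

(** Summation by parts with pivot z. As all columns of H have size 3, z is multiplied by the full
    deficiency of G. *)
Lemma five_rows_ineq (R : realFieldType) (m x y z l r P a b : R) :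
  z <= x -> z <= y -> a <= P - r * x -> a <= P - r * y ->
  0 <= (z - m) * (r * m - (b + a)) + (z - l) * (r * l - a)
       + z * (3 * P - (r * m + (r * x + (r * y + (r * z + (r * l + 0)))))) ->
  0 <= m * (b + a - r * m) + x * (P - a - r * x) + y * (P - a - r * y)
       + z * (P - b - r * z) + l * (a - r * l).
Proof.
move=> zx zy Ax Ay H.
have t1 : 0 <= (x - z) * (P - r * x - a) by apply: mulr_ge0; lra.
have t2 : 0 <= (y - z) * (P - r * y - a) by apply: mulr_ge0; lra.
by lra.
Qed.

Lemma perm_eq5 (T : eqType) (m x y z l : T) :
  [/\ perm_eq [:: m; x; y; z; l] [:: m; x; z; y; l],
      perm_eq [:: m; x; y; z; l] [:: m; y; z; x; l],
      perm_eq [:: m; x; y; z; l] [:: m; z; x; y; l],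
      perm_eq [:: m; x; y; z; l] [:: m; z; y; x; l] &
      perm_eq [:: x; y; z; m; l] [:: m; x; y; z; l] /\
      perm_eq [:: x; y; z; m; l] [:: l; x; y; z; m]].
Proof. by do 2?split; apply/permP => p /=; lia. Qed.

Section Five.
Variables (T : finType) (e : rel T) (K I : {set T}).
Hypothesis KS : K14_split e K I.

Lemma iso_Gamma5 n k m g g' h l c d : k = (n - 5)%N -> #|K| = k -> (5 <= k)%N ->
  uniq [:: m; g; g'; h; l] -> [:: m; g; g'; h; l] =i I ->
  missed e K g = [set c] -> missed e K g' = [set c] -> missed e K h = [set d] ->
  nbr e K l = [set c] -> (forall v, v \in K -> e m v = (v == d) || (v == c)) ->
  c \in K -> d \in K -> c != d ->
  graph_iso e (@split_rel k 5 (Gamma_cross n 5)).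
Proof.
move=> kn Kk k5 uq qI Mg Mg' Mh Nl Em cK dK cd.
have [s [us sK ss s0 sl]] := listing_ends g cK dK cd.
rewrite Kk in ss sl.
have nthE i j0 : (i < k)%N -> (j0 < k)%N -> (nth g s i == nth g s j0) = (i == j0).
  by move=> ik jk; rewrite nth_uniq ?ss.
apply: (graph_iso_split KS (x0 := g) (s := s) (q := [:: m; g; g'; h; l])) => //.
move=> i j i5 jk; have jK : nth g s j \in K by rewrite -sK mem_nth ?ss.
have k0 : (0 < k)%N by apply: leq_trans k5.
have kl : (k.-1 < k)%N by rewrite prednK.
have [c0 [c1 c2] c3 c4] := Gamma_cross5 kn k5 jk.
case: i i5 => [|[|[|[|[|//]]]]] _; rewrite ?c0 ?c1 ?c2 ?c3 ?c4 /=
  ?(missed1 Mg) ?(missed1 Mg') ?(missed1 Mh) ?(nbr1 Nl) ?Em //.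
all: by rewrite -?sl -?s0 !nthE.
Qed.
End Five.

Section FiveWeights.
Variables (R : realFieldType) (T : finType) (e : rel T) (K I : {set T}).
Variables (w : T -> R) (r : R).
Hypothesis KS : K14_split e K I.
Hypothesis PW : perron_weights e K I w r.
Hypothesis r_gt0 : 0 < r.

(** The columns of [b] and [c] are {m, g, h} and {g, g', l}. From w(b) = w(c) they weigh the same,
    and w(g') = w(h) because these rows miss equal weights; so w(m) = w(l). *)
Lemma no_spread5 m g g' h l c a b :
  uniq [:: m; g; g'; h; l] -> [:: m; g; g'; h; l] =i I ->
  missed e K g = [set a] -> missed e K g' = [set b] -> missed e K h = [set c] ->
  nbr e K l = [set c] -> b \in K -> c \in K ->
  a != c -> b != c -> a != b -> e m b -> ~~ e m c -> w b = w c ->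
  r * w l < r * w m -> False.
Proof.
move=> uq qI Mg Mg' Mh Nl bK cK ac bc ab emb emc wbc.
have eg v : v \in K -> e g v = (v != a) by apply: missed1.
have eg' v : v \in K -> e g' v = (v != b) by apply: missed1.
have eh v : v \in K -> e h v = (v != c) by apply: missed1.
have el v : v \in K -> e l v = (v == c) by apply: nbr1.
have uI u : u \in [:: m; g; g'; h; l] -> u \in I by rewrite qI.
have Ec := column_eq KS PW uq qI cK; have Eb := column_eq KS PW uq qI bK.
have Wg' := wt_missed PW (uI g' _); have Wh := wt_missed PW (uI h _).
move: Ec Eb Wg' Wh; rewrite !big_cons !big_nil eg // eg' // eh // el // Mg' Mh !inE !eqxx ?orbT.
rewrite /wt !big_set1 ![c == _]eq_sym ac bc eg // eg' // eh // el // [b == a]eq_sym ab eqxx (negPf bc) emb (negPf emc) /=.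
rewrite -wbc -/(wt w K) => Ec Eb /(_ isT) Wg' /(_ isT) Wh.
have /(mulfI (lt0r_neq0 r_gt0)) gh : r * w g' = r * w h.
  by lra.
have lm : w l = w m by lra.
by rewrite lm ltxx.
Qed.

Section Equality.
Variables (n k : nat) (m x y z l a b : T).
Hypotheses (kn : k = (n - 5)%N) (Kk : #|K| = k) (k5 : (5 <= k)%N).
Hypotheses (uq : uniq [:: m; x; y; z; l]) (qI : [:: m; x; y; z; l] =i I).
Hypotheses (aK : a \in K) (bK : b \in K).
Hypothesis w2 : forall v v', v \in K -> v' \in K -> w v < w v' + w v'.
Hypotheses (Ex : wt w (missed e K x) = w a) (Ey : wt w (missed e K y) = w a).
Hypotheses (Ez : wt w (missed e K z) = w b) (El : wt w (nbr e K l) = w a).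
Hypothesis (Em : wt w (nbr e K m) = w b + w a).

(** The row equalities add up to deficiency 0, so every column has size 3. Three coinciding missed
    vertices would leave only [m] and [l] in a column. If exactly two coincide, that column consists
    of [m], [l] and the third heavy row, as in H. If none do, [c] is one of them, since otherwise
    its column has size 4, and [no_spread5] applies. *)
Lemma five_rows_eq : graph_iso e (@split_rel k 5 (Gamma_cross n 5)).
Proof.
have memI : [/\ m \in I, x \in I, y \in I, z \in I & l \in I].
  by rewrite -!qI !inE !eqxx !orbT.
case: memI => mI xI yI zI lI.
have all3 v : v \in K -> #|column e I v| = 3%N.
  move=> vK; apply/eqP; rewrite eqn_leq (ks_col KS vK) ltnNge; apply/negP => c2.
  have := sum_deficiency KS PW 3 uq qI; rewrite !big_cons big_nil => def0.
  have := deficiency_ge PW (A := [set v]) (@ks_col _ _ _ _ KS).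
  rewrite -def0 sub1set vK /wt big_set1 => /(_ isT) vle.
  have {}vle : w v <= 3 * wt w K - (r * w m + (r * w x + (r * w y + (r * w z + (r * w l + 0))))).
    by apply: vle => u; rewrite inE => /eqP->.
  suff : w v <= 0 by rewrite leNgt (pw_gt0 PW).
  move: vle Ex Ey Ez El Em; rewrite (wt_missed PW xI) (wt_missed PW yI) (wt_missed PW zI).
  by rewrite (wt_nbr PW lI) (wt_nbr PW mI) => *; lra.
have [al Mx alK] := @wt_single_in _ _ _ _ _ _ _ PW _ a w2 (missed_sub e K x) (missed_neq0 KS xI) aK Ex.
have [be My beK] := @wt_single_in _ _ _ _ _ _ _ PW _ a w2 (missed_sub e K y) (missed_neq0 KS yI) aK Ey.
have [ga Mz gaK] := @wt_single_in _ _ _ _ _ _ _ PW _ b w2 (missed_sub e K z) (missed_neq0 KS zI) bK Ez.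
have [c Nl cK] := @wt_single_in _ _ _ _ _ _ _ PW _ a w2 (nbr_sub e K l) (nbr_neq0 KS lI) aK El.
move: Ex Ey Ez El; rewrite Mx My Mz Nl /wt !big_set1 => wx wy wz wl.
have lm : r * w l < r * w m.
  by rewrite -(wt_nbr PW lI) -(wt_nbr PW mI) Em Nl /wt big_set1 wl ltrDr (pw_gt0 PW).
have cnt v : v \in K ->
    (e m v + ((v != al) + ((v != be) + ((v != ga) + (v == c)))) = 3)%N.
  move=> vK; rewrite -(all3 v vK) (card_column KS v uq qI) /= addn0.
  by rewrite (missed1 Mx) // (missed1 My) // (missed1 Mz) // (nbr1 Nl).
have [p1 p2 p3 p4 _] := perm_eq5 m x y z l.
have [uq1 qI1] := perm_listing p1 uq qI; have [uq2 qI2] := perm_listing p2 uq qI.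
have [uq3 qI3] := perm_listing p3 uq qI; have [uq4 qI4] := perm_listing p4 uq qI.
have cntc := cnt c cK; have cnta := cnt al alK; have cntb := cnt be beK; have cntg := cnt ga gaK.
have [alb|alb] := eqVneq al be; have [alg|alg] := eqVneq al ga.
- subst be ga; move: cnta; rewrite eqxx /=; by case: (e m al); case: (al == c).
- subst be; have cal : c = al.
    move: cnta; rewrite eqxx /= alg; by case: eqVneq => [->//|_]; case: (e m al).
  subst c; apply: (iso_Gamma5 KS kn Kk k5 uq qI Mx My Mz Nl) => // v vK.
  have := cnt v vK; have [->|_] := eqVneq v ga.
  + by case: (ga == al); case: (e m ga).
  + by case: (v == al); case: (e m v).
- subst ga; have cal : c = al.
    move: cnta; rewrite eqxx /= alb; by case: eqVneq => [->//|_]; case: (e m al).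
  subst c; apply: (iso_Gamma5 KS kn Kk k5 uq1 qI1 Mx Mz My Nl) => // v vK.
  have := cnt v vK; have [->|_] := eqVneq v be.
  + by case: (be == al); case: (e m be).
  + by case: (v == al); case: (e m v).
have [beg|beg] := eqVneq be ga.
  subst ga; have cal : c = be.
    move: cntb; rewrite eqxx /= [be == al]eq_sym alb; by case: eqVneq => [->//|_]; case: (e m be).
  subst c; apply: (iso_Gamma5 KS kn Kk k5 uq2 qI2 My Mz Mx Nl) => // [v vK|]; last by rewrite eq_sym.
  have := cnt v vK; have [->|_] := eqVneq v al.
  + by case: (al == be); case: (e m al).
  + by case: (v == be); case: (e m v).
have gal : ga != al by rewrite eq_sym.
have bal : be != al by rewrite eq_sym.
have gbe : ga != be by rewrite eq_sym.
have c_in : [|| c == al, c == be | c == ga].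
  apply: contraT; rewrite !negb_or => /and3P[ca cb cg].
  by move: cntc; rewrite ca cb cg eqxx; case: (e m c).
case/or3P: c_in => /eqP def_c; subst c.
- case: (@no_spread5 m z y x l al ga be uq4 qI4) => //; rewrite ?wy ?wl //.
  + by move: cntb; rewrite bal beg eqxx (negPf bal); case: (e m be).
  + by move: cnta; rewrite alb alg eqxx; case: (e m al).
- case: (@no_spread5 m z x y l be ga al uq3 qI3) => //; rewrite ?wx ?wl //.
  + by move: cnta; rewrite alb alg eqxx (negPf alb); case: (e m al).
  + by move: cntb; rewrite bal beg eqxx; case: (e m be).
- case: (@no_spread5 m y x z l ga be al) => //; rewrite ?wx ?wl //.
  + by move: uq; rewrite /= !inE !negb_or [y == x]eq_sym => /and5P[/and4P[-> -> -> ->] /and3P[-> -> ->] /andP[-> ->] -> _].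
  + by move=> u; rewrite -qI !inE; case: (u == m); case: (u == x); case: (u == y).
  + by move: cnta; rewrite alb alg eqxx (negPf alg); case: (e m al).
  + by move: cntg; rewrite gal gbe eqxx; case: (e m ga).
Qed.
End Equality.

(** The two lightest rows take the places of degree two ([m]) and degree one ([l]) in H. Which of
    them takes which depends on G, so the remaining inequality is left as a hypothesis. *)
Lemma five_rows_of n k m x y z l : k = (n - 5)%N -> #|K| = k -> (5 <= k)%N ->
  rayleigh_bounded (@split_rel k 5 (Gamma_cross n 5)) r ->
  uniq [:: m; x; y; z; l] -> [:: m; x; y; z; l] =i I -> w z <= w x -> w z <= w y ->
  (forall a b, a \in K -> b \in K -> a != b -> (forall v, v \in K -> w a <= w v) ->
    (forall v, v \in K -> v != a -> w b <= w v) ->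
    0 <= (w z - w m) * (r * w m - (w b + w a)) + (w z - w l) * (r * w l - w a)
     + w z * \sum_(v in K) (3 - #|column e I v|%:R) * w v) ->
  graph_iso e (@split_rel k 5 (Gamma_cross n 5)).
Proof.
move=> kn Kk k5 bdd uq qI zx zy ge.
have K5 : (5 <= #|K|)%N by rewrite Kk.
have memI : [/\ m \in I, x \in I, y \in I, z \in I & l \in I].
  by rewrite -!qI !inE !eqxx !orbT.
case: memI => mI xI yI zI lI.
have [a [b [aK bK ab min_a min_b]]] := min_weight2 w (leq_trans (isT : 1 < 5)%N K5).
have [s [us sK ss s0 sl]] := listing_ends x aK bK ab; rewrite Kk in ss sl.
have w2 := column_weights_lt2 KS PW r_gt0 (r_ge3 PW (leq_trans (isT : 4 <= 5)%N K5)).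
have miss_ge u : u \in I -> w a <= wt w K - r * w u.
  move=> uI; rewrite -(wt_missed PW uI); case/(ks_miss KS): uI => v vK nuv.
  apply: le_trans (min_a v vK) _; by apply: (wt_ge1 PW); rewrite inE vK.
have {}ge := ge a b aK bK ab min_a min_b.
have := sum_deficiency KS PW 3 uq qI; rewrite !big_cons big_nil => def0; rewrite -def0 in ge.
have k0 : (0 < k)%N by apply: leq_trans k5.
have kl : (k.-1 < k)%N by rewrite prednK.
have kne : (0 != k.-1)%N by case: (k) k5 => [|[|?]].
have hr0 : hrow w k (Gamma_cross n 5) x s 0 = w b + w a.
  rewrite -sl -s0; apply: hrow_two k0 kl kne _ => j jk.
  by have [] := Gamma_cross5 kn k5 jk.
have hr1 : hrow w k (Gamma_cross n 5) x s 1 = wt w K - w a.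
  by rewrite -sl; apply: hrow_all_but => // j jk; have [_ []] := Gamma_cross5 kn k5 jk.
have hr2 : hrow w k (Gamma_cross n 5) x s 2 = wt w K - w a.
  by rewrite -sl; apply: hrow_all_but => // j jk; have [_ []] := Gamma_cross5 kn k5 jk.
have hr3 : hrow w k (Gamma_cross n 5) x s 3 = wt w K - w b.
  by rewrite -s0; apply: hrow_all_but => // j jk; have [_ _] := Gamma_cross5 kn k5 jk.
have hr4 : hrow w k (Gamma_cross n 5) x s 4 = w a.
  by rewrite -sl; apply: hrow_one => // j jk; have [_ _] := Gamma_cross5 kn k5 jk.
have le0 := arrange_le KS PW x ss (erefl : size [:: m; x; y; z; l] = 5%N) us uq sK qI bdd.
have eq0 := arrange_eq KS PW (x0 := x) ss (erefl : size [:: m; x; y; z; l] = 5%N) us uq sK qI bdd.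
move: le0 eq0; rewrite !big_ord_recr big_ord0 /= hr0 hr1 hr2 hr3 hr4 add0r => le0 eq0.
have ge0 := five_rows_ineq zx zy (miss_ge x xI) (miss_ge y yI) ge.
have {}eq0 := eq0 (le_anti (introT andP (conj le0 ge0))).
move: (eq0 0%N isT) (eq0 1%N isT) (eq0 2%N isT) (eq0 3%N isT) (eq0 4%N isT).
rewrite /= hr0 hr1 hr2 hr3 hr4 => E0 E1 E2 E3 E4.
apply: (five_rows_eq kn Kk k5 uq qI aK bK w2).
- by rewrite (wt_missed PW xI) -E1 opprB addrC subrK.
- by rewrite (wt_missed PW yI) -E2 opprB addrC subrK.
- by rewrite (wt_missed PW zI) -E3 opprB addrC subrK.
- by rewrite (wt_nbr PW lI) -E4.
- by rewrite (wt_nbr PW mI) -E0.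
Qed.

Lemma five_rows n k : k = (n - 5)%N -> #|K| = k -> #|I| = 5%N -> (5 <= k)%N ->
  rayleigh_bounded (@split_rel k 5 (Gamma_cross n 5)) r ->
  graph_iso e (@split_rel k 5 (Gamma_cross n 5)).
Proof.
move=> kn Kk I5 k5 bdd.
have [q [uq0 qI0 sq]] := sorted_listing w I; rewrite I5 in sq.
case: q uq0 qI0 sq => [|x [|y [|z [|i [|j [|? ?]]]]]] // uq0 qI0 _ /= /and5P[yx zy iz ji _].
have zx := le_trans zy yx; have jz := le_trans ji iz.
have [_ _ _ _ [pi pj]] := perm_eq5 i x y z j.
have [uqi qIi] := perm_listing pi uq0 qI0; have [uqj qIj] := perm_listing pj uq0 qI0.
have memI : [/\ i \in I, x \in I, y \in I, z \in I & j \in I].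
  by rewrite -!qIi !inE !eqxx !orbT.
case: memI => iI xI yI zI jI.
have nbr_ge u a : u \in I -> (forall v, v \in K -> w a <= w v) -> w a <= r * w u.
  move=> uI min_a; rewrite -(wt_nbr PW uI); case/(ks_row KS): uI => v vK euv.
  by apply: le_trans (min_a v vK) _; apply: (wt_ge1 PW); rewrite inE vK.
have nbr_ge2 u v v' a b : u \in I -> v \in nbr e K u -> v' \in nbr e K u -> v != v' ->
    (forall v, v \in K -> w a <= w v) -> (forall v, v \in K -> v != a -> w b <= w v) ->
    w b + w a <= r * w u.
  move=> uI vN v'N vv' min_a min_b; rewrite -(wt_nbr PW uI).
  apply: le_trans (wt_ge2 PW vN v'N vv'); rewrite addrC.
  by apply: (small_pair_weight (K := K)) => //; apply: (subsetP (nbr_sub e K u)).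
have def_ge0 : 0 <= \sum_(v in K) (3 - #|column e I v|%:R) * w v.
  by apply: le_trans (deficiency_ge PW (A := set0) (@ks_col _ _ _ _ KS) (sub0set _) _);
    rewrite ?/wt ?big_set0 // => v; rewrite inE.
have z0 := ltW (pw_gt0 PW z).
have [i1|] := leqP #|nbr e K i| 1; last first.
  case/card_gt1P => v [v' [vN v'N vv']].
  apply: (five_rows_of kn Kk k5 bdd uqi qIi) => // a b aK bK ab min_a min_b.
  by rewrite !addr_ge0 // mulr_ge0 ?subr_ge0 ?(nbr_ge2 i v v') ?(nbr_ge j).
have [j1|] := leqP #|nbr e K j| 1; last first.
  case/card_gt1P => v [v' [vN v'N vv']].
  apply: (five_rows_of kn Kk k5 bdd uqj qIj) => // a b aK bK ab min_a min_b.
  by rewrite !addr_ge0 // mulr_ge0 ?subr_ge0 ?(nbr_ge2 j v v') ?(nbr_ge i).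
have nbr_one u : u \in I -> (#|nbr e K u| <= 1)%N -> exists2 c, c \in K & nbr e K u = [set c].
  move=> uI u1; have /cards1P[c Nc] : #|nbr e K u| == 1.
    by rewrite eqn_leq u1 card_gt0 (nbr_neq0 KS).
  by exists c => //; apply: (subsetP (nbr_sub e K u)); rewrite Nc inE.
have [c cK Ni] := nbr_one i iI i1; have [d dK Nj] := nbr_one j jI j1.
have Wi : r * w i = w c by rewrite -(wt_nbr PW iI) Ni /wt big_set1.
have Wj : r * w j = w d by rewrite -(wt_nbr PW jI) Nj /wt big_set1.
(* Both light rows are pendant. If they share their neighbour, no column has size 3 and the
   deficiency is at least the weight of [K]. *)
have [cd|cd] := eqVneq c d.
  subst d; have ij : i != j by move: uqi; rewrite /= !inE !negb_or => /andP[/and4P[]].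
  have all2 := pendants_apart KS iI jI ij cK Ni Nj.
  apply: (five_rows_of kn Kk k5 bdd uqi qIi) => // a b aK bK ab min_a min_b.
  have def_ge : w b + w a <= \sum_(v in K) (3 - #|column e I v|%:R) * w v.
    apply: le_trans (deficiency_ge PW (A := K) (@ks_col _ _ _ _ KS) (subxx _) all2).
    by apply: (wt_ge2 PW); rewrite // eq_sym.
  rewrite Wi Wj; have ca := min_a c cK; have b0 := pw_gt0 PW b; have a0 := pw_gt0 PW a.
  have i0 := pw_gt0 PW i.
  move: (\sum_(v in K) _) def_ge => D def_ge.
  have t1 : 0 <= (w z - w i) * (w c - w a) by rewrite mulr_ge0 ?subr_ge0.
  have t2 : 0 <= (w z - w j) * (w c - w a) by rewrite mulr_ge0 ?subr_ge0.
  have t3 : 0 <= w z * (D - (w b + w a)) by rewrite mulr_ge0 ?subr_ge0.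
  have t4 : 0 <= w z * w a by rewrite mulr_ge0 // ltW.
  have t5 : 0 <= w i * w b by rewrite mulr_ge0 // ltW.
  by lra.
(* If all columns had size 3, each of [c] and [d] would be missed by exactly one of x, y, z and no
   other vertex by any; but each of these three rows misses something. *)
have [v vK c2v] : exists2 v, v \in K & (#|column e I v| <= 2)%N.
  apply/exists_inP; apply/contraT => /exists_inPn /= c3; exfalso.
  have {}c3 v : v \in K -> #|column e I v| = 3%N.
    by move=> vK; apply/eqP; rewrite eqn_leq (ks_col KS vK) ltnNge c3.
  have cnt v : v \in K ->
      ((v == c) + (e x v + (e y v + (e z v + (v == d)))) = 3)%N.
    move=> vK; rewrite -(c3 v vK) (card_column KS v uqi qIi) /= addn0.
    by rewrite (nbr1 Ni) // (nbr1 Nj).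
  have full u v : u \in I -> ~~ e u v -> v \in K -> (u \in [:: x; y; z]) -> (v == c) || (v == d).
    move=> _ nuv vK; have := cnt v vK; case: (v == c); case: (v == d) => //=.
    rewrite !inE => + /or3P[] /eqP uE; rewrite uE in nuv; rewrite (negPf nuv);
    by do 2?case: (e _ v).
  have dc : d != c by rewrite eq_sym.
  have := cnt c cK; have := cnt d dK; rewrite !eqxx (negPf cd) (negPf dc) /=.
  have [vx vxK nx] := ks_miss KS xI; have [vy vyK ny] := ks_miss KS yI.
  have [vz vzK nz] := ks_miss KS zI.
  have := full x vx xI nx vxK; have := full y vy yI ny vyK; have := full z vz zI nz vzK.
  rewrite !inE !eqxx !orbT => /(_ isT)/orP[]/eqP ez /(_ isT)/orP[]/eqP ey /(_ isT)/orP[]/eqP ex;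
  rewrite ex in nx; rewrite ey in ny; rewrite ez in nz;
  rewrite ?(negPf nx) ?(negPf ny) ?(negPf nz);
  by case: (e x c) (e y c) (e z c) (e x d) (e y d) (e z d) => -[] [] [] [] [].
have def_ge a : (forall v, v \in K -> w a <= w v) -> w a <= \sum_(v in K) (3 - #|column e I v|%:R) * w v.
  move=> min_a; apply: le_trans (deficiency_ge PW (A := [set v]) (@ks_col _ _ _ _ KS) _ _).
  - by rewrite /wt big_set1 min_a.
  - by rewrite sub1set.
  - by move=> u; rewrite inE => /eqP->.
(* A pendant in the place of degree two falls short by the weight [pk]; the deficiency, at least
   [pk], makes up for it. *)
have core (m l D p1 pk zz : R) (cm cl : R) : m <= zz -> l <= zz -> 0 <= m -> 0 <= pk ->
    p1 <= cm -> pk <= cl -> pk <= D -> 0 <= zz ->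
    0 <= (zz - m) * (cm - (p1 + pk)) + (zz - l) * (cl - pk) + zz * D.
  move=> mz lz m0 pk0 h1 h2 h3 zz0.
  have t1 : 0 <= (zz - m) * (cm - p1) by rewrite mulr_ge0 ?subr_ge0.
  have t2 : 0 <= (zz - l) * (cl - pk) by rewrite mulr_ge0 ?subr_ge0.
  have t3 : 0 <= zz * (D - pk) by rewrite mulr_ge0 ?subr_ge0.
  have t4 : 0 <= m * pk by rewrite mulr_ge0.
  by lra.
have i0 := ltW (pw_gt0 PW i); have j0 := ltW (pw_gt0 PW j).
(* The row pendant at the heavier vertex takes the place of degree two, as the heavier of two clique
   vertices weighs at least [b]. *)
have [wcd|wdc] := leP (w d) (w c).
  apply: (five_rows_of kn Kk k5 bdd uqi qIi) => // a b aK bK ab min_a min_b.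
  rewrite Wi Wj; apply: core; rewrite ?min_a ?def_ge ?(ltW (pw_gt0 PW a)) //.
  have [ca|ca] := eqVneq c a; last exact: min_b.
  by apply: le_trans wcd; apply: min_b => //; rewrite -ca eq_sym.
apply: (five_rows_of kn Kk k5 bdd uqj qIj) => // a b aK bK ab min_a min_b.
rewrite Wi Wj; apply: core; rewrite ?min_a ?def_ge ?(ltW (pw_gt0 PW a)) //.
have [da|da] := eqVneq d a; last exact: min_b.
by apply: le_trans (ltW wdc); apply: min_b => //; rewrite -da.
Qed.
End FiveWeights.

(** * Six or more independent vertices *)

(** From here on [t] is |I| - 5, the number of rows of H that are pendant at the first clique
    vertices. *)
Lemma Gamma_cross6 n k t j : k = (n - t.+4.+1)%N -> (0 < t)%N -> (t.+4.+1 <= k)%N -> (j < k)%N ->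
  [/\ forall i, (i < t)%N -> Gamma_cross n t.+4.+1 i.+1 j.+1 = (j == i),
      Gamma_cross n t.+4.+1 t.+1 j.+1 = (j != k.-1) /\
      Gamma_cross n t.+4.+1 t.+2 j.+1 = (j != k.-2),
      Gamma_cross n t.+4.+1 t.+3 j.+1 = (t <= j)%N,
      Gamma_cross n t.+4.+1 t.+4 j.+1 = (j == k.-2)
    & Gamma_cross n t.+4.+1 t.+4.+1 j.+1 = (j == k.-1)].
Proof.
case: t => // t kn _ tk jk; rewrite /Gamma_cross -kn !subSS !subn0 {kn}.
by do 2?split; try move=> i it; lia.
Qed.

Lemma tail_index t sr k : (t + (sr + 2) = k)%N ->
  [/\ (k.-2 < t)%N = false /\ (k.-2 - t < sr)%N = false, (k.-2 - t - sr = 0)%N,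
      (k.-1 < t)%N = false /\ (k.-1 - t < sr)%N = false, (k.-1 - t - sr = 1)%N
    & [/\ (k.-1 < k)%N, (k.-2 < k)%N & (t <= k)%N]].
Proof. by move=> <-; do 2?split; lia. Qed.

Section Six.
Variables (T : finType) (e : rel T) (K I : {set T}).
Hypothesis KS : K14_split e K I.

(** Suppose [x] and [y] miss only [a]. Any other [u] with a neighbour v different from [a] has
    column {x, y, u} at v, which must meet the column of [a], hence in [u]. So the column of [a]
    contains all of [I] except [x] and [y], at least four vertices. *)
Lemma spread_misses x y a : (6 <= #|I|)%N ->
  x \in I -> y \in I -> x != y -> a \in K ->
  exists2 v, v \in K & (v != a) && (~~ e x v || ~~ e y v).
Proof.
move=> I6 xI yI xy aK; apply/exists_inP; apply/contraT => /exists_inPn /= all_in.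
have ex v : v \in K -> v != a -> e x v && e y v.
  by move=> vK va; have := all_in v vK; rewrite va /= negb_or !negbK.
have nxa : ~~ e x a.
  have [v vK nv] := ks_miss KS xI; have [<-//|va] := eqVneq v a.
  by have /andP[exv _] := ex v vK va; rewrite exv in nv.
have nya : ~~ e y a.
  have [v vK nv] := ks_miss KS yI; have [<-//|va] := eqVneq v a.
  by have /andP[_ eyv] := ex v vK va; rewrite eyv in nv.
have sub : I :\ x :\ y \subset column e I a.
  apply/subsetP => u; rewrite !inE => /and3P[uy ux uI]; rewrite uI (ks_sym KS).
  have [v vK euv] := ks_row KS uI; have [<-//|va] := eqVneq v a.
  have /andP[exv eyv] := ex v vK va.
  have sub3 : x |: (y |: [set u]) \subset column e I v.
    apply/subsetP => t; rewrite !inE => /or3P[] /eqP->;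
    by rewrite ?xI ?yI ?uI (ks_sym KS).
  have c3 : #|x |: (y |: [set u])| = 3%N.
    by rewrite !cardsU1 !inE negb_or xy eq_sym ux eq_sym uy cards1.
  have /eqP cv : x |: (y |: [set u]) == column e I v.
    by rewrite eqEcard sub3 c3 (ks_col KS).
  have [t] := ks_meet KS vK aK (etrans (congr1 (fun A : {set T} => #|A|) (esym cv)) c3).
  rewrite -cv (mem_column KS) !inE => /or3P[] /eqP->; first by rewrite (negPf nxa) andbF.
    by rewrite (negPf nya) andbF.
  by case/andP.
have := leq_trans (subset_leq_card sub) (ks_col KS aK).
move: I6; rewrite (cardsD1 x) xI (cardsD1 y) !inE [y == x]eq_sym xy yI.
by move: #|_ :\ y| => c; rewrite !add1n !ltnS => /leq_trans h /h.
Qed.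

Variables (n k t : nat).
Hypotheses (kn : k = (n - t.+4.+1)%N) (t0 : (0 < t)%N) (tk : (t.+4.+1 <= k)%N) (Kk : #|K| = k).

Lemma iso_Gamma6 x y z m0 m1 a b (ms : seq T) (g : T -> T) :
  size ms = t -> uniq (ms ++ [:: x; y; z; m0; m1]) -> ms ++ [:: x; y; z; m0; m1] =i I ->
  missed e K x = [set b] -> missed e K y = [set a] ->
  (forall m, m \in ms -> nbr e K m = [set g m] /\ g m \in K) ->
  nbr e K m0 = [set a] -> nbr e K m1 = [set b] -> a \in K -> b \in K -> a != b ->
  uniq (map g ms) -> a \notin map g ms -> b \notin map g ms ->
  (forall v, v \in K -> e z v = (v \notin map g ms)) ->
  graph_iso e (@split_rel k t.+4.+1 (Gamma_cross n t.+4.+1)).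
Proof.
move=> sm uq qI Mx My Nms Nm0 Nm1 aK bK ab ug ag bg ez.
pose rest := enum (K :\: [set v in map g ms ++ [:: a; b]]).
pose s := map g ms ++ rest ++ [:: a; b].
have mem_rest v : (v \in rest) = [&& v \notin map g ms, v != a, v != b & v \in K].
  by rewrite mem_enum !inE mem_cat !inE !negb_or !andbA.
have us : uniq s.
  rewrite /s !cat_uniq ug enum_uniq /= !inE ab !andbT orbF.
  rewrite !mem_rest !eqxx !andbF /= andbT has_cat; apply/norP; split.
    by apply/hasPn => v; rewrite mem_rest => /andP[].
  by rewrite /= (negPf ag) (negPf bg).
have gK v : v \in map g ms -> v \in K.
  by case/mapP => m mM ->; have [] := Nms m mM.
have sK : s =i K.
  move=> v; rewrite /s !mem_cat mem_rest !inE.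
  have [vg|_] := boolP (v \in map g ms); first by rewrite (gK v vg).
  have [->|va] := eqVneq v a; first by rewrite aK.
  by have [->|vb] := eqVneq v b; rewrite ?bK //= orbF.
have ss : size s = k by rewrite -Kk -(card_uniqP us); apply: eq_card.
have sr : (t + (size rest + 2) = k)%N by rewrite -ss /s !size_cat size_map sm.
have [[f1 f2] f3 [f4 f5] f6 [k1 k2 tk']] := tail_index sr.
have s_a : nth x s k.-2 = a.
  rewrite /s nth_cat size_map sm nth_cat.
  by rewrite f1 f2 f3.
have s_b : nth x s k.-1 = b.
  rewrite /s nth_cat size_map sm nth_cat.
  by rewrite f4 f5 f6.
have s_g i : (i < t)%N -> nth x s i = g (nth x ms i).
  by move=> it; rewrite /s nth_cat size_map sm it (nth_map x) ?sm.
have s_in j : (j < k)%N -> (nth x s j \in map g ms) = (j < t)%N.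
  move=> jk; rewrite /s nth_cat size_map sm; case: ifP => jt.
    by apply: mem_nth; rewrite size_map sm.
  apply: negbTE; have : nth x (rest ++ [:: a; b]) (j - t) \in rest ++ [:: a; b].
    by apply: mem_nth; rewrite size_cat /= ltn_subLR ?sr // leqNgt jt.
  rewrite mem_cat mem_rest !inE => /orP[/andP[]//|/orP[]/eqP->//].
have nthE i j0 : (i < k)%N -> (j0 < k)%N -> (nth x s i == nth x s j0) = (i == j0).
  by move=> ik jk; rewrite nth_uniq ?ss.
apply: (graph_iso_split KS (x0 := x) (s := s) (q := ms ++ [:: x; y; z; m0; m1])) => //.
  by rewrite size_cat sm /= addnC.
move=> i j it jk; have jK : nth x s j \in K by rewrite -sK mem_nth ?ss.
have [c0 [c1 c2] c3 c4 c5] := Gamma_cross6 kn t0 tk jk.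
rewrite nth_cat sm; case: ltnP => [lt_it|].
  have mM : nth x ms i \in ms by rewrite mem_nth ?sm.
  by have [Nm _] := Nms _ mM; rewrite (nbr1 Nm) // c0 // -s_g // nthE // (leq_trans lt_it).
case/subnKC => def_i; rewrite -def_i in it *.
rewrite addKn; case: (i - t)%N it => [|[|[|[|[|d]]]]] it.
- by rewrite addn0 c1 /= (missed1 Mx) // -s_b nthE.
- by rewrite addn1 c2 /= (missed1 My) // -s_a nthE.
- by rewrite addn2 c3 /= ez // s_in // -leqNgt.
- by rewrite addn3 c4 /= (nbr1 Nm0) // -s_a nthE.
- by rewrite addn4 c5 /= (nbr1 Nm1) // -s_b nthE.
by move: it; rewrite !addnS ltnNge !ltnS leq_addr.
Qed.
End Six.

(** Regrouping around the pivot z. For the [t] pendant rows [S] is their total weight, [Sp] that of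
    their places, [Q] the sum of the products of the two, and [M2] the sum of r w(u)^2. *)
Lemma six_rows_ineq (R : realFieldType) (x y z m0 m1 r P pa pb Q S M2 Sp : R) :
  0 <= (x - z) * (P - r * x - pa) + (y - z) * (P - r * y - pb) ->
  0 <= (z - m0) * (r * m0 - pa) + (z - m1) * (r * m1 - pb)
       + (z * (r * S) - z * Sp - M2 + Q)
       + z * (3 * P - (r * S + (r * y + (r * x + (r * z + (r * m0 + (r * m1 + 0))))))) ->
  0 <= (Q - M2) + y * (P - pb - r * y) + x * (P - pa - r * x)
       + z * (P - Sp - r * z) + m0 * (pa - r * m0) + m1 * (pb - r * m1).
Proof. lra. Qed.

(** Only B - pb can be negative, and by at most pb - pa. In that case A - pa is at least pb - pa and
    carries the larger coefficient. *)
Lemma spread_ineq (R : realFieldType) (x y z A B pa pb : R) :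
  y <= x -> z <= y -> pa <= pb -> pa <= A -> pa <= B -> (pb <= A) || (pb <= B) ->
  0 <= (x - z) * (A - pa) + (y - z) * (B - pb).
Proof.
move=> yx zy ab aA aB /orP[bA|bB]; last by rewrite addr_ge0 // mulr_ge0; lra.
have t1 : 0 <= (x - z) * (A - pb) by apply: mulr_ge0; lra.
have t2 : 0 <= (y - z) * (B - pa) by apply: mulr_ge0; lra.
have t3 : 0 <= (x - y) * (pb - pa) by apply: mulr_ge0; lra.
by lra.
Qed.

Section SixWeights.
Variables (R : realFieldType) (T : finType) (e : rel T) (K I : {set T}).
Variables (w : T -> R) (r : R).
Hypothesis KS : K14_split e K I.
Hypothesis PW : perron_weights e K I w r.
Hypothesis r_gt0 : 0 < r.
Hypothesis w2 : forall v v', v \in K -> v' \in K -> w v < w v' + w v'.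

Lemma nbr_single u v : u \in I -> v \in K -> r * w u <= w v ->
  exists2 c, nbr e K u = [set c] & c \in K.
Proof.
move=> uI vK le_uv; have /set0Pn[c cN] := nbr_neq0 KS uI.
have cK := subsetP (nbr_sub e K u) c cN.
exists c => //; apply/setP => d; rewrite in_set1; apply/idP/eqP => [dN|->//].
apply/eqP/negP => /negP dc; have dK := subsetP (nbr_sub e K u) d dN.
have := wt_ge2 PW cN dN; rewrite eq_sym dc (wt_nbr PW uI) => /(_ isT) le2.
have lt1 := w2 vK cK; have lt2 := w2 vK dK; have le3 := le_trans le2 le_uv.
suff : w v < w v by rewrite ltxx.
by lra.
Qed.

(** Otherwise the first i + 1 rows of [M] are so light that [nbr_single] makes them pendant, at
    distinct vertices by [pendants_apart]. These vertices are lighter than entry i of [s], and only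
    i entries come before it. *)
Lemma minor_ge (M s : seq T) x0 i : uniq M -> {subset M <= I} ->
  sorted (fun u u' => w u <= w u') M ->
  s =i K -> sorted (fun v v' => w v <= w v') s -> (i < size M)%N -> (i < size s)%N ->
  (exists2 v, v \in K & #|column e I v| = 3%N) ->
  w (nth x0 s i) <= r * w (nth x0 M i).
Proof.
move=> uM MI sM sK ss iM is' [v3 v3K c3]; rewrite leNgt; apply/negP => lt_i.
have siK : nth x0 s i \in K by rewrite -sK mem_nth.
pose g m := odflt m [pick v in nbr e K m].
have MM m : m \in take i.+1 M -> m \in I /\ w m <= w (nth x0 M i).
  move=> mT; split; first by apply: MI; apply: mem_take mT.
  have [j] := nthP x0 mT; rewrite size_takel // => ji <-; rewrite nth_take //.
  apply: (sorted_leq_nth (leT := fun u u' => w u <= w u')) => //.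
  - by move=> a b c; apply: le_trans.
  - by rewrite inE (leq_trans ji).
have gP m : m \in take i.+1 M -> nbr e K m = [set g m] /\ w (g m) < w (nth x0 s i).
  case/MM => mI lem; have lt_m : r * w m < w (nth x0 s i).
    by apply: le_lt_trans lt_i; rewrite ler_pM2l.
  have [c Nc cK] := nbr_single mI siK (ltW lt_m).
  have -> : g m = c.
    by rewrite /g; case: pickP => [c'|/(_ c)]; rewrite Nc inE ?eqxx // => /eqP->.
  by split=> //; move: lt_m; rewrite -(wt_nbr PW mI) Nc /wt big_set1.
have gK m : m \in take i.+1 M -> g m \in K.
  by case/gP => Nm _; apply: (subsetP (nbr_sub e K m)); rewrite Nm inE.
have ug : uniq (map g (take i.+1 M)).
  rewrite map_inj_in_uniq ?take_uniq // => m m' mT m'T gmm.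
  apply/eqP/negP => /negP mm'.
  have [Nm _] := gP m mT; have [Nm' _] := gP m' m'T; rewrite -gmm in Nm'.
  have := pendants_apart KS (MM m mT).1 (MM m' m'T).1 mm' (gK m mT) Nm Nm' v3K.
  by rewrite c3.
have : {subset map g (take i.+1 M) <= take i s}.
  move=> v /mapP[m mT ->]; have [_ lt_m] := gP m mT; have := gK m mT; rewrite -sK.
  move=> vs; have [j js def_v] := nthP x0 vs; rewrite -def_v in lt_m *.
  have [ji|ij] := ltnP j i; first by rewrite -(nth_take x0 ji) mem_nth // size_takel // ltnW.
  move: lt_m; rewrite ltNge => /negP[].
  apply: (sorted_leq_nth (leT := fun v v' => w v <= w v')) => //.
  by move=> b a c; apply: le_trans.
move/(uniq_leq_size ug); rewrite size_map !size_takel ?ltnn //; exact: ltnW.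
Qed.

(** Here [P] is the deficiency. If some column has size 3, [minor_ge] makes every summand
    nonnegative. Otherwise the deficiency is at least the weight of [K], which covers the weight of
    all the places. *)
Lemma six_sum_ge (M s : seq T) x0 z t P : uniq M -> {subset M <= I} ->
  sorted (fun u u' => w u <= w u') M -> uniq s ->
  s =i K -> sorted (fun v v' => w v <= w v') s -> size M = t -> (t <= size s)%N ->
  (forall m, m \in M -> w m <= w z) ->
  0 <= P -> P = \sum_(v in K) (3 - #|column e I v|%:R) * w v ->
  0 <= \sum_(i < t) (w z - w (nth x0 M i)) * (r * w (nth x0 M i) - w (nth x0 s i)) + w z * P.
Proof.
move=> uM MI sM us sK ss sMt ts mz P0 def_P.
have [/exists_inP[v vK /eqP c3]|/exists_inPn no3] :=
  boolP [exists v in K, #|column e I v| == 3%N].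
  rewrite addr_ge0 ?mulr_ge0 ?(ltW (pw_gt0 PW z)) //; apply: sumr_ge0 => i _.
  rewrite mulr_ge0 ?subr_ge0 ?mz ?mem_nth ?sMt //.
  apply: minor_ge => //; rewrite ?sMt //; last by exists v.
  exact: leq_trans (ltn_ord i) ts.
have P_ge : wt w K <= P.
  rewrite def_P; apply: (deficiency_ge PW (A := K)) => // [|v vK]; first exact: (ks_col KS).
  by rewrite -ltnS ltn_neqAle no3 ?(ks_col KS).
have sum_le : \sum_(i < t) w (nth x0 s i) <= wt w K.
  rewrite /wt -(sum_nth_seq x0 w erefl us sK) -!(big_mkord xpredT (fun i => w (nth x0 s i))).
  rewrite [leRHS](@big_cat_nat _ _ _ t) //= lerDl sumr_ge0 // => j _.
  by rewrite ltW // (pw_gt0 PW).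
have z0 := ltW (pw_gt0 PW z).
apply: le_trans (_ : - (w z * \sum_(i < t) w (nth x0 s i)) + w z * P <= _).
  by rewrite addrC subr_ge0 ler_wpM2l // (le_trans sum_le).
rewrite lerD2r mulr_sumr -sumrN; apply: ler_sum => i _.
have mM : nth x0 M i \in M by rewrite mem_nth ?sMt.
have m0 := pw_gt0 PW (nth x0 M i); have p0 := pw_gt0 PW (nth x0 s i).
have t1 : 0 <= (w z - w (nth x0 M i)) * (r * w (nth x0 M i)).
  by rewrite mulr_ge0 ?subr_ge0 ?mz // mulr_ge0 // ltW.
have t2 : 0 <= w (nth x0 M i) * w (nth x0 s i) by rewrite mulr_ge0 // ltW.
by rewrite -subr_ge0; move: t1 t2 => *; lra.
Qed.
End SixWeights.

(** * The equality case for six or more independent vertices *)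

Section SixEquality.
Variables (T : finType) (e : rel T) (K I : {set T}).
Hypothesis KS : K14_split e K I.
Variables (n k t : nat).
Hypotheses (kn : k = (n - t.+4.+1)%N) (t0 : (0 < t)%N) (tk : (t.+4.+1 <= k)%N).
Hypotheses (Kk : #|K| = k) (It : #|I| = t.+4.+1).
Variables (x y z al be : T) (g : T -> T).
Hypotheses (xI : x \in I) (yI : y \in I) (zI : z \in I).
Hypotheses (xy : x != y) (xz : x != z) (yz : y != z).
Hypotheses (Mx : missed e K x = [set al]) (My : missed e K y = [set be]).
Hypotheses (alK : al \in K) (beK : be \in K).
Hypothesis all3 : forall v, v \in K -> #|column e I v| = 3%N.
Let minor u := [&& u \in I, u != x, u != y & u != z].
Hypothesis Ng : forall u, minor u -> nbr e K u = [set g u] /\ g u \in K.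

Let sym := ks_sym KS.

Let minor_at u v : minor u -> v \in K -> e u v = (v == g u).
Proof. by move=> /Ng[Nu _] vK; rewrite (nbr1 Nu). Qed.

Let g_inj u u' : minor u -> minor u' -> g u = g u' -> u = u'.
Proof.
move=> mu mu' guu; apply/eqP/negP => /negP uu.
have [Nu gK] := Ng mu; have [Nu' _] := Ng mu'; rewrite -guu in Nu'.
have /and4P[uI _ _ _] := mu; have /and4P[u'I _ _ _] := mu'.
by have := pendants_apart KS uI u'I uu gK Nu Nu' alK; rewrite all3.
Qed.

Let one_minor u u' v : v \in K -> minor u -> minor u' -> e u v -> e u' v -> u = u'.
Proof.
move=> vK mu mu'; rewrite !minor_at // => /eqP-> /eqP/g_inj; exact.
Qed.

Let minor_or u : u \in I -> [|| u == x, u == y, u == z | minor u].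
Proof. by rewrite /minor => ->; case: (u == x); case: (u == y); case: (u == z). Qed.

(** A column contains at most one pendant row, because pendants sit at distinct vertices. Without
    [p] it can reach size 3 only as {p', z, m} with [m] pendant. *)
Let lost_top p p' v : v \in K -> [|| (p == x) && (p' == y) | (p == y) && (p' == x)] ->
  ~~ e p v -> e z v /\ exists2 m, minor m & e m v.
Proof.
move=> vK pp' npv.
have col_minor u : u \in column e I v -> u != p' -> u != z -> minor u.
  rewrite (mem_column KS) => /andP[uI euv] up' uz.
  have up : u != p by apply: contraNneq npv => <-.
  rewrite /minor uI uz; case/orP: pp' => /andP[/eqP pE /eqP pE'];
  by rewrite -?pE -?pE' up up'.
have col_e u : u \in column e I v -> e u v by rewrite (mem_column KS) => /andP[].
have c3 := all3 vK.
have ezv : e z v.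
  apply: contraT => nzv; have : (1 < #|column e I v :\ p'|)%N.
    by move: c3; rewrite (cardsD1 p'); case: (p' \in _); case: #|_ :\ _| => [|[|?]].
  case/card_gt1P => u [u' []]; rewrite !in_setD1 => /andP[up uc] /andP[up' uc'] uu.
  have zn u0 : u0 \in column e I v -> u0 != z.
    by move=> /col_e eu; apply: contraNneq nzv => <-.
  by rewrite (one_minor vK (col_minor u uc up (zn u uc)) (col_minor u' uc' up' (zn u' uc')) (col_e u uc) (col_e u' uc')) eqxx in uu.
split=> //; have : (0 < #|column e I v :\ p' :\ z|)%N.
  move: c3; rewrite (cardsD1 p') (cardsD1 z (_ :\ p')).
  by case: (p' \in _); case: (z \in _); case: #|_ :\ _| => [|?].
case/card_gt0P => u; rewrite !in_setD1 => /and3P[uz up' uc].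
by exists u; [apply: col_minor | apply: col_e].
Qed.

Let top_full v : v \in K -> e x v -> e y v ->
  e z v = ~~ [exists m, minor m && e m v].
Proof.
move=> vK exv eyv; have c3 := all3 vK; apply/idP/existsPn => [ezv m|no_m].
  apply/negP => /andP[mm emv]; have /and4P[mI mx my mz] := mm.
  have : m |: (x |: (y |: [set z])) \subset column e I v.
    apply/subsetP => u; rewrite !inE => /or4P[] /eqP->;
    by rewrite ?mI ?xI ?yI ?zI sym.
  by move/subset_leq_card; rewrite c3 !cardsU1 !inE !negb_or mx my mz xy xz yz cards1.
apply: contraT => nz; have : column e I v \subset [set x; y].
  apply/subsetP => u; rewrite (mem_column KS) !inE => /andP[uI euv].
  have /or4P[-> //|->|/eqP uz|mu] := minor_or uI; first by rewrite orbT.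
    by rewrite -uz euv in nz.
  by have := no_m u; rewrite mu euv.
by move/subset_leq_card; rewrite c3 cards2 xy.
Qed.

(** By [lost_top] both [al] and [be] carry [z] and a pendant row; these rows are [m1] and [m0]. At
    every other clique vertex [x] and [y] are present, and either [z] or one pendant row completes
    the column. So [z] misses exactly the neighbours of the remaining pendants. *)
Lemma six_rows_eq : graph_iso e (@split_rel k t.+4.+1 (Gamma_cross n t.+4.+1)).
Proof.
have al_be : al != be.
  have [|v vK /andP[va /orP[]]] := spread_misses KS (x := x) (y := y) (a := al) _ xI yI xy alK.
  - by rewrite It !ltnS.
  - by rewrite (missed1 Mx) // va.
  - by rewrite (missed1 My) // negbK => /eqP<-; rewrite eq_sym.
have nxal : ~~ e x al by rewrite (missed1 Mx) // eqxx.
have nybe : ~~ e y be by rewrite (missed1 My) // eqxx.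
have [ez_al [m1 mm1 em1]] := lost_top (p := x) (p' := y) alK (introT orP (or_introl (introT andP (conj (eqxx x) (eqxx y))))) nxal.
have [ez_be [m0 mm0 em0]] := lost_top (p := y) (p' := x) beK (introT orP (or_intror (introT andP (conj (eqxx y) (eqxx x))))) nybe.
have [Nm1 gm1K] := Ng mm1; have [Nm0 gm0K] := Ng mm0.
have gm1 : g m1 = al by move: em1; rewrite minor_at // => /eqP.
have gm0 : g m0 = be by move: em0; rewrite minor_at // => /eqP.
rewrite gm1 in Nm1; rewrite gm0 in Nm0.
have m01 : m0 != m1 by apply: contraNneq al_be => mm; rewrite -gm1 -gm0 mm.
have /and4P[m0I m0x m0y m0z] := mm0; have /and4P[m1I m1x m1y m1z] := mm1.
pose ms := enum (I :\ x :\ y :\ z :\ m0 :\ m1).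
have mem_ms u : (u \in ms) = [&& u != m1, u != m0, u != z, u != y, u != x & u \in I].
  by rewrite mem_enum !inE.
have ms_minor u : u \in ms -> [/\ minor u, u != m0 & u != m1].
  rewrite mem_ms => /and5P[-> -> uz uy /andP[ux uI]].
  by rewrite /minor uI ux uy uz.
have uq : uniq (ms ++ [:: x; y; z; m0; m1]).
  rewrite cat_uniq enum_uniq /= !inE !negb_or xy xz yz m01.
  rewrite ![x == _]eq_sym ![y == _]eq_sym ![z == _]eq_sym m0x m0y m0z m1x m1y m1z /=.
  by rewrite !mem_ms !eqxx !andbF.
have qI : ms ++ [:: x; y; z; m0; m1] =i I.
  move=> u; rewrite mem_cat mem_ms !inE.
  case: (eqVneq u x) => [->|ux]; first by rewrite xI ?orbT.
  case: (eqVneq u y) => [->|uy]; first by rewrite yI ?orbT.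
  case: (eqVneq u z) => [->|uz]; first by rewrite zI ?orbT.
  case: (eqVneq u m0) => [->|um0]; first by rewrite m0I ?orbT.
  by case: (eqVneq u m1) => [->|um1]; rewrite ?m1I //= ?orbF.
have sms : size ms = t.
  have : size (ms ++ [:: x; y; z; m0; m1]) = t.+4.+1.
    by rewrite -It -(card_uniqP uq); apply: eq_card.
  by rewrite size_cat /= !addnS addn0 => -[].
have g_ms v : v \in map g ms -> exists m, [/\ minor m, m != m0, m != m1 & g m = v].
  by case/mapP => m /ms_minor[mm mm0' mm1'] ->; exists m.
apply: (iso_Gamma6 KS kn t0 tk Kk (g := g) sms uq qI Mx My _ Nm0 Nm1 beK alK) => //.
- by move=> m /ms_minor[mm _ _]; apply: Ng.
- by rewrite eq_sym.
- rewrite map_inj_in_uniq ?enum_uniq // => u u' /ms_minor[mu _ _] /ms_minor[mu' _ _].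
  exact: g_inj.
- apply/negP => /g_ms[m [mm nm0 _]]; rewrite -gm0 => /(g_inj mm mm0) mE.
  by rewrite mE eqxx in nm0.
- apply/negP => /g_ms[m [mm _ nm1]]; rewrite -gm1 => /(g_inj mm mm1) mE.
  by rewrite mE eqxx in nm1.
move=> v vK; have [->|val] := eqVneq v al.
  rewrite ez_al; apply/esym/negP => /g_ms[m [mm _ nm1]]; rewrite -gm1 => /(g_inj mm mm1) mE.
  by rewrite mE eqxx in nm1.
have [->|vbe] := eqVneq v be.
  rewrite ez_be; apply/esym/negP => /g_ms[m [mm nm0 _]]; rewrite -gm0 => /(g_inj mm mm0) mE.
  by rewrite mE eqxx in nm0.
rewrite top_full ?(missed1 Mx) ?(missed1 My) //; congr (~~ _).
apply/existsP/idP => [[m /andP[mm emv]]|/g_ms[m [mm _ _ <-]]]; last first.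
  by exists m; rewrite mm minor_at ?eqxx //; have [] := Ng mm.
move: emv; rewrite minor_at // => /eqP vE; rewrite vE; apply: map_f.
have /and4P[mI mx my mz] := mm; rewrite mem_ms mI mx my mz !andbT.
by apply/andP; split; [apply: contraNneq val | apply: contraNneq vbe] => mE;
   rewrite vE mE ?gm1 ?gm0.
Qed.
End SixEquality.

Lemma nth_tail5 (T : Type) (x0 : T) (m : seq T) (t : nat) a b c d f : size m = t ->
  [/\ forall i, (i < t)%N -> nth x0 (m ++ [:: a; b; c; d; f]) i = nth x0 m i,
      nth x0 (m ++ [:: a; b; c; d; f]) t = a /\
      nth x0 (m ++ [:: a; b; c; d; f]) t.+1 = b,
      nth x0 (m ++ [:: a; b; c; d; f]) t.+2 = c,
      nth x0 (m ++ [:: a; b; c; d; f]) t.+3 = d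
    & nth x0 (m ++ [:: a; b; c; d; f]) t.+4 = f].
Proof.
move=> sm; have E j : nth x0 (m ++ [:: a; b; c; d; f]) (t + j) = nth x0 [:: a; b; c; d; f] j.
  by rewrite nth_cat sm ltnNge leq_addr addKn.
have := E 0%N; have := E 1%N; have := E 2%N; have := E 3%N; have := E 4%N.
rewrite addn0 addn1 addn2 addn3 addn4 => -> -> -> -> -> /=; do 2?split=> //.
by move=> i it; rewrite nth_cat sm it.
Qed.

Lemma perm_tail5 (T : eqType) (x y z m0 m1 : T) (m : seq T) :
  perm_eq (x :: y :: z :: rev [:: m0, m1 & m]) (m ++ [:: y; x; z; m0; m1]).
Proof.
apply/permP => p; rewrite /= !rev_cons -!cats1 !count_cat count_rev /=; lia.
Qed.

Lemma perm_tail2 (T : eqType) (a b : T) (s : seq T) :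
  perm_eq [:: a, b & s] (s ++ [:: a; b]).
Proof. by apply/permP => p; rewrite /= !count_cat /=; lia. Qed.

Lemma nth_tail2 (T : Type) (x0 : T) (s : seq T) (k : nat) a b :
  size (s ++ [:: a; b]) = k ->
  [/\ forall i, (i.+2 < k)%N -> nth x0 (s ++ [:: a; b]) i = nth x0 s i,
      nth x0 (s ++ [:: a; b]) k.-2 = a & nth x0 (s ++ [:: a; b]) k.-1 = b].
Proof.
rewrite size_cat addn2 => <-; split=> /=.
- by move=> i; rewrite !ltnS nth_cat => ->.
- by rewrite nth_cat ltnn subnn.
- by rewrite nth_cat ltnNge leqnSn subSnn.
Qed.

Section SixRows.
Variables (R : realFieldType) (T : finType) (e : rel T) (K I : {set T}).
Variables (w : T -> R) (r : R).
Hypothesis KS : K14_split e K I.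
Hypothesis PW : perron_weights e K I w r.
Hypothesis r_gt0 : 0 < r.

Lemma six_rows n k t : k = (n - t.+4.+1)%N -> (0 < t)%N -> (t.+4.+1 <= k)%N ->
  #|K| = k -> #|I| = t.+4.+1 ->
  rayleigh_bounded (@split_rel k t.+4.+1 (Gamma_cross n t.+4.+1)) r ->
  graph_iso e (@split_rel k t.+4.+1 (Gamma_cross n t.+4.+1)).
Proof.
move=> kn t0 tk Kk It bdd.
have w2 := column_weights_lt2 KS PW r_gt0 (r_ge3 PW (leq_trans (_ : 4 <= t.+4.+1)%N (_ : t.+4.+1 <= #|K|)%N)).
have {}w2 := w2 isT; rewrite Kk in w2; have {}w2 := w2 tk.
have [q0 [uq0 q0I sq0 ss0]] := sorted_listing w I; rewrite It in sq0.
have [M [x [y [z def_q0]]]] : exists M, exists x y z, q0 = x :: y :: z :: rev M.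
  case: q0 sq0 {uq0 q0I ss0} => [|x [|y [|z q]]] // _.
  by exists (rev q), x, y, z; rewrite revK.
subst q0; have sM : size M = t.+2 by move: sq0; rewrite /= size_rev => -[].
move: ss0; rewrite /= => /and3P[yx zy zM].
have transR : transitive (fun a b : T => w b <= w a) by move=> b a c ab bc; apply: le_trans bc ab.
have sortM : sorted (fun u u' => w u <= w u') M.
  by rewrite -[M]revK rev_sorted; apply: path_sorted zM.
have Mz m : m \in M -> w m <= w z.
  by rewrite -mem_rev => /(allP (order_path_min transR zM)).
case: M sM uq0 q0I sq0 sortM Mz {zM} => [|m0 [|m1 ms]] // [sms] uq0 q0I _ sortM Mz.
(* The heaviest row [x] will miss the lightest clique vertex [a], and [y] the next one, [b]. The two
   lightest rows [m0] and [m1] become pendant at [a] and [b], the other light rows at the following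
   clique vertices in increasing order. *)
have [uq qI] := perm_listing (perm_tail5 x y z m0 m1 ms) uq0 q0I.
have sq : size (ms ++ [:: y; x; z; m0; m1]) = t.+4.+1 by rewrite size_cat sms /= addnC.
set q := ms ++ _ in uq qI sq.
have [s0 [us0 s0K size_s0 sort_s0]] : exists s0, [/\ uniq s0, s0 =i K, size s0 = k &
    sorted (fun v v' => w v <= w v') s0].
  have [s [us sK ss sorts]] := sorted_listing w K; exists (rev s).
  by split; rewrite ?rev_uniq ?size_rev ?ss ?rev_sorted // => v; rewrite mem_rev.
case: s0 us0 s0K size_s0 sort_s0 => [|a [|b s']] us0 s0K size_s0 sort_s0.
- by rewrite -size_s0 in tk.
- by rewrite -size_s0 in tk.
have [us sK] : uniq (s' ++ [:: a; b]) /\ s' ++ [:: a; b] =i K.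
  have ps := perm_tail2 a b s'; rewrite -(perm_uniq ps); split=> // v.
  by rewrite -(perm_mem ps).
have ss : size (s' ++ [:: a; b]) = k by rewrite -size_s0 size_cat addnC.
have [nth_s nth_a nth_b] := nth_tail2 x ss; set s := s' ++ _ in us sK ss nth_s nth_a nth_b.
have [nth_q [nth_y nth_x] nth_z nth_m0 nth_m1] := nth_tail5 x y x z m0 m1 sms.
rewrite -/q in nth_q nth_y nth_x nth_z nth_m0 nth_m1.
have ts' : (t <= size s')%N by move: tk; rewrite -size_s0 /= !ltnS => h; apply: leq_trans h; rewrite !leqW.
have [k1 k2 tk'] : [/\ (k.-1 < k)%N, (k.-2 < k)%N & (t.+2 <= k)%N] by rewrite -size_s0 /= !ltnS leqnSn leqnn.
have cross j (jk : (j < k)%N) := Gamma_cross6 kn t0 tk jk.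
set c := Gamma_cross n t.+4.+1 in cross bdd *.
have hr_i i : (i < t)%N -> hrow w k c x s i = w (nth x s' i).
  move=> it; have ik2 : (i.+2 < k)%N by apply: leq_trans tk'; rewrite !ltnS.
  have ik : (i < k)%N by apply: ltn_trans ik2; rewrite ltnS leqnSn.
  by rewrite -nth_s //; apply: hrow_one => // j jk; have [h _ _ _ _] := cross j jk; apply: h.
have hr_y : hrow w k c x s t = wt w K - w b.
  by rewrite -nth_b; apply: hrow_all_but => // j jk; have [_ []] := cross j jk.
have hr_x : hrow w k c x s t.+1 = wt w K - w a.
  by rewrite -nth_a; apply: hrow_all_but => // j jk; have [_ []] := cross j jk.
have hr_m0 : hrow w k c x s t.+3 = w a.
  by rewrite -nth_a; apply: hrow_one => // j jk; have [_ _] := cross j jk.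
have hr_m1 : hrow w k c x s t.+4 = w b.
  by rewrite -nth_b; apply: hrow_one => // j jk; have [_ _] := cross j jk.
pose Sp := \sum_(i < t) w (nth x s' i).
have hr_z : hrow w k c x s t.+2 = wt w K - Sp.
  rewrite -(wtK_arrange w x ss us sK) (bigID (fun j : 'I_k => (t <= j)%N)) /= addrC.
  have -> : \sum_(j < k | ~~ (t <= j)%N) w (nth x s j) = Sp.
    have tk0 : (t <= k)%N by apply: leq_trans tk'; rewrite leqW.
    rewrite /Sp (big_ord_widen k (fun j => w (nth x s' j)) tk0).
    apply: eq_big => [j|j]; first by rewrite -ltnNge.
    rewrite -ltnNge => jt; rewrite nth_s //; apply: leq_trans tk'; by rewrite !ltnS.
  rewrite addrC addrK; apply: eq_bigl => j; have [_ _ -> //] := cross j (ltn_ord j).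
have le0 := arrange_le KS PW x ss sq us uq sK qI bdd.
have eq0 := arrange_eq KS PW (x0 := x) ss sq us uq sK qI bdd.
have memI : [/\ x \in I, y \in I, z \in I, m0 \in I & m1 \in I].
  by rewrite -!qI /q !mem_cat !inE !eqxx !orbT.
case: memI => xI yI zI m0I m1I.
pose S := \sum_(i < t) w (nth x ms i).
pose M2 := \sum_(i < t) w (nth x ms i) * (r * w (nth x ms i)).
pose Q := \sum_(i < t) w (nth x ms i) * w (nth x s' i).
move: le0 eq0; rewrite !big_ord_recr /= hr_y hr_x hr_z hr_m0 hr_m1 nth_y nth_x nth_z nth_m0 nth_m1.
have -> : \sum_(i < t) w (nth x q i) * (hrow w k c x s i - r * w (nth x q i)) = Q - M2.
  rewrite /Q /M2 -sumrB; apply: eq_bigr => i _.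
  by rewrite hr_i // nth_q // mulrBr.
move=> le0 eq0.
have [aK bK] : a \in K /\ b \in K by rewrite -!s0K !inE !eqxx !orbT.
have ab : a != b by move: us0; rewrite /= inE negb_or => /andP[/andP[]].
have transS : transitive (fun v v' : T => w v <= w v') by move=> v2 v1 v3; apply: le_trans.
have min_a v : v \in K -> w a <= w v.
  rewrite -s0K inE => /orP[/eqP->//|]; move: sort_s0 => /(order_path_min transS)/allP; exact.
have min_b v : v \in K -> v != a -> w b <= w v.
  rewrite -s0K !inE => /orP[->//|/orP[/eqP->//|vs _]].
  by move: sort_s0 => /= /andP[_ /(order_path_min transS)/allP]; apply.
have miss_ge u v : u \in I -> v \in K -> ~~ e u v -> w v <= wt w K - r * w u.
  by move=> uI vK nuv; rewrite -(wt_missed PW uI); apply: (wt_ge1 PW); rewrite inE vK.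
have xy : x != y by move: uq0; rewrite /= !inE !negb_or => /andP[/andP[]].
have xz : x != z by move: uq0; rewrite /= !inE !negb_or => /andP[/and3P[]].
have yz : y != z by move: uq0; rewrite /= !inE !negb_or => /and3P[_ /andP[]].
have spread : 0 <= (w x - w z) * (wt w K - r * w x - w a) + (w y - w z) * (wt w K - r * w y - w b).
  have low u : u \in I -> w a <= wt w K - r * w u.
    move=> uI; have [v vK nuv] := ks_miss KS uI.
    exact: le_trans (min_a v vK) (miss_ge u v uI vK nuv).
  apply: spread_ineq => //; rewrite ?low // ?min_a //.
  have [|v vK /andP[va]] := spread_misses KS (x := x) (y := y) (a := a) _ xI yI xy aK.
    by rewrite It !ltnS.
  by case/orP => nv; rewrite (le_trans (min_b v vK va) (miss_ge _ v _ vK nv)) ?orbT.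
have defE := sum_deficiency KS PW 3 uq qI.
have SE : \sum_(u <- q) r * w u =
    r * S + (r * w y + (r * w x + (r * w z + (r * w m0 + (r * w m1 + 0))))).
  rewrite /q big_cat !big_cons big_nil /=; congr (_ + _).
  by rewrite (big_nth x) sms big_mkord /S mulr_sumr.
rewrite SE in defE.
have def_ge0 : 0 <= \sum_(v in K) (3 - #|column e I v|%:R) * w v.
  by apply: le_trans (deficiency_ge PW (A := set0) (@ks_col _ _ _ _ KS) (sub0set _) _);
    rewrite ?/wt ?big_set0 // => v; rewrite inE.
have key : 0 <= (w z - w m0) * (r * w m0 - w a) + (w z - w m1) * (r * w m1 - w b)
       + (w z * (r * S) - w z * Sp - M2 + Q)
       + w z * (3 * wt w K - (r * S + (r * w y + (r * w x + (r * w z + (r * w m0 + (r * w m1 + 0))))))).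
  rewrite defE.
  have MI : {subset [:: m0, m1 & ms] <= I}.
    by move=> u um; rewrite -q0I !inE mem_rev um !orbT.
  have uM : uniq [:: m0, m1 & ms].
    by move: uq0 => /= /and4P[_ _ _]; rewrite rev_uniq.
  have sM : size [:: m0, m1 & ms] = t.+2 by rewrite /= sms.
  (* All [t.+2] light rows are matched with the lightest clique vertices at once; the terms of [m0]
     and [m1] are then split off. *)
  have := six_sum_ge KS PW r_gt0 w2 x uM MI sortM us0 s0K sort_s0 sM _ Mz def_ge0 erefl.
  rewrite size_s0 => /(_ tk'); rewrite !big_ord_recl /= !addrA.
  have -> : \sum_(i < t) (w z - w (nth x ms (0 + i))) *
      (r * w (nth x ms (0 + i)) - w (nth x s' (0 + i))) =
      w z * (r * S) - w z * Sp - M2 + Q.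
    rewrite /S /Sp /M2 /Q 2!mulr_sumr mulr_sumr -!sumrN -!big_split /=.
    by apply: eq_bigr => i _; rewrite add0n; ring.
  by rewrite !addrA.
have ge0 := six_rows_ineq spread key.
have {}eq0 := eq0 (le_anti (introT andP (conj le0 ge0))).
have [t1 t2 t3 t4 t5] : [/\ (t < t.+4.+1)%N, (t.+1 < t.+4.+1)%N, (t.+2 < t.+4.+1)%N,
    (t.+3 < t.+4.+1)%N & (t.+4 < t.+4.+1)%N] by rewrite !ltnS !leqW.
have Ei i : (i < t)%N -> w (nth x s' i) = r * w (nth x ms i).
  move=> it; rewrite -nth_q // -hr_i // eq0 //; apply: ltn_trans it _.
  exact: t1.
have := eq0 _ t1; have := eq0 _ t2; have := eq0 _ t3; have := eq0 _ t4; have := eq0 _ t5.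
rewrite hr_y hr_x hr_z hr_m0 hr_m1 nth_y nth_x nth_z nth_m0 nth_m1 => Em1 Em0 Ez Ex Ey.
have ESp : Sp = r * S.
  by rewrite /Sp /S mulr_sumr; apply: eq_bigr => i _; apply: Ei.
(* The row equations add up to deficiency 0, since H has none; hence every column of G has size
   3. *)
have def0 : \sum_(v in K) (3 - #|column e I v|%:R) * w v = 0.
  rewrite -defE -Ey -Ex -Ez -Em0 -Em1 ESp; move: (wt w K) (r * S) (w a) (w b) => *; ring.
have all3 v : v \in K -> #|column e I v| = 3%N.
  move=> vK; apply/eqP; rewrite eqn_leq (ks_col KS vK) ltnNge; apply/negP => c2.
  have := deficiency_ge PW (A := [set v]) (@ks_col _ _ _ _ KS).
  rewrite def0 sub1set vK /wt big_set1 => /(_ isT) vle.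
  have {}vle : w v <= 0 by apply: vle => u; rewrite inE => /eqP->.
  by move: vle; rewrite leNgt (pw_gt0 PW).
have [al Mx alK] := wt_single_in PW w2 (missed_sub e K x) (missed_neq0 KS xI) aK
  (etrans (wt_missed PW xI) (etrans (congr1 (+%R (wt w K) \o -%R) (esym Ex)) (subKr _ _))).
have [be My beK] := wt_single_in PW w2 (missed_sub e K y) (missed_neq0 KS yI) bK
  (etrans (wt_missed PW yI) (etrans (congr1 (+%R (wt w K) \o -%R) (esym Ey)) (subKr _ _))).
pose g m := odflt m [pick v in nbr e K m].
apply: (six_rows_eq KS kn t0 tk Kk It xI yI zI xy xz yz Mx My alK beK all3 (g := g)).
move=> u /and4P[uI ux uy uz].
have [v vK le_uv] : exists2 v, v \in K & r * w u <= w v.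
  move: (uI); rewrite -qI /q mem_cat !inE (negPf ux) (negPf uy) (negPf uz) /=.
  case/or3P => [um|/eqP->|/eqP->].
  - have [i] := nthP x um; rewrite sms => it <-; exists (nth x s' i); last by rewrite Ei.
    by rewrite -s0K !inE mem_nth ?orbT // (leq_trans it).
  - by exists a; rewrite // Em0.
  - by exists b; rewrite // Em1.
have [d Nd dK] := nbr_single KS PW w2 uI vK le_uv.
have -> : g u = d by rewrite /g; case: pickP => [c'|/(_ d)]; rewrite Nd inE ?eqxx // => /eqP->.
by [].
Qed.
End SixRows.

(** * At most two independent vertices *)

Lemma Gamma_cross2 n k j : k = (n - 2)%N -> (4 <= k)%N -> (j < k)%N ->
  Gamma_cross n 2 1 j.+1 = (j != k.-1) /\ Gamma_cross n 2 2 j.+1 = (j == k.-2).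
Proof. by rewrite /Gamma_cross /=; split; lia. Qed.

Section SmallT.
Variables (T : finType) (e : rel T) (K I : {set T}).
Hypothesis KS : K14_split e K I.
Let sym := ks_sym KS.

Lemma one_row n k : k = (n - 1)%N -> #|K| = k -> #|I| = 1%N -> (2 <= k)%N ->
  hamiltonian e \/ graph_iso e (@split_rel k 1 (Gamma_cross n 1)).
Proof.
move=> kn Kk /eqP/cards1P[u Iu] k2.
have uI : u \in I by rewrite Iu inE.
have qI : [:: u] =i I by move=> v; rewrite Iu !inE.
have [|] := leqP #|nbr e K u| 1.
  move=> le1; right; have /cards1P[a Na] : #|nbr e K u| == 1%N.
    by rewrite eqn_leq le1 card_gt0 (nbr_neq0 KS).
  have aK : a \in K by apply: (subsetP (nbr_sub e K u)); rewrite Na inE.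
  have [b bK] := @ex_notin _ K [:: a] ltac:(by rewrite Kk); rewrite inE => ba.
  have [s [us sK ss s0 _]] := listing_ends u bK aK ba; rewrite Kk in ss.
  apply: (graph_iso_split KS (x0 := u) (s := s) (q := [:: u])) => //.
  case=> // j _ jk; rewrite (nbr1 Na) -?sK ?mem_nth ?ss // -s0 nth_uniq ?ss //.
  by apply: leq_trans k2.
case/card_gt1P => a [b [aN bN ab]]; left.
apply: (hamiltonian_alternate_path KS (z := [:: (a, u)]) (l := b)) => //.
- by rewrite /= inE ab.
- by move=> v; rewrite !inE => /orP[] /eqP->; apply: (subsetP (nbr_sub e K u)).
move: aN bN; rewrite !inE => /andP[_ eua] /andP[_ eub].
by rewrite /= sym eua eub.
Qed.

(** Equal neighbourhoods have three members, giving a path a x b y c. Otherwise some [c] is joined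
    to one row only; start there and pass to the other row either through a common neighbour or
    along a clique edge. *)
Lemma hamiltonian_two x y : uniq [:: x; y] -> [:: x; y] =i I ->
  (1 < #|nbr e K x|)%N -> (1 < #|nbr e K y|)%N ->
  (2 < #|nbr e K x :|: nbr e K y|)%N -> hamiltonian e.
Proof.
move=> uq qI.
have nK u v : v \in nbr e K u -> v \in K by apply: (subsetP (nbr_sub e K u)).
have nE u v : v \in nbr e K u -> e u v by rewrite inE => /andP[].
have chain u v a b c : uniq [:: u; v] -> [:: u; v] =i I -> uniq [:: a; b; c] ->
    a \in nbr e K u -> b \in nbr e K u -> b \in nbr e K v -> c \in nbr e K v ->
    hamiltonian e.
  move=> uuv uvI uabc au bu bv cv.
  apply: (hamiltonian_alternate_path KS (z := [:: (a, u); (b, v)]) (l := c)) => //.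
  - move=> d; rewrite !inE => /or3P[] /eqP->; [exact: nK au|exact: nK bu|exact: nK cv].
  - by rewrite /= sym (nE u a) // (nE u b) // sym (nE v b) // (nE v c).
have main u v c : uniq [:: u; v] -> [:: u; v] =i I -> (1 < #|nbr e K u|)%N ->
    (1 < #|nbr e K v|)%N -> c \in nbr e K u -> c \notin nbr e K v -> hamiltonian e.
  move=> uuv uvI cu1 cv1 cu ncv.
  have /card_gt0P[a] : (0 < #|nbr e K u :\ c|)%N.
    by move: cu1; rewrite (cardsD1 c) cu.
  rewrite in_setD1 => /andP[ac au].
  have /card_gt1P[b [d [bv dv bd]]] := cv1.
  have neq_c f : f \in nbr e K v -> c != f by move=> fv; apply: contraNneq ncv => ->.
  have [ab|ab] := eqVneq a b.
    by apply: (chain u v c a d) => //; rewrite ?ab //= !inE !negb_or ?(neq_c b) ?(neq_c d) ?bd.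
  have [ad|ad] := eqVneq a d.
    apply: (chain u v c a b) => //; rewrite ?ad //= !inE !negb_or ?(neq_c b) ?(neq_c d) //.
    by rewrite eq_sym bd.
  have [uI vI] : u \in I /\ v \in I by rewrite -!uvI !inE !eqxx orbT.
  have uv : u != v by move: uuv; rewrite /= inE andbT.
  have [aK bK] := (nK u a au, nK v b bv); have [cK dK] := (nK u c cu, nK v d dv).
  have uall : uniq [:: c; u; a; b; v; d].
    have ca : c != a by rewrite eq_sym.
    rewrite /= !inE !negb_or ca (neq_c b) // (neq_c d) // ab ad uv bd.
    by rewrite !(neqKI KS cK uI, neqKI KS cK vI, neqKI KS aK uI, neqKI KS bK uI,
      neqKI KS dK uI, neqKI KS aK vI, neqKI KS bK vI, neqKI KS dK vI).
  apply: (hamiltonian_path KS (x := c) (c := [:: u; a; b; v; d])) => //.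
  - by apply: leq_trans (max_card (mem [:: c; u; a; b; v; d])); rewrite (card_uniqP uall).
  - rewrite /= sym (nE u c) // (nE u a) // (ks_clique KS aK bK ab) sym (nE v b) //.
    by rewrite (nE v d).
  - move=> f; rewrite -uvI !inE => /orP[] /eqP->; by rewrite eqxx ?orbT.
move=> cx cy cxy; have [Nxy|] := eqVneq (nbr e K x) (nbr e K y).
  move: cxy; rewrite -Nxy setUid => /card_gt2P[a [b [c [[aN bN cN] [ab bc ca]]]]].
  apply: (chain x y a b c); rewrite -?Nxy //= !inE !negb_or ab bc eq_sym ca //.
have qI' : [:: y; x] =i I by move=> v; rewrite -qI !inE orbC.
have uq' : uniq [:: y; x] by move: uq; rewrite /= !inE eq_sym.
rewrite eqEsubset negb_and => /orP[] /subsetPn[c cin cout].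
  exact: (main x y c).
exact: (main y x c).
Qed.

Lemma listing_last2 a b x0 : a \in K -> b \in K -> a != b -> exists s : seq T,
  [/\ uniq s, s =i K, size s = #|K|, nth x0 s #|K|.-2 = a & nth x0 s #|K|.-1 = b].
Proof.
move=> aK bK ab; pose s := enum (K :\ a :\ b) ++ [:: a; b].
have us : uniq s.
  by rewrite cat_uniq enum_uniq /= !mem_enum !inE !eqxx ab ?andbF.
have sK : s =i K.
  move=> v; rewrite mem_cat mem_enum !inE.
  have [->|va] := eqVneq v a; first by rewrite aK ?orbT.
  by have [->|vb] := eqVneq v b; rewrite ?bK //= orbF.
have ss : size s = #|K| by rewrite -(card_uniqP us); apply: eq_card.
by exists s; have [_ na nb] := nth_tail2 x0 ss.
Qed.

Lemma iso_Gamma2 n k x j c d : k = (n - 2)%N -> #|K| = k -> (4 <= k)%N ->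
  uniq [:: x; j] -> [:: x; j] =i I -> missed e K x = [set d] -> nbr e K j = [set c] ->
  c \in K -> d \in K -> c != d -> graph_iso e (@split_rel k 2 (Gamma_cross n 2)).
Proof.
move=> kn Kk k4 uq qI Mx Nj cK dK cd.
have [s [us sK ss s2 s1]] := listing_last2 x cK dK cd; rewrite Kk in ss s2 s1.
apply: (graph_iso_split KS (x0 := x) (s := s) (q := [:: x; j])) => //.
move=> i l i2 lk; have lK : nth x s l \in K by rewrite -sK mem_nth ?ss.
have [c0 c1] := Gamma_cross2 kn k4 lk.
have k1 : (k.-1 < k)%N by case: (k) k4.
have k2 : (k.-2 < k)%N by case: (k) k4 => [|[]].
case: i i2 => [|[|//]] _; rewrite ?c0 ?c1 /= ?(missed1 Mx) ?(nbr1 Nj) //.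
  by rewrite -s1 nth_uniq ?ss.
by rewrite -s2 nth_uniq ?ss.
Qed.

Lemma iso_Gamma'2 n k x j d : k = (n - 2)%N -> #|K| = k -> k = 3%N ->
  uniq [:: x; j] -> [:: x; j] =i I -> missed e K x = [set d] -> missed e K j = [set d] ->
  d \in K -> graph_iso e (@split_rel k 2 Gamma'2_cross).
Proof.
move=> kn Kk k3 uq qI Mx Mj dK.
have [c cK] := @ex_notin _ K [:: d] ltac:(by rewrite Kk k3); rewrite inE => cd.
have [s [us sK ss s2 s1]] := listing_last2 x cK dK cd; rewrite Kk in ss s2 s1.
apply: (graph_iso_split KS (x0 := x) (s := s) (q := [:: x; j])) => //.
move=> i l i2 lk; have lK : nth x s l \in K by rewrite -sK mem_nth ?ss.
have k1 : (k.-1 < k)%N by rewrite k3.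
have -> : Gamma'2_cross i.+1 l.+1 = (l != k.-1).
  by move: i2 lk; rewrite /Gamma'2_cross k3; case: i => [|[|]]; case: l {lK} => [|[|[|]]].
by case: i i2 => [|[|//]] _; rewrite /= ?(missed1 Mx) ?(missed1 Mj) // -s1 nth_uniq ?ss.
Qed.
End SmallT.

(* The test vector (10, 10, 11, 8; 8, 3) approximates the Perron vector, whose
   eigenvalue is 3.7104.... *)
Lemma Gamma62_bound (R : realFieldType) (r : R) :
  rayleigh_bounded (@split_rel 4 2 (Gamma_cross 6 2)) r -> 1698 <= r * 458.
Proof.
move=> bdd.
pose v (x : 'I_4 + 'I_2) : R := match x with
  | inl j => nth 0 [:: 10; 10; 11; 8] j | inr i => nth 0 [:: 8; 3] i end.
have [] := bdd v; rewrite !big_sumType /= !big_ord_recr !big_ord0 /=.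
rewrite !big_sumType /=; do !rewrite [\sum_(_ < _ | _) _]big_mkcond !big_ord_recr !big_ord0 /=.
by move=> h _; lra.
Qed.

(** These are the equations of K_4 with two further vertices joined to the same two clique vertices:
    [A] is the weight of those two, [C] of the other two, [u] of the added ones. Eliminating [C] and
    [u] leaves the cubic. *)
Lemma twin_cubic (R : realFieldType) (r A C u : R) : 0 < A ->
  (r + 1) * A = A + A + C + C + u + u -> (r + 1) * C = A + A + C + C ->
  r * u = A + A -> r ^+ 3 - 2 * r ^+ 2 - 7 * r + 4 = 0.
Proof.
move=> A0 E1 E2 E3.
suff : A * (r ^+ 3 - 2 * r ^+ 2 - 7 * r + 4) = 0.
  by move/eqP; rewrite mulf_eq0 gt_eqF //= => /eqP.
have E4 : (r - 1) * C = A + A by lra.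
have E5 : (r - 1) * A = C + C + u + u by lra.
have -> : A * (r ^+ 3 - 2 * r ^+ 2 - 7 * r + 4) =
  r * (r - 1) * ((r - 1) * A) - 4 * r * A - 4 * (r - 1) * A by ring.
rewrite E5 (_ : r * (r - 1) * (C + C + u + u) = 2 * r * ((r - 1) * C) + 2 * (r - 1) * (r * u)).
  by rewrite E4 E3; ring.
by ring.
Qed.

(** The bound gives r > 3.7, and the cubic has only positive coefficients when expanded in powers of
    r - 3.7. *)
Lemma twin_cubic_absurd (R : realFieldType) (r : R) : 1698 <= r * 458 ->
  r ^+ 3 - 2 * r ^+ 2 - 7 * r + 4 = 0 -> False.
Proof.
move=> r_ge E; have r37 : 0 <= r - 37 / 10 by lra.
have t : 0 <= (r - 37 / 10) * ((r - 37 / 10) * (r - 37 / 10)) by rewrite !mulr_ge0.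
have t' : 0 <= (r - 37 / 10) * (r - 37 / 10) by rewrite mulr_ge0.
have : (0 : R) < 0 by lra.
by rewrite ltxx.
Qed.

Section TwoRows.
Variables (R : realFieldType) (T : finType) (e : rel T) (K I : {set T}).
Variables (w : T -> R) (r : R).
Hypothesis KS : K14_split e K I.
Hypothesis PW : perron_weights e K I w r.
Hypothesis r_gt0 : 0 < r.

Let w_gt0 := pw_gt0 PW.

Lemma missed_ge u v : u \in I -> v \in K -> ~~ e u v -> w v <= wt w K - r * w u.
Proof. by move=> uI vK nuv; rewrite -(wt_missed PW uI); apply: (wt_ge1 PW); rewrite inE vK. Qed.

Lemma wt_ge_seq (s : seq T) : uniq s -> {subset s <= K} -> \sum_(v <- s) w v <= wt w K.
Proof.
move=> us sK; rewrite (big_uniq _ us) /wt (big_setID [set v in s]) /= -[leLHS]addr0.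
apply: lerD; last by apply: sumr_ge0 => v _; apply: ltW.
rewrite le_eqVlt; apply/orP; left; apply/eqP; apply: eq_bigl => v.
by rewrite !inE andbC; case vs: (v \in s); rewrite //= sK.
Qed.

Section Large.
Variables (n k : nat).
Hypotheses (kn : k = (n - 2)%N) (k4 : (4 <= k)%N) (Kk : #|K| = k).
Hypothesis bdd : rayleigh_bounded (@split_rel k 2 (Gamma_cross n 2)) r.

Let w2 : forall v v', v \in K -> v' \in K -> w v < w v' + w v'.
Proof. by apply: (column_weights_lt2 KS PW r_gt0); apply: (r_ge3 PW); rewrite Kk. Qed.

Lemma two_arrange x j p q : uniq [:: x; j] -> [:: x; j] =i I ->
  p \in K -> q \in K -> p != q ->
  w x * (wt w K - w q - r * w x) + w j * (w p - r * w j) <= 0 /\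
  (w x * (wt w K - w q - r * w x) + w j * (w p - r * w j) = 0 ->
   wt w K - r * w x = w q).
Proof.
move=> uq qI pK qK pq.
have [s [us sK ss s2 s1]] := listing_last2 x pK qK pq; rewrite Kk in ss s2 s1.
have k1 : (k.-1 < k)%N by case: (k) k4.
have k2 : (k.-2 < k)%N by case: (k) k4 => [|[]].
have hr0 : hrow w k (Gamma_cross n 2) x s 0 = wt w K - w q.
  by rewrite -s1; apply: hrow_all_but => // l lk; have [] := Gamma_cross2 kn k4 lk.
have hr1 : hrow w k (Gamma_cross n 2) x s 1 = w p.
  by rewrite -s2; apply: hrow_one => // l lk; have [] := Gamma_cross2 kn k4 lk.
have le0 := arrange_le KS PW x ss (erefl : size [:: x; j] = 2%N) us uq sK qI bdd.
have eq0 := arrange_eq KS PW (x0 := x) ss (erefl : size [:: x; j] = 2%N) us uq sK qI bdd.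
move: le0 eq0; rewrite !big_ord_recr big_ord0 /= hr0 hr1 add0r => le0 eq0.
split=> // /eq0/(_ 0%N isT); rewrite /= hr0 => <-.
by rewrite opprB addrC subrK.
Qed.

(** If [x] misses some [al] other than [c], placing [al] and [c] as in H gives a nonnegative sum,
    and equality gives H. The other possibility, that [x] misses only [c], is contradictory:
    exchanging [c] with another vertex [d] lowers the form only if w(d) <= w(c), so w(x) <= w(j) by
    the column equations, whence [c] carries at least half the weight of [K], more than the factor
    two permits. *)
Lemma two_pendant x j c : uniq [:: x; j] -> [:: x; j] =i I -> nbr e K j = [set c] ->
  graph_iso e (@split_rel k 2 (Gamma_cross n 2)).
Proof.
move=> uq qI Nj; have [xI jI] : x \in I /\ j \in I by rewrite -!qI !inE !eqxx orbT.
have cK : c \in K by apply: (subsetP (nbr_sub e K j)); rewrite Nj inE.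
have Wj : r * w j = w c by rewrite -(wt_nbr PW jI) Nj /wt big_set1.
have [/exists_inP[al alK /andP[alc nal]]|/exists_inPn all_c] :=
  boolP [exists al in K, (al != c) && ~~ e x al].
  have cal : c != al by rewrite eq_sym.
  have [le0 eq0] := two_arrange uq qI cK alK cal.
  rewrite Wj subrr mulr0 addr0 in le0 eq0.
  have le1 := missed_ge xI alK nal.
  have ge0 : 0 <= w x * (wt w K - w al - r * w x).
    by rewrite mulr_ge0 ?(ltW (w_gt0 x)) // addrAC subr_ge0.
  have E := eq0 (le_anti (introT andP (conj le0 ge0))).
  have [d Mx dK] := wt_single_in PW w2 (missed_sub e K x) (missed_neq0 KS xI) alK
    (etrans (wt_missed PW xI) E).
  have al_d : al = d by apply/eqP; rewrite -(in_set1 al d) -Mx inE alK.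
  by apply: (iso_Gamma2 KS kn Kk k4 uq qI Mx Nj) => //; rewrite -al_d.
have Mx : missed e K x = [set c].
  have sub : missed e K x \subset [set c].
    apply/subsetP => v; rewrite !inE => /andP[vK nv].
    by have := all_c v vK; rewrite nv andbT negbK.
  by apply/eqP; rewrite eqEsubset sub; have := missed_neq0 KS xI;
     case/set0Pn => v vM; rewrite sub1set; have := subsetP sub v vM; rewrite inE => /eqP<-.
have [d dK] := @ex_notin _ K [:: c] ltac:(by rewrite Kk; exact: leq_trans k4).
rewrite inE => dc.
have [f fK] := @ex_notin _ K [:: c; d] ltac:(by rewrite Kk; exact: leq_trans k4).
rewrite !inE negb_or => /andP[fc fd].
have [le0 _] := two_arrange uq qI dK cK dc.
have Wx : r * w x = wt w K - w c.
  by have := wt_missed PW xI; rewrite Mx /wt big_set1 -/(wt w K) => ->; rewrite subKr.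
rewrite Wx subrr mulr0 add0r Wj pmulr_rle0 // subr_le0 in le0.
have := column_eq KS PW uq qI cK; have := column_eq KS PW uq qI dK.
rewrite !big_cons !big_nil !(missed1 Mx) // !(nbr1 Nj) // eqxx dc (negPf dc) /= => Ed Ec.
have le_K : w c + (w d + (w f + 0)) <= wt w K.
  have us : uniq [:: c; d; f].
    by rewrite /= !inE !negb_or [c == d]eq_sym dc [c == f]eq_sym fc [d == f]eq_sym fd.
  have := wt_ge_seq us; rewrite !big_cons big_nil; apply=> v.
  by rewrite !inE => /or3P[] /eqP->.
have lt1 := w2 cK dK; have lt2 := w2 cK fK.
have xj : w x <= w j.
  have r1 : 0 <= r + 1 by rewrite addr_ge0 // ltW.
  have le1 := ler_wpM2l r1 le0; lra.
have := ler_wpM2l (ltW r_gt0) xj; rewrite Wx Wj => le3.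
have : (0 : R) < 0 by lra.
by rewrite ltxx.
Qed.

(** Let [x] miss only some [c] and [j] be pendant at [a]: the comparison leaves P <= w(a) + 2 w(b) +
    w(c). With five clique vertices, two further ones then weigh at most w(b), against the factor
    two. With four, the eigenvalue equations are solved and contradict the bound from the test
    vector. *)
Lemma two_twins x j a b : uniq [:: x; j] -> [:: x; j] =i I -> a != b ->
  nbr e K x = [set a; b] -> nbr e K j = [set a; b] -> False.
Proof.
move=> uq qI ab Nx Nj; have [xI jI] : x \in I /\ j \in I by rewrite -!qI !inE !eqxx orbT.
have [aK bK] : a \in K /\ b \in K.
  by split; apply: (subsetP (nbr_sub e K x)); rewrite Nx !inE eqxx ?orbT.
have Wx : r * w x = w a + w b.
  by rewrite -(wt_nbr PW xI) Nx /wt big_setU1 ?inE // big_set1.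
have Wj : r * w j = w a + w b.
  by rewrite -(wt_nbr PW jI) Nj /wt big_setU1 ?inE // big_set1.
have /(mulfI (lt0r_neq0 r_gt0)) xj : r * w x = r * w j by rewrite Wx Wj.
have [c cK] := @ex_notin _ K [:: a; b] ltac:(by rewrite Kk; exact: leq_trans k4).
rewrite !inE negb_or => /andP[ca cb].
have [d dK] := @ex_notin _ K [:: a; b; c] ltac:(by rewrite Kk).
rewrite !inE !negb_or => /and3P[da db dc].
have uabcd : uniq [:: a; b; c; d].
  by rewrite /= !inE !negb_or ab ![_ == c]eq_sym ![_ == d]eq_sym ca cb da db dc.
have [k5|k_lt5] := leqP 5 k.
  have [f fK] := @ex_notin _ K [:: a; b; c; d] ltac:(by rewrite Kk).
  rewrite !inE !negb_or => /and4P[fa fb fc fd].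
  have ac : a != c by rewrite eq_sym.
  have [le0 _] := two_arrange uq qI aK cK ac.
  rewrite Wx Wj xj -mulrDr pmulr_rle0 // in le0.
  have us : uniq [:: f; a; b; c; d] by rewrite cons_uniq uabcd !inE !negb_or fa fb fc fd.
  have := wt_ge_seq us; rewrite !big_cons big_nil => le_K.
  have {}le_K : w f + (w a + (w b + (w c + (w d + 0)))) <= wt w K.
    apply: le_K => v; rewrite !inE => /orP[/eqP->//|/or4P[] /eqP-> //].
  have lt1 := w2 bK dK; have lt2 := w2 bK fK.
  have : (0 : R) < 0 by lra.
  by rewrite ltxx.
have k_eq4 : k = 4%N by apply/eqP; rewrite eqn_leq k4 -ltnS k_lt5.
have n6 : n = 6%N by move: kn k_eq4 => ->; case: (n) => [|[|m]] //; rewrite !subSS subn0 => ->.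
have r_big : 1698 <= r * 458 by apply: Gamma62_bound; move: bdd; rewrite n6 k_eq4.
have ee u v : u \in I -> v \in K -> e u v = (v == a) || (v == b).
  move=> uI vK; have : nbr e K u = [set a; b].
    by move: uI; rewrite -qI !inE => /orP[] /eqP->.
  by move/setP/(_ v); rewrite !inE vK.
have Ea := column_eq KS PW uq qI aK; have Eb := column_eq KS PW uq qI bK.
have Ec := column_eq KS PW uq qI cK; have Ed := column_eq KS PW uq qI dK.
rewrite !big_cons !big_nil !ee // !eqxx ?orbT ?(negPf ca) ?(negPf cb) ?(negPf da) ?(negPf db) /= in Ea Eb Ec Ed.
have KE : wt w K = w a + w b + w c + w d.
  have subK : [:: a; b; c; d] =i K.
    apply/subset_cardP; first by rewrite (card_uniqP uabcd) Kk k_eq4.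
    by apply/subsetP => v; rewrite !inE => /or4P[] /eqP->.
  rewrite /wt -(eq_bigl _ _ subK) -(big_uniq _ uabcd) /= !big_cons big_nil.
  by rewrite addr0 !addrA.
have r1 : r + 1 != 0 by rewrite lt0r_neq0 // addr_gt0.
have ab_eq : w a = w b by apply: (mulfI r1); rewrite Ea Eb.
have cd_eq : w c = w d by apply: (mulfI r1); rewrite Ec Ed.
apply: (twin_cubic_absurd r_big).
apply: (@twin_cubic _ r (w a) (w c) (w x)) => //.
- by rewrite Ea KE -ab_eq -cd_eq -xj; ring.
- by rewrite Ec KE -ab_eq -cd_eq; ring.
- by rewrite Wx -ab_eq.
Qed.

Lemma two_rows : #|I| = 2%N -> 
  hamiltonian e \/ graph_iso e (@split_rel k 2 (Gamma_cross n 2)).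
Proof.
move=> I2; have [q [uq qI sq _]] := sorted_listing w I; rewrite I2 in sq.
case: q uq qI sq => [|x [|j [|? ?]]] // uq qI _.
have [xI jI] : x \in I /\ j \in I by rewrite -!qI !inE !eqxx orbT.
have single u : u \in I -> (#|nbr e K u| <= 1)%N -> exists c, nbr e K u = [set c].
  move=> uI u1; have /cards1P[c Nc] : #|nbr e K u| == 1%N.
    by rewrite eqn_leq u1 card_gt0 (nbr_neq0 KS).
  by exists c.
have [j1|j1] := leqP #|nbr e K j| 1.
  by have [c Nj] := single j jI j1; right; exact: (two_pendant uq qI Nj).
have qI' : [:: j; x] =i I by move=> v; rewrite -qI !inE orbC.
have uq' : uniq [:: j; x] by move: uq; rewrite /= !inE eq_sym.
have [x1|x1] := leqP #|nbr e K x| 1.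
  by have [c Nx] := single x xI x1; right; exact: (two_pendant uq' qI' Nx).
have [U2|U3] := leqP #|nbr e K x :|: nbr e K j| 2; last first.
  by left; apply: (hamiltonian_two KS uq qI).
have Nx : nbr e K x = nbr e K x :|: nbr e K j.
  by apply/eqP; rewrite eqEcard subsetUl (leq_trans U2).
have Nj : nbr e K j = nbr e K x :|: nbr e K j.
  by apply/eqP; rewrite eqEcard subsetUr (leq_trans U2).
have /cards2P[a [b [ab NE]]] : #|nbr e K x| == 2%N.
  by rewrite eqn_leq x1 andbT {1}Nx.
by case: (two_twins uq qI ab NE); rewrite Nj -Nx.
Qed.
End Large.
End TwoRows.

(** * Three clique vertices *)

Lemma perm_eq3 (T : eqType) (x y j : T) :
  perm_eq [:: x; y; j] [:: x; j; y] /\ perm_eq [:: x; y; j] [:: y; j; x].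
Proof. by split; apply/permP => p /=; lia. Qed.

Section ThreeColumns.
Variables (R : realFieldType) (T : finType) (e : rel T) (K I : {set T}).
Variables (w : T -> R) (r : R).
Hypothesis KS : K14_split e K I.
Hypothesis PW : perron_weights e K I w r.
Hypothesis r_gt0 : 0 < r.
Hypothesis K3 : #|K| = 3%N.

Let w_gt0 := pw_gt0 PW.

Lemma wt_missed_eq u a : u \in I -> a \in K -> ~~ e u a ->
  wt w K - r * w u = w a -> missed e K u = [set a].
Proof.
move=> uI aK nua; rewrite -(wt_missed PW uI) => Wa.
apply/setP => v; rewrite inE; apply/idP/eqP => [vM|->]; last by rewrite inE aK.
apply/eqP/negP => /negP va; have aM : a \in missed e K u by rewrite inE aK.
by have := wt_ge2 PW vM aM va; rewrite Wa leNgt ltrDr w_gt0.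
Qed.

(** To exclude a row [j'] pendant at [c], let both rows miss a vertex [a] that [x'] misses. The term
    of [j'] is w(j') (P - w(a) - w(c)), positive by the factor two if a = c and thanks to the third
    clique vertex otherwise. So both rows have two neighbours, and either their union is all of [K]
    or both miss the same vertex, as in H. *)
Lemma two_rows_small n : (n - 2 = 3)%N -> #|I| = 2%N ->
  rayleigh_bounded (@split_rel (n - 2) 2 Gamma'2_cross) r ->
  hamiltonian e \/ graph_iso e (@split_rel (n - 2) 2 Gamma'2_cross).
Proof.
move=> n3 I2 bdd; have [q [uq qI sq _]] := sorted_listing w I; rewrite I2 in sq.
case: q uq qI sq => [|x [|j [|? ?]]] // uq qI _.
have [xI jI] : x \in I /\ j \in I by rewrite -!qI !inE !eqxx orbT.
have arr x' j' a : uniq [:: x'; j'] -> [:: x'; j'] =i I -> a \in K ->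
    w x' * (wt w K - w a - r * w x') + w j' * (wt w K - w a - r * w j') <= 0.
  move=> uq' qI' aK.
  have [c cK] := @ex_notin _ K [:: a] ltac:(by rewrite K3); rewrite inE => ca.
  have [s [us sK ss _ sl]] := listing_last2 x cK aK ca; rewrite K3 in ss sl.
  rewrite -n3 in ss sl.
  have hr i : (i < 2)%N -> hrow w (n - 2) Gamma'2_cross x s i = wt w K - w a.
    move=> i2; rewrite -sl; apply: hrow_all_but => //; first by rewrite n3.
    by rewrite n3 => l l3; case: i i2 => [|[|]] //; case: l l3 => [|[|[|]]].
  have := arrange_le KS PW x ss (erefl : size [:: x'; j'] = 2%N) us uq' sK qI' bdd.
  by rewrite !big_ord_recr big_ord0 /= !hr // add0r.
have r2 : 2 <= r by have := r_ge PW ltac:(by rewrite K3); rewrite K3; lra.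
have w2 v v' : v \in K -> v' \in K -> w v < w v' + w v'.
  move=> vK v'K; apply: (w_lt2 KS PW) => //; apply: le_trans r2; rewrite ler_nat -I2.
  by apply/subset_leq_card/subsetP => u; rewrite inE => /andP[].
have P3 a b c : uniq [:: a; b; c] -> a \in K -> b \in K -> c \in K ->
    w a + w b + w c <= wt w K.
  move=> us aK bK cK; have := wt_ge_seq PW us; rewrite !big_cons big_nil addr0 addrA; apply=> v.
  by rewrite !inE => /or3P[] /eqP->.
have no_pendant x' j' c : uniq [:: x'; j'] -> [:: x'; j'] =i I -> nbr e K j' = [set c] -> False.
  move=> uq' qI' Nj; have [xI' jI'] : x' \in I /\ j' \in I by rewrite -!qI' !inE !eqxx orbT.
  have cK : c \in K by apply: (subsetP (nbr_sub e K j')); rewrite Nj inE.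
  have Wj : r * w j' = w c by rewrite -(wt_nbr PW jI') Nj /wt big_set1.
  have [a aK nxa] := ks_miss KS xI'.
  have le0 := arr x' j' a uq' qI' aK; rewrite Wj in le0.
  have [b bK] := @ex_notin _ K [:: a; c] ltac:(by rewrite K3); rewrite !inE negb_or => /andP[ba bc].
  have t1 : 0 <= w x' * (wt w K - w a - r * w x').
    by rewrite mulr_ge0 ?(ltW (w_gt0 _)) // addrAC subr_ge0 (missed_ge PW).
  have [ac|ac] := eqVneq a c.
    have [d dK] := @ex_notin _ K [:: c; b] ltac:(by rewrite K3); rewrite !inE negb_or => /andP[dc db].
    have le3 : w c + w b + w d <= wt w K.
      by apply: P3 => //; rewrite /= !inE !negb_or [c == b]eq_sym bc [c == d]eq_sym dc [b == d]eq_sym db.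
    have lt1 := w2 c b cK bK; have lt2 := w2 c d cK dK.
    have t2 : 0 < w j' * (wt w K - w a - w c).
      by rewrite mulr_gt0 // ac; lra.
    have : (0 : R) < 0 by lra.
    by rewrite ltxx.
  have le3 : w a + w c + w b <= wt w K.
    by apply: P3 => //; rewrite /= !inE !negb_or ac [a == b]eq_sym ba [c == b]eq_sym bc.
  have t2 : 0 < w j' * (wt w K - w a - w c).
    by rewrite mulr_gt0 //; have := w_gt0 b; lra.
  have : (0 : R) < 0 by lra.
  by rewrite ltxx.
have big u u' : uniq [:: u'; u] -> [:: u'; u] =i I -> u \in I -> (1 < #|nbr e K u|)%N.
  move=> uq' qI' uI; rewrite ltnNge; apply/negP => u1.
  have /cards1P[c Nc] : #|nbr e K u| == 1%N by rewrite eqn_leq u1 card_gt0 (nbr_neq0 KS).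
  exact: no_pendant uq' qI' Nc.
have qI' : [:: j; x] =i I by move=> v; rewrite -qI !inE orbC.
have uq' : uniq [:: j; x] by move: uq; rewrite /= !inE eq_sym.
have j1 := big j x uq qI jI; have x1 := big x j uq' qI' xI.
have [U2|U3] := leqP #|nbr e K x :|: nbr e K j| 2; last first.
  by left; apply: (hamiltonian_two KS uq qI).
right; have Nx : nbr e K x = nbr e K x :|: nbr e K j.
  by apply/eqP; rewrite eqEcard subsetUl (leq_trans U2).
have Nj : nbr e K j = nbr e K x :|: nbr e K j.
  by apply/eqP; rewrite eqEcard subsetUr (leq_trans U2).
have missedE u : missed e K u = K :\: nbr e K u.
  by apply/setP => v; rewrite !inE; case: (v \in K); rewrite ?andbF // !andbT.
have /cards1P[d Md] : #|missed e K x| == 1%N.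
  rewrite missedE cardsD (setIidPr (nbr_sub e K x)) K3 Nx.
  by rewrite (_ : #|_| = 2%N) //; apply/eqP; rewrite eqn_leq U2 -Nx.
apply: (iso_Gamma'2 KS (d := d) erefl _ n3 uq qI Md) => //; first by rewrite K3 n3.
  by rewrite missedE Nj -Nx -missedE.
by apply: (subsetP (missed_sub e K x)); rewrite Md inE.
Qed.

(** In H two rows miss one clique vertex and the third row another. If three missed vertices of G
    can be chosen in this pattern, every summand is nonnegative and equality gives H; this is
    [iso]. *)
Lemma three_rows_small n : (n - 3 = 3)%N -> #|I| = 3%N ->
  rayleigh_bounded (@split_rel (n - 3) 3 (Gamma'3_cross n)) r ->
  hamiltonian e \/ graph_iso e (@split_rel (n - 3) 3 (Gamma'3_cross n)).
Proof.
move=> n3 I3 bdd; have n6 : n = 6%N by lia.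
have cross i l : (i < 3)%N -> (l < n - 3)%N -> Gamma'3_cross n i.+1 l.+1 =
    if (i < 2)%N then l != 2%N else l != 0%N.
  by rewrite n6; case: i => [|[|[|]]] //; case: l => [|[|[|]]].
have iso x y j a b : uniq [:: x; y; j] -> [:: x; y; j] =i I -> a \in K -> b \in K ->
    a != b -> ~~ e x a -> ~~ e y a -> ~~ e j b ->
    graph_iso e (@split_rel (n - 3) 3 (Gamma'3_cross n)).
  move=> uq qI aK bK ab nx ny nj.
  have [[xI yI] jI] : (x \in I /\ y \in I) /\ j \in I by rewrite -!qI !inE !eqxx ?orbT.
  have [s [us sK ss s0 sl]] := listing_ends x aK bK ab; rewrite K3 in ss sl.
  rewrite -n3 in ss.
  have nthE l l' : (l < n - 3)%N -> (l' < n - 3)%N -> (nth x s l == nth x s l') = (l == l').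
    by move=> lk l'k; rewrite nth_uniq ?ss.
  have hr i : (i < 2)%N -> hrow w (n - 3) (Gamma'3_cross n) x s i = wt w K - w a.
    move=> i2; rewrite -sl; apply: hrow_all_but => //= [|l lk]; first by rewrite n3.
    by rewrite cross ?i2 // ltnW.
  have hr2 : hrow w (n - 3) (Gamma'3_cross n) x s 2 = wt w K - w b.
    by rewrite -s0; apply: hrow_all_but => //= [|l lk]; [rewrite n3 | rewrite cross].
  have le0 := arrange_le KS PW x ss (erefl : size [:: x; y; j] = 3%N) us uq sK qI bdd.
  have eq0 := arrange_eq KS PW (x0 := x) ss (erefl : size [:: x; y; j] = 3%N) us uq sK qI bdd.
  move: le0 eq0; rewrite !big_ord_recr big_ord0 /= (hr 0%N isT) (hr 1%N isT) hr2 add0r => le0 eq0.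
  have ge u c : u \in I -> c \in K -> ~~ e u c -> 0 <= w u * (wt w K - w c - r * w u).
    by move=> uI cK nuc; rewrite mulr_ge0 ?(ltW (w_gt0 _)) // addrAC subr_ge0 (missed_ge PW).
  have ge0 := addr_ge0 (addr_ge0 (ge x a xI aK nx) (ge y a yI aK ny)) (ge j b jI bK nj).
  have {}eq0 := eq0 (le_anti (introT andP (conj le0 ge0))).
  have := eq0 0%N isT; have := eq0 1%N isT; have := eq0 2%N isT.
  rewrite /= (hr 0%N isT) (hr 1%N isT) hr2 => Ej Ey Ex.
  have flip u c : wt w K - w c = r * w u -> wt w K - r * w u = w c by move=> <-; rewrite opprB addrC subrK.
  have Mx := wt_missed_eq xI aK nx (flip x a Ex); have My := wt_missed_eq yI aK ny (flip y a Ey).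
  have Mj := wt_missed_eq jI bK nj (flip j b Ej).
  apply: (graph_iso_split KS (x0 := x) (s := s) (q := [:: x; y; j])) => // i l i3 lk.
  have lK : nth x s l \in K by rewrite -sK mem_nth ?ss.
  have k2 : (3.-1 < n - 3)%N by rewrite n3.
  have k0 : (0 < n - 3)%N by rewrite n3.
  rewrite cross //; case: i i3 => [|[|[|//]]] _ /=; rewrite ?(missed1 Mx) ?(missed1 My) ?(missed1 Mj) //.
  - by rewrite -sl nthE.
  - by rewrite -sl nthE.
  - by rewrite -s0 nthE.
have [q [uq qI sq _]] := sorted_listing w I; rewrite I3 in sq.
case: q uq qI sq => [|x [|y [|j [|? ?]]]] // uq qI _.
have [[xI yI] jI] : (x \in I /\ y \in I) /\ j \in I by rewrite -!qI !inE !eqxx ?orbT.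
have [p1 p2] := perm_eq3 x y j.
have [uq1 qI1] := perm_listing p1 uq qI; have [uq2 qI2] := perm_listing p2 uq qI.
have [a aK nxa] := ks_miss KS xI; have [b bK nyb] := ks_miss KS yI.
have [c cK njc] := ks_miss KS jI.
pose good := graph_iso e (@split_rel (n - 3) 3 (Gamma'3_cross n)).
(* If exactly two of the chosen missed vertices agree, [iso] applies. What remains is that all agree
   or all differ, for every choice. *)
have g1 a' b' c' : a' \in K -> b' \in K -> c' \in K -> ~~ e x a' -> ~~ e y b' -> ~~ e j c' ->
    [\/ good, a' = b' /\ a' = c' | [/\ a' != b', a' != c' & b' != c']].
  move=> aK' bK' cK' nx ny nj.
  have [ab|ab] := eqVneq a' b'; have [ac|ac] := eqVneq a' c'.
  - by apply: Or32.
  - by apply: Or31; apply: (iso x y j a' c') => //; rewrite ab.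
  - by apply: Or31; apply: (iso x j y a' b') => //; rewrite ac.
  have [bc|bc] := eqVneq b' c'; last by apply: Or33.
  have ba : b' != a' by rewrite eq_sym.
  by apply: Or31; apply: (iso y j x b' a') => //; rewrite bc.
case: (g1 a b c aK bK cK nxa nyb njc) => [|[ab ac]|[ab ac bc]]; first by right.
  subst b c; move: nyb njc {bK cK} => nyb njc.
  (* All three rows miss [a]. Changing one choice shows that a row missing anything else leads to H;
     if none does, the column of [a] is empty and meets no column of size 3. *)
  have uni u v : u \in I -> v \in K -> ~~ e u v -> v != a -> good.
    move=> uI vK nuv va; have := uI; rewrite -qI !inE => /or3P[] /eqP uE; rewrite uE in nuv.
    - case: (g1 v a a) => //; first by case=> vaE _; rewrite vaE eqxx in va.
      by case=> _ _; rewrite eqxx.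
    - case: (g1 a v a) => //; first by case=> vaE _; rewrite -vaE eqxx in va.
      by case=> _; rewrite eqxx.
    - case: (g1 a a v) => //; first by case=> _ vaE; rewrite -vaE eqxx in va.
      by case; rewrite eqxx.
  have [v vK] := @ex_notin _ K [:: a] ltac:(by rewrite K3); rewrite inE => va.
  have [ex|/(uni x v xI vK)] := boolP (e x v); last by move/(_ va); right.
  have [ey|/(uni y v yI vK)] := boolP (e y v); last by move/(_ va); right.
  have [ej|/(uni j v jI vK)] := boolP (e j v); last by move/(_ va); right.
  have c3 : #|column e I v| = 3%N by rewrite (card_column KS v uq qI) /= ex ey ej.
  have [u] := ks_meet KS vK aK c3; rewrite !(mem_column KS) => /andP[uI _] /andP[_].
  by move: uI; rewrite -qI !inE => /or3P[] /eqP->; rewrite ?(negPf nxa) ?(negPf nyb) ?(negPf njc).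
(* Three different choices exhaust [K]. Changing one shows that, unless G is H, each row misses only
   its own vertex, and a cycle can be written down. *)
have full u v : u \in I -> v \in K -> ~~ e u v ->
    good \/ [\/ u = x /\ v = a, u = y /\ v = b | u = j /\ v = c].
  move=> uI vK nuv; have KE : v \in [:: a; b; c].
    have uabc : uniq [:: a; b; c] by rewrite /= !inE !negb_or ab ac bc.
    have /subset_cardP/(_ _)/(_ v)-> // : #|[:: a; b; c]| = #|K| by rewrite (card_uniqP uabc) K3.
    by apply/subsetP => t; rewrite !inE => /or3P[] /eqP->.
  have := uI; rewrite -qI !inE => /or3P[] /eqP uE; rewrite uE in nuv *.
  - case: (g1 v b c vK bK cK nuv nyb njc) => [||[vb vc _]]; [by left| by case=> -> E; rewrite E eqxx in bc|].
    right; apply: Or31; split=> //; move: KE; rewrite !inE (negPf vb) (negPf vc) !orbF => /eqP //.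
  - case: (g1 a v c aK vK cK nxa nuv njc) => [||[va _ vc]]; [by left| by case=> <- E; rewrite E eqxx in ac|].
    right; apply: Or32; split=> //; move: KE; rewrite !inE eq_sym (negPf va) (negPf vc) !orbF => /eqP //.
  - case: (g1 a b v aK bK vK nxa nyb nuv) => [||[_ va vb]]; [by left| by case=> E _; rewrite E eqxx in ab|].
    right; apply: Or33; split=> //; move: KE; rewrite !inE eq_sym (negPf va) eq_sym (negPf vb) /= => /eqP //.
have [/existsP[u /existsP[v]]|/existsPn nobad] := boolP [exists u, exists v,
  [&& u \in I, v \in K, ~~ e u v & ~~ [|| (u == x) && (v == a), (u == y) && (v == b) | (u == j) && (v == c)]]].
  case/and4P => uI vK nuv; rewrite !negb_or => /and3P[n1 n2 n3'].
  case: (full u v uI vK nuv); [by right | case=> -[uE vE]; by rewrite uE vE !eqxx in n1 n2 n3'].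
have ee u v : u \in I -> v \in K -> ~~ [|| (u == x) && (v == a), (u == y) && (v == b) | (u == j) && (v == c)] -> e u v.
  move=> uI vK nb; have /existsPn/(_ v) := nobad u; rewrite uI vK nb andbT /= negbK; exact.
left; have sym := ks_sym KS.
have [xy xj yj] : [/\ x != y, x != j & y != j] by move: uq; rewrite /= !inE !negb_or => /and3P[/andP[-> ->] ->].
have [yx jx jy] : [/\ y != x, j != x & j != y] by rewrite eq_sym xy eq_sym xj eq_sym yj.
have [ba ca cb] : [/\ b != a, c != a & c != b] by rewrite eq_sym ab eq_sym ac eq_sym bc.
apply: (hamiltonian_alternate_cycle KS (z := [:: (a, y); (c, x); (b, j)])) => //.
- by rewrite /= !inE !negb_or ac ab cb.
- by rewrite /= !inE !negb_or yx yj xj.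
- by move=> v; rewrite !inE => /or3P[] /eqP->.
- by move=> u; rewrite -qI /= !inE; case: (u == x); case: (u == y).
- rewrite /= [e a y]sym [e c x]sym [e b j]sym.
  by rewrite !ee // ?(negPf yx) ?(negPf xy) ?(negPf yj) ?(negPf jy) ?(negPf xj) ?(negPf jx)
    ?(negPf ba) ?(negPf ab) ?(negPf ca) ?(negPf ac) ?(negPf cb) ?(negPf bc) ?andbF.
move=> f fK; rewrite /= !inE !negb_or => /and3P[fa fc fb].
have : (#|[:: f; a; c; b]| <= #|K|)%N.
  by apply/subset_leq_card/subsetP => v; rewrite !inE => /or4P[] /eqP->.
have uf : uniq [:: f; a; c; b] by rewrite /= !inE !negb_or fa fc fb ac ab cb.
by rewrite (card_uniqP uf) K3.
Qed.
End ThreeColumns.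

(** * Three independent vertices *)

Lemma Gamma_cross3 n k j : k = (n - 3)%N -> (4 <= k)%N -> (j < k)%N ->
  [/\ Gamma_cross n 3 1 j.+1 = (j != k.-1), Gamma_cross n 3 2 j.+1 = (j != k.-1)
    & Gamma_cross n 3 3 j.+1 = (j == k.-1)].
Proof. by rewrite /Gamma_cross /=; split; lia. Qed.

(* The test vector satisfies the eigenvalue equation for r at every vertex
   except at v_1, ..., v_(k-1), where its defect has a constant sign. *)
Lemma Gamma3_bound (R : realFieldType) (r : R) n k : k.+1 = (n - 3)%N -> (4 <= k.+1)%N ->
  1 < r -> rayleigh_bounded (@split_rel k.+1 3 (Gamma_cross n 3)) r ->
  k%:R * (3 * r ^+ 2 - 2) <= (r - k%:R + 1) * (r * (r ^+ 2 - 1)).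
Proof.
move=> kn k4 r1; have crs l (lk : (l < k.+1)%N) := Gamma_cross3 kn k4 lk.
move: (Gamma_cross n 3) crs => c crs bdd {kn}; pose N : R := k%:R.
have r0 : r != 0 by rewrite lt0r_neq0 // (lt_trans ltr01).
have q0 : 0 < r ^+ 2 - 1 by rewrite subr_gt0 exprn_egt1.
have q1 : r ^+ 2 - 1 != 0 by rewrite lt0r_neq0.
(* [X] solves r X = N at the first two rows. [V] solves r V = N + V / r at the last clique vertex,
   whose pendant row carries V / r. *)
pose X := N / r; pose V := N * r / (r ^+ 2 - 1).
pose v (x : 'I_k.+1 + 'I_3) : R := match x with
  | inl j => if (j == k :> nat) then V else 1 | inr i => if (i < 2)%N then X else V / r end.
have sumK : \sum_(l < k.+1) v (inl l) = N + V.
  rewrite big_ord_recr /= eqxx; congr (_ + _).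
  rewrite (eq_bigr (fun=> 1)) => [|l _]; last by rewrite (ltn_eqF (ltn_ord l)).
  by rewrite sumr_const card_ord.
have sum_but : \sum_(l < k.+1 | l != k :> nat) v (inl l) = N.
  by apply: (addIr V); rewrite -sumK [in RHS](bigD1 ord_max) //= eqxx addrC.
pose D : R := N - 1 + V + X + X - r.
have defect x : \sum_(y | split_rel c x y) v y =
    r * v x + (if x is inl j then (if (j == k :> nat) then 0 else D) else 0).
  rewrite big_sumType; case: x => [j|i] /=; last first.
    rewrite [X in _ + X]big1 // !addr0.
    have -> : \sum_(l < k.+1 | c i.+1 l.+1) v (inl l) = if (i < 2)%N then N else V.
      case: i => -[|[|[|//]]] /= _.
      - by rewrite -sum_but; apply: eq_bigl => l; have [-> _ _] := crs l (ltn_ord l).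
      - by rewrite -sum_but; apply: eq_bigl => l; have [_ -> _] := crs l (ltn_ord l).
      - rewrite (big_pred1 ord_max) /= ?eqxx // => l.
        by have [_ _ ->] := crs l (ltn_ord l).
    by case: ifP => _; rewrite /X; field.
  have -> : \sum_(l < k.+1 | j != l) v (inl l) = N + V - v (inl j).
    rewrite -sumK [in RHS](bigD1 j) //= addrAC subrr add0r.
    by apply: eq_bigl => l; rewrite eq_sym.
  have [c1 c2 c3] := crs j (ltn_ord j).
  rewrite big_mkcond !big_ord_recr big_ord0 /= c1 c2 c3 /= add0r.
  case: ifP => jk /=.
    by rewrite /V; field; rewrite r0 q1.
  by rewrite /D; ring.
have [+ _] := bdd v.
under eq_bigr do rewrite defect mulrDr.
rewrite big_split /= mulr_sumr (eq_bigr (fun x => r * v x ^+ 2)) => [|x _]; last by ring.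
rewrite gerDl big_sumType /= [X in _ + X]big1 ?addr0 => [|i _]; last by rewrite mulr0.
rewrite big_ord_recr /= eqxx mulr0 addr0 (eq_bigr (fun=> D)) => [|l _]; last first.
  by rewrite (ltn_eqF (ltn_ord l)) mul1r.
rewrite sumr_const card_ord -[D *+ k]mulr_natl pmulr_rle0 => [D0|]; last first.
  by rewrite ltr0n; case: (k) k4.
have : r * (r ^+ 2 - 1) * D <= 0 by rewrite pmulr_rle0 // mulr_gt0 // (lt_trans ltr01).
have -> : r * (r ^+ 2 - 1) * D = N * (3 * r ^+ 2 - 2) - (r - N + 1) * (r * (r ^+ 2 - 1)).
  by rewrite /D /V /X; field; rewrite r0 q1.
by rewrite subr_le0.
Qed.

(** The equations express [N] as a rational function of [r], namely N F M = r E F - M. Inserted in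
    the bound for H, this leaves a polynomial inequality that is false for r >= 3. *)
Lemma full_column_pendant_absurd (R : realFieldType) (r P x c j N : R) : 0 < P -> 3 <= r ->
  (r - N) * P = 2 * N * x + j -> (r ^+ 2 + r + 1) * x = r * P ->
  (r ^+ 2 + r - 1) * c = r * (P + 2 * x) -> r * j = c ->
  N * (3 * r ^+ 2 - 2) <= (r - N + 1) * (r * (r ^+ 2 - 1)) -> False.
Proof.
move=> P0 r3 E1 E2 E3 E4 H.
have r0 : 0 < r by lra.
pose E := r ^+ 2 + r + 1; pose F := r ^+ 2 + r - 1; pose M := r ^+ 2 + 3 * r + 1.
have t9 : 0 <= (r - 3) * (r + 3) by apply: mulr_ge0; lra.
have rr : 9 <= r * r by lra.
have F0 : 0 < F by rewrite /F; lra.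
have M0 : 0 < M by rewrite /M; lra.
have Fj : F * j = P + 2 * x.
  apply: (mulfI (lt0r_neq0 r0)); rewrite mulrCA E4 -E3 /F; ring.
have K1 : (r - N) * (E * F) = 2 * N * F * r + M.
  apply: (mulIf (lt0r_neq0 P0)).
  transitivity (E * F * ((r - N) * P)); first by ring.
  rewrite E1 (_ : E * F * _ = 2 * N * F * (E * x) + E * (F * j)); last by ring.
  rewrite Fj (_ : E * (P + 2 * x) = E * P + 2 * (E * x)); last by ring.
  by rewrite /E E2 /M; ring.
have K2 : N * F * M = r * E * F - M.
  have -> : r * E * F = (r - N) * (E * F) + N * E * F by ring.
  by rewrite K1 /M /E /F; ring.
pose G := r ^+ 3 + 3 * r ^+ 2 - r - 2.
have H' : N * G <= (r + 1) * (r * (r ^+ 2 - 1)).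
  by rewrite -subr_ge0; rewrite -subr_ge0 in H; apply: le_trans H _; rewrite /G le_eqVlt; apply/orP; left; apply/eqP; ring.
have K3 : F * M * (N * G) <= F * M * ((r + 1) * (r * (r ^+ 2 - 1))).
  by rewrite ler_wpM2l // mulr_ge0 // ltW.
have K4 : F * M * ((r + 1) * (r * (r ^+ 2 - 1))) - (r * E * F - M) * G =
    - (2 * (r * r * r * ((r - 3) * (r + 2)) + 4 * r + 1)).
  by rewrite /F /M /E /G; ring.
have K5 : 0 <= r * r * r * ((r - 3) * (r + 2)).
  by rewrite mulr_ge0 ?mulr_ge0 //; lra.
have K6 : F * M * (N * G) = (r * E * F - M) * G by rewrite -K2; ring.
have : (0 : R) < 0 by rewrite K6 in K3; lra.
by rewrite ltxx.
Qed.

(** Elimination gives (r^3 - 2 r^2 - 10 r + 4) P = - 6 y - 8 x < 0. But [r] times this cubic exceeds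
    the difference of the two sides of the bound by 2 r - 6, so it is nonnegative. *)
Lemma twin_singletons_absurd (R : realFieldType) (r P x y c a b : R) : 0 < P -> 0 < x -> 0 < y -> 3 <= r ->
  P = c + b + 2 * a -> (r + 1) * c = P + x + 2 * y -> (r + 1) * b = P + 2 * y ->
  (r + 1) * a = P + x -> r * x = P - b -> r * y = c + b ->
  3 * (3 * r ^+ 2 - 2) <= (r - 3 + 1) * (r * (r ^+ 2 - 1)) -> False.
Proof.
move=> P0 x0 y0 r3 EP Ec Eb Ea Ex Ey H.
have S1 : r * ((r + 1) * a) = (r + 1) * P - b by rewrite Ea mulrDr Ex; ring.
have ry : r * y = P - 2 * a by rewrite Ey EP; ring.
have S2 : r * ((r + 1) * b) = (r + 2) * P - 4 * a.
  by rewrite Eb; transitivity (r * P + 2 * (r * y)); [ring | rewrite ry; ring].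
have S3 : r * ((r + 1) * c) = (r + 3) * P - b - 4 * a.
  by rewrite Ec; transitivity (r * P + r * x + 2 * (r * y)); [ring | rewrite Ex ry; ring].
have S4 : (r ^+ 2 - 3 * r - 7) * P + 3 * b + 8 * a = 0.
  have : r * (r + 1) * P = r * ((r + 1) * c) + r * ((r + 1) * b) + 2 * (r * ((r + 1) * a)).
    by rewrite {1}EP; ring.
  by rewrite S1 S2 S3 => h; lra.
have S5 : (r ^+ 3 - 2 * r ^+ 2 - 10 * r + 4) * P + 6 * y + 8 * x = 0.
  have : (r + 1) * ((r ^+ 2 - 3 * r - 7) * P + 3 * b + 8 * a) = 0 by rewrite S4 mulr0.
  rewrite (_ : (r + 1) * _ = (r + 1) * (r ^+ 2 - 3 * r - 7) * P + 3 * ((r + 1) * b) + 8 * ((r + 1) * a)); last by ring.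
  by rewrite Ea Eb => h; lra.
have neg : r ^+ 3 - 2 * r ^+ 2 - 10 * r + 4 < 0.
  by rewrite -(ltr_pM2r P0) mul0r; lra.
have neg2 : r * (r ^+ 3 - 2 * r ^+ 2 - 10 * r + 4) < 0.
  by rewrite pmulr_rlt0 //; lra.
have : (0 : R) < 0 by lra.
by rewrite ltxx.
Qed.

Local Close Scope ring_scope.

(** * Hamiltonian cycles through three independent vertices *)

Section ThreeCombinatorics.
Variables (T : finType) (e : rel T) (K I : {set T}).
Hypothesis KS : K14_split e K I.
Hypotheses (I3 : #|I| = 3) (K4 : 4 <= #|K|).
Let sym := ks_sym KS.

Let column3_full c u : c \in K -> #|column e I c| = 3 -> u \in I -> e u c.
Proof.
move=> cK c3 uI; have /eqP cI : column e I c == I.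
  by rewrite eqEcard c3 I3 leqnn andbT; apply/subsetP => v; rewrite inE => /andP[].
by move: uI; rewrite -cI (mem_column KS) => /andP[].
Qed.

Let third u v : u \in I -> v \in I -> u != v ->
  exists z, uniq [:: u; v; z] /\ [:: u; v; z] =i I.
Proof.
move=> uI vI uv; have : #|I :\ u :\ v| == 1.
  by move: I3; rewrite (cardsD1 u) uI (cardsD1 v) !inE vI eq_sym uv => -[] /eqP.
case/cards1P => z Iz; have : z \in I :\ u :\ v by rewrite Iz inE.
rewrite !inE => /and3P[zv zu zI]; exists z; split.
  by rewrite /= !inE !negb_or uv ![_ == z]eq_sym zu zv.
move=> t; have /setP/(_ t) := Iz; rewrite !inE.
have [->|tu] := eqVneq t u; first by rewrite uI.
by have [->|tv] := eqVneq t v; first by rewrite vI.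
Qed.

(** Full columns join any two rows, so only the ends of the path matter. A row [u] is entered from
    [a]; a row [v] that reaches a vertex [b] missed by [u] differs from [u]; the third row lies
    between [c] and [c']. *)
Lemma hamiltonian_three_full c c' : c \in K -> c' \in K -> c != c' ->
  #|column e I c| = 3 -> #|column e I c'| = 3 -> hamiltonian e.
Proof.
move=> cK c'K cc c3 c'3.
have nonempty v : v \in K -> exists2 u, u \in I & e u v.
  move=> vK; have [u _] := ks_meet KS cK vK c3.
  by rewrite (mem_column KS) => /andP[uI euv]; exists u.
have /card_gt0P[x xI] : 0 < #|I| by rewrite I3.
have [a aK nxa] := ks_miss KS xI; have [u uI eua] := nonempty a aK.
have [b bK nub] := ks_miss KS uI; have [v vI evb] := nonempty b bK.
have uv : u != v by apply: contraNneq nub => ->.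
have ab := neq_row nub eua; have [z [uq qI]] := third uI vI uv.
have neq_full d t t' : d \in K -> #|column e I d| = 3 -> t' \in I -> ~~ e t' t -> d != t.
  by move=> dK d3 tI nt; apply: contraNneq nt => <-; apply: column3_full.
have zI : z \in I by rewrite -qI !inE eqxx !orbT.
apply: (hamiltonian_alternate_path KS (z := [:: (a, u); (c, z); (c', v)]) (l := b)) => //.
- have [ac ac'] : a != c /\ a != c'.
    by split; rewrite eq_sym; [apply: (neq_full c a x) | apply: (neq_full c' a x)].
  have [cb c'b] : c != b /\ c' != b.
    by split; [apply: (neq_full c b u) | apply: (neq_full c' b u)].
  by rewrite /= !inE !negb_or ac ac' cc cb c'b !ab.
- move: uq; rewrite /= !inE !negb_or => /and3P[/andP[-> ->] vz _].
  by rewrite eq_sym vz.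
- by move=> t; rewrite !inE => /or4P[] /eqP->.
- by move=> t; rewrite -qI /= !inE; case: (t == u); case: (t == v); case: (t == z).
have [euc ezc] := (column3_full cK c3 uI, column3_full cK c3 zI).
have [ezc' evc'] := (column3_full c'K c'3 zI, column3_full c'K c'3 vI).
by rewrite /= sym eua euc sym ezc ezc' sym evc' evb.
Qed.

(** Each column omits exactly one row, so vertices missed by the three rows are distinct and each
    links the other two rows. *)
Lemma hamiltonian_three_pairs : (forall v, v \in K -> #|column e I v| = 2) ->
  hamiltonian e.
Proof.
move=> all2.
have [q [uq qI sq _]] := @sorted_listing rat _ (fun=> 0%R) I; rewrite I3 in sq.
case: q uq qI sq => [|x [|y [|j [|? ?]]]] // uq qI _.
have [[xI yI] jI] : (x \in I /\ y \in I) /\ j \in I by rewrite -!qI !inE !eqxx ?orbT.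
have [a aK nxa] := ks_miss KS xI; have [b bK nyb] := ks_miss KS yI.
have [c cK njc] := ks_miss KS jI.
have ee u v t : u \in I -> v \in K -> ~~ e u v -> t \in I -> t != u -> e t v.
  move=> uI vK nuv tI tu; have := all2 v vK; rewrite (card_column KS v uq qI) /=.
  move: uI tI nuv tu; rewrite -!qI !inE.
  case/or3P=> /eqP-> /or3P[] /eqP->; rewrite ?eqxx // => /negPf-> _;
  by do 2?case: (e _ v).
have [xy xj yj] : [/\ x != y, x != j & y != j] by move: uq; rewrite /= !inE !negb_or => /and3P[/andP[-> ->] ->].
have [yx jx jy] : [/\ y != x, j != x & j != y] by rewrite eq_sym xy eq_sym xj eq_sym yj.
have [eya eja] := (ee x a y xI aK nxa yI yx, ee x a j xI aK nxa jI jx).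
have [exb ejb] := (ee y b x yI bK nyb xI xy, ee y b j yI bK nyb jI jy).
have [exc eyc] := (ee j c x jI cK njc xI xj, ee j c y jI cK njc yI yj).
apply: (hamiltonian_alternate_cycle KS (z := [:: (a, y); (c, x); (b, j)])) => //.
- by rewrite /= !inE !negb_or !(neq_row nxa exc) !(neq_row nxa exb) !(neq_row njc ejb).
- by rewrite /= !inE !negb_or yx yj xj.
- by move=> v; rewrite !inE => /or3P[] /eqP->.
- by move=> u; rewrite -qI /= !inE; case: (u == x); case: (u == y).
- by rewrite /= [e a y]sym eya eyc [e c x]sym exc exb [e b j]sym ejb eja.
by move=> f fK _; apply: column_ext; rewrite all2.
Qed.

(** Suppose a row [j] is pendant at [c]. A vertex missed by one of the other two rows then has a
    column of size 1, and only two such columns are allowed, so each of the two rows misses one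
    vertex: the second alternative. Otherwise every row has a neighbour besides [c], and a path
    exists unless G has the third shape. *)
Lemma three_one_full c : c \in K -> #|column e I c| = 3 ->
  (forall v, v \in K -> v != c -> #|column e I v| <= 2) ->
  #|[set v in K | #|column e I v| == 1]| <= 2 ->
  [\/ hamiltonian e,
      exists x y j a b, [/\ uniq [:: x; y; j] /\ [:: x; y; j] =i I, nbr e K j = [set c],
        missed e K x = [set a] /\ missed e K y = [set b], a \in K /\ b \in K & a != b]
    | exists x y j b, [/\ uniq [:: x; y; j] /\ [:: x; y; j] =i I, missed e K x = [set b],
        nbr e K y = [set c; b] /\ nbr e K j = [set c; b], b \in K /\ b != c & #|K| = 4]].
Proof.
move=> cK c3 le2 singles.
have nonempty v : v \in K -> exists2 u, u \in I & e u v.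
  move=> vK; have [u _] := ks_meet KS cK vK c3.
  by rewrite (mem_column KS) => /andP[uI euv]; exists u.
have full u : u \in I -> e u c by apply: column3_full.
have no3 v1 v2 v3 : v1 \in K -> v2 \in K -> v3 \in K -> v1 != v2 -> v2 != v3 -> v3 != v1 ->
    #|column e I v1| = 1 -> #|column e I v2| = 1 -> #|column e I v3| = 1 -> False.
  move=> K1 K2 K3 n12 n23 n31 s1 s2 s3.
  have : 2 < #|[set v in K | #|column e I v| == 1]|.
    by apply/card_gt2P; exists v1, v2, v3; rewrite !inE K1 K2 K3 s1 s2 s3.
  by rewrite ltnNge singles.
have [/exists_inP[j jI /eqP Nj]|/exists_inPn nopend] := boolP [exists u in I, nbr e K u == [set c]].
  apply: Or32; have [x xI xj] : exists2 x, x \in I & x != j.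
    have : 0 < #|I :\ j| by move: I3; rewrite (cardsD1 j) jI; case: #|_ :\ _|.
    by case/card_gt0P => x; rewrite !inE => /andP[xj xI]; exists x.
  have [y [uq qI]] := third jI xI ltac:(by rewrite eq_sym).
  have [uq' qI'] : uniq [:: x; y; j] /\ [:: x; y; j] =i I.
    by apply: perm_listing uq qI; rewrite -[[:: x; y; j]]/([:: x; y] ++ [:: j]) perm_sym perm_catC.
  have yI : y \in I by rewrite -qI !inE eqxx !orbT.
  have nj v : v \in K -> v != c -> ~~ e j v by move=> vK vc; rewrite (nbr1 Nj) // (negPf vc).
  have cnt v : v \in K -> #|column e I v| = (e x v + (e y v + (e j v + 0)))%N.
    by move=> vK; rewrite (card_column KS v uq' qI') /=.
  have notc u v : u \in I -> ~~ e u v -> v != c by move=> uI nuv; apply: contraNneq nuv => ->; apply: full.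
  have some v : v \in K -> v != c -> e x v || e y v.
    move=> vK vc; have [u uI euv] := nonempty v vK; have := nj v vK vc.
    by move: uI; rewrite -qI' !inE => /or3P[] /eqP uE; rewrite -uE euv ?orbT.
  have sx v : v \in K -> ~~ e x v -> e y v /\ #|column e I v| = 1.
    move=> vK nv; have vc := notc x v xI nv; have := some v vK vc.
    by rewrite cnt // (negPf nv) (negPf (nj v vK vc)) => /= ->.
  have sy v : v \in K -> ~~ e y v -> e x v /\ #|column e I v| = 1.
    move=> vK nv; have vc := notc y v yI nv; have := some v vK vc.
    by rewrite cnt // (negPf nv) (negPf (nj v vK vc)) orbF => ->.
  have [a aK nxa] := ks_miss KS xI; have [b bK nyb] := ks_miss KS yI.
  have [eya a1] := sx a aK nxa; have [exb b1] := sy b bK nyb.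
  have ab := neq_row nxa exb.
  exists x, y, j, a, b; split; rewrite ?ab //; split=> //.
    apply/setP => v; rewrite !inE; apply/andP/eqP => [[vK nxv]|->//].
    apply/eqP/negP => /negP va; have [eyv v1] := sx v vK nxv.
    by apply: (@no3 v a b); rewrite ?ab ?va //; rewrite (neq_row nyb eyv).
  apply/setP => v; rewrite !inE; apply/andP/eqP => [[vK nyv]|->//].
  apply/eqP/negP => /negP vb; have [exv v1] := sy v vK nyv.
  by apply: (@no3 v b a); rewrite ?ab ?vb //; rewrite (neq_row nxa exv).
have pend u : u \in I -> exists2 v, v \in K & (v != c) && e u v.
  move=> uI; apply/exists_inP; apply: contraR (nopend u uI) => /exists_inPn noth.
  rewrite eqEsubset; apply/andP; split; apply/subsetP => v; rewrite !inE.
    by case/andP=> vK euv; have := noth v vK; rewrite euv andbT negbK.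
  by move/eqP->; rewrite cK full.
(* There are at least three vertices besides [c] and at most two columns of size 1; none is empty,
   as all meet the column of [c]. *)
have [be /andP[beK] /andP[bec be2]] : exists be, (be \in K) && ((be != c) && (#|column e I be| == 2)).
  apply/existsP; apply: contraT => /existsPn no2; exfalso.
  have one v : v \in K -> v != c -> #|column e I v| = 1.
    move=> vK vc; have := no2 v; rewrite vK vc /=; have := le2 v vK vc.
    have [u uI euv] := nonempty v vK.
    have : 0 < #|column e I v| by apply/card_gt0P; exists u; rewrite (mem_column KS) uI.
    by case: #|_| => [|[|[|]]].
  have [v1 K1] := @ex_notin _ K [:: c] (leq_trans (isT : 1 < 4) K4); rewrite !inE => v1c.
  have [v2 K2] := @ex_notin _ K [:: c; v1] (leq_trans (isT : 2 < 4) K4).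
  rewrite !inE negb_or => /andP[v2c v21].
  have [v3 K3] := @ex_notin _ K [:: c; v1; v2] K4.
  rewrite !inE !negb_or => /and3P[v3c v31 v32].
  by apply: (@no3 v1 v2 v3) => //; rewrite ?one // eq_sym.
have /cards2P[y [j [yj col_be]]] := be2.
have [yb jb] : y \in column e I be /\ j \in column e I be by rewrite col_be !inE !eqxx orbT.
move: yb jb; rewrite !(mem_column KS) => /andP[yI eyb] /andP[jI ejb].
have [x [uq0 qI0]] := third yI jI yj.
have [uq qI] : uniq [:: x; y; j] /\ [:: x; y; j] =i I.
  by apply: perm_listing uq0 qI0; rewrite -[[:: x; y; j]]/([:: x] ++ [:: y; j]) perm_sym perm_catC.
have xI : x \in I by rewrite -qI !inE eqxx.
have [xy xj] : x != y /\ x != j by move: uq; rewrite /= !inE !negb_or => /and3P[/andP[]].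
have nxbe : ~~ e x be.
  apply/negP => exb; have : x \in column e I be by rewrite (mem_column KS) xI.
  by rewrite col_be !inE (negPf xy) (negPf xj).
(* The path a x c u be v g, where u and v are [y] and [j] in some order, needs only an end for [x]
   and a different end for [y] or [j]. *)
have ham a g : a \in K -> g \in K -> a != c -> a != be -> g != c -> g != be -> a != g ->
    e x a -> e y g || e j g -> hamiltonian e.
  move=> aK gK ac ab gc gb ag exa.
  have core u v : uniq [:: x; u; v] -> [:: x; u; v] =i I -> e u be -> e v be -> e v g ->
      u \in I -> v \in I -> hamiltonian e.
    move=> uuv uvI eub evb evg uI vI.
    apply: (hamiltonian_alternate_path KS (z := [:: (a, x); (c, u); (be, v)]) (l := g)) => //.
    - by rewrite /= !inE !negb_or ac ab ag [c == be]eq_sym bec [c == g]eq_sym gc [be == g]eq_sym gb.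
    - by move=> t; rewrite !inE => /or4P[] /eqP->.
    by rewrite /= sym exa full // sym full // eub sym evb evg.
  case/orP=> [eyg|ejg]; last exact: (core y j).
  apply: (core j y) => //.
    by move: uq; rewrite /= !inE !negb_or [j == y]eq_sym => /and3P[/andP[-> ->] ->].
  by move=> t; rewrite -qI !inE; case: (t == x); rewrite //= orbC.
have [al alK /andP[alc exal]] := pend x xI.
have albe : al != be by apply: contraTneq exal => ->.
have [/exists_inP[g gK /and4P[gc gb gal eg]]|/exists_inPn noother] :=
  boolP [exists g in K, [&& g != c, g != be, g != al & e y g || e j g]].
  by apply: Or31; apply: (ham al g) => //; rewrite eq_sym.
have other v : v \in K -> v != c -> v != be -> v != al -> [/\ e x v, ~~ e y v & ~~ e j v].
  move=> vK vc vb va; have := noother v vK; rewrite vc vb va /= negb_or => /andP[ny nj].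
  have [u uI euv] := nonempty v vK; split=> //.
  by move: uI; rewrite -qI !inE => /or3P[] /eqP uE; rewrite -uE euv in ny nj *.
have [g0 g0K] := @ex_notin _ K [:: c; be; al] K4; rewrite !inE !negb_or => /and3P[g0c g0b g0a].
have [ex0 ny0 nj0] := other g0 g0K g0c g0b g0a.
have [eal|] := boolP (e y al || e j al).
  by apply: Or31; apply: (ham g0 al).
rewrite negb_or => /andP[nyal njal].
have cnt v : v \in K -> #|column e I v| = (e x v + (e y v + (e j v + 0)))%N.
  by move=> vK; rewrite (card_column KS v uq qI) /=.
have all_x v : v \in K -> v != c -> v != be -> [/\ e x v, ~~ e y v & ~~ e j v].
  by move=> vK vc vb; have [->|va] := eqVneq v al; [split | apply: other].
(* All vertices other than [c] and [be] now have column {x}, and there are at most two of them. *)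
have k4 : #|K| = 4.
  apply/eqP; rewrite eqn_leq K4 andbT leqNgt; apply/negP => K5.
  have [g1 g1K] := @ex_notin _ K [:: c; be; al; g0] K5.
  rewrite !inE !negb_or => /and4P[g1c g1b g1a g10].
  have one v : v \in K -> v != c -> v != be -> #|column e I v| = 1.
    by move=> vK vc vb; have [h1 h2 h3] := all_x v vK vc vb; rewrite cnt // h1 (negPf h2) (negPf h3).
  by apply: (@no3 al g0 g1); rewrite ?one //; rewrite eq_sym.
apply: Or33; exists x, y, j, be; split=> //.
- apply/setP => v; rewrite !inE; apply/andP/eqP => [[vK nxv]|->//].
  apply/eqP/negP => /negP vb; have vc : v != c by apply: contraNneq nxv => ->; apply: full.
  by have [exv _ _] := all_x v vK vc vb; rewrite exv in nxv.
- have N u : u \in I -> e u be -> (forall v, v \in K -> v != c -> v != be -> ~~ e u v) -> nbr e K u = [set c; be].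
    move=> uI eub nu; apply/setP => v; rewrite !inE; apply/andP/orP => [[vK euv]|].
      have [vc|vc] := eqVneq v c; first by left.
      have [vb|vb] := eqVneq v be; first by right.
      by have := nu v vK vc vb; rewrite euv.
    by case=> /eqP->; split=> //; apply: full.
  by split; apply: N => // v vK vc vb; have [] := all_x v vK vc vb.
Qed.
End ThreeCombinatorics.

Local Open Scope ring_scope.

(** Summation by parts with the lightest row j as pivot. Measured against 2, the deficiency of H is
    the weight [a] of its last clique vertex. *)
Lemma three_rows_ineq (R : realFieldType) (x y j r P a : R) :
  j <= x -> j <= y -> 0 <= j -> a <= P - r * x -> a <= P - r * y ->
  a <= 2 * P - (r * x + (r * y + (r * j + 0))) ->
  0 <= x * (P - a - r * x) + y * (P - a - r * y) + j * (a - r * j).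
Proof.
move=> jx jy j0 Ax Ay key.
have t1 : 0 <= (x - j) * (P - r * x - a) by apply: mulr_ge0; lra.
have t2 : 0 <= (y - j) * (P - r * y - a) by apply: mulr_ge0; lra.
have t3 : 0 <= j * (2 * P - (r * x + (r * y + (r * j + 0))) - a).
  by apply: mulr_ge0; lra.
by lra.
Qed.

Section ThreeRows.
Variables (R : realFieldType) (T : finType) (e : rel T) (K I : {set T}).
Variables (w : T -> R) (r : R).
Hypothesis KS : K14_split e K I.
Hypothesis PW : perron_weights e K I w r.
Hypothesis r_gt0 : 0 < r.
Variables (n k : nat).
Hypotheses (kn : k = (n - 3)%N) (k4 : (4 <= k)%N) (Kk : #|K| = k) (I3 : #|I| = 3%N).
Hypothesis bdd : rayleigh_bounded (@split_rel k 3 (Gamma_cross n 3)) r.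

Let w_gt0 := pw_gt0 PW.
Let K4 : (4 <= #|K|)%N. Proof. by rewrite Kk. Qed.
Let r3 : 3 <= r := r_ge3 PW K4.
Let w2 := column_weights_lt2 KS PW r_gt0 r3.

(** For the infinite family of exceptions this is the equation that ties the order of the clique to
    [r]. *)
Lemma sum_cols (q : seq T) : uniq q -> q =i I ->
  (r + 1) * wt w K = k%:R * wt w K + \sum_(u <- q) w u *+ #|nbr e K u|.
Proof.
move=> uq qI; rewrite {1}/wt mulr_sumr.
rewrite (eq_bigr (fun v => wt w K + \sum_(u in column e I v) w u)); last first.
  by move=> v vK; rewrite -(pw_col PW vK).
rewrite big_split /= sumr_const Kk mulr_natl; congr (_ + _).
rewrite (big_uniq _ uq) (eq_bigl _ _ qI) (exchange_big_dep (mem I)) /=; last first.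
  by move=> v u _; rewrite inE => /andP[].
apply: eq_bigr => u uI; rewrite -sumr_const; apply: eq_bigl => v.
by rewrite !inE uI (ks_sym KS).
Qed.

Lemma iso_Gamma3 x y j a : uniq [:: x; y; j] -> [:: x; y; j] =i I ->
  missed e K x = [set a] -> missed e K y = [set a] -> nbr e K j = [set a] ->
  a \in K -> graph_iso e (@split_rel k 3 (Gamma_cross n 3)).
Proof.
move=> uq qI Mx My Nj aK.
have [b bK] := @ex_notin _ K [:: a] (leq_trans (isT : 1 < 4)%N K4); rewrite inE => ba.
have ab : a != b by rewrite eq_sym.
have [s [us sK ss _ sl]] := listing_ends x aK bK ab; rewrite Kk in ss sl.
apply: (graph_iso_split KS (x0 := x) (s := s) (q := [:: x; y; j])) => // i l i3 lk.
have lK : nth x s l \in K by rewrite -sK mem_nth ?ss.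
have k1 : (k.-1 < k)%N by case: (k) k4.
have [c0 c1 c2] := Gamma_cross3 kn k4 lk.
case: i i3 => [|[|[|//]]] _; rewrite ?c0 ?c1 ?c2 /= ?(missed1 Mx) ?(missed1 My) ?(nbr1 Nj) //;
  by rewrite -sl nth_uniq ?ss.
Qed.

Lemma three_rows_win x y j : uniq [:: x; y; j] -> [:: x; y; j] =i I ->
  w j <= w x -> w j <= w y ->
  (forall a, a \in K -> (forall v, v \in K -> w a <= w v) ->
    w a <= \sum_(v in K) (2 - #|column e I v|%:R) * w v) ->
  graph_iso e (@split_rel k 3 (Gamma_cross n 3)).
Proof.
move=> uq qI jx jy ge.
have [[xI yI] jI] : (x \in I /\ y \in I) /\ j \in I by rewrite -!qI !inE !eqxx ?orbT.
have [a [b [aK bK ab min_a _]]] := min_weight2 w (leq_trans (isT : 1 < 4)%N K4).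
have [s [us sK ss _ sl]] := listing_ends x aK bK ab; rewrite Kk in ss sl.
have k1 : (k.-1 < k)%N by case: (k) k4.
have hr0 : hrow w k (Gamma_cross n 3) x s 0 = wt w K - w a.
  by rewrite -sl; apply: hrow_all_but => // l lk; have [] := Gamma_cross3 kn k4 lk.
have hr1 : hrow w k (Gamma_cross n 3) x s 1 = wt w K - w a.
  by rewrite -sl; apply: hrow_all_but => // l lk; have [] := Gamma_cross3 kn k4 lk.
have hr2 : hrow w k (Gamma_cross n 3) x s 2 = w a.
  by rewrite -sl; apply: hrow_one => // l lk; have [] := Gamma_cross3 kn k4 lk.
have le0 := arrange_le KS PW x ss (erefl : size [:: x; y; j] = 3%N) us uq sK qI bdd.
have eq0 := arrange_eq KS PW (x0 := x) ss (erefl : size [:: x; y; j] = 3%N) us uq sK qI bdd.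
move: le0 eq0; rewrite !big_ord_recr big_ord0 /= hr0 hr1 hr2 add0r => le0 eq0.
have miss_ge u : u \in I -> w a <= wt w K - r * w u.
  move=> uI; have [v vK nv] := ks_miss KS uI.
  exact: le_trans (min_a v vK) (missed_ge PW uI vK nv).
have key := ge a aK min_a.
have := sum_deficiency KS PW 2 uq qI; rewrite !big_cons big_nil => def0; rewrite -def0 in key.
have ge0 := three_rows_ineq jx jy (ltW (w_gt0 j)) (miss_ge x xI) (miss_ge y yI) key.
have {}eq0 := eq0 (le_anti (introT andP (conj le0 ge0))).
have := eq0 0%N isT; have := eq0 1%N isT; have := eq0 2%N isT.
rewrite /= hr0 hr1 hr2 => Ej Ey Ex.
have flip u c : wt w K - w c = r * w u -> wt w K - r * w u = w c by move=> <-; rewrite opprB addrC subrK.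
have [al Mx alK] := wt_single_in PW w2 (missed_sub e K x) (missed_neq0 KS xI) aK
  (etrans (wt_missed PW xI) (flip _ _ Ex)).
have [be My beK] := wt_single_in PW w2 (missed_sub e K y) (missed_neq0 KS yI) aK
  (etrans (wt_missed PW yI) (flip _ _ Ey)).
have [c Nj cK] := wt_single_in PW w2 (nbr_sub e K j) (nbr_neq0 KS jI) aK
  (etrans (wt_nbr PW jI) (esym Ej)).
have Wal : w al = w a.
  by rewrite -(flip _ _ Ex) -(wt_missed PW xI) Mx /wt big_set1.
have Wbe : w be = w a.
  by rewrite -(flip _ _ Ey) -(wt_missed PW yI) My /wt big_set1.
have Wc : w c = w a by rewrite Ej -(wt_nbr PW jI) Nj /wt big_set1.
have xy : w x = w y by apply: (mulfI (lt0r_neq0 r_gt0)); rewrite -Ex -Ey.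
have Ec := column_eq KS PW uq qI cK; have Eal := column_eq KS PW uq qI alK.
have Ebe := column_eq KS PW uq qI beK.
rewrite !big_cons !big_nil !(missed1 Mx) // !(missed1 My) // !(nbr1 Nj) // eqxx /= in Ec Eal Ebe.
rewrite Wc in Ec; rewrite Wal in Eal; rewrite Wbe in Ebe.
have x0 := w_gt0 x; have y0 := w_gt0 y; have j0 := w_gt0 j.
(* The vertices [al], [be] and [c] have equal weights, hence equally heavy columns, and w(x) = w(y).
   Unless all three coincide, comparing two columns leaves w(j) <= 0. *)
have cal : c = al.
  apply/eqP/negP => /negP nc; rewrite nc [al == c]eq_sym (negPf nc) ?eqxx /= in Ec Eal.
  suff : w j <= 0 by rewrite leNgt j0.
  by case: (al != be) Eal => /= Eal; case: (c != be) Ec => /= Ec; lra.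
subst c; have alb : al = be.
  apply/eqP/negP => /negP nc; rewrite nc [be == al]eq_sym (negPf nc) !eqxx /= in Ec Ebe.
  suff : w j <= 0 by rewrite leNgt j0.
  by lra.
by subst be; apply: (iso_Gamma3 uq qI Mx My Nj).
Qed.

Lemma sum_ge_sub (A B : {set T}) (F : T -> R) : A \subset B ->
  (forall v, v \in B -> 0 <= F v) -> (forall v, v \in A -> w v <= F v) ->
  wt w A <= \sum_(v in B) F v.
Proof.
move=> /subsetP AB F0 FA; rewrite [leRHS](big_setID A) /= -[leLHS]addr0; apply: lerD.
  have -> : \sum_(v in B :&: A) F v = \sum_(v in A) F v.
    by apply: eq_bigl => v; rewrite inE andbC; case vA: (v \in A) => //=; apply: AB.
  exact: ler_sum.
by apply: sumr_ge0 => v; rewrite inE => /andP[_ /F0].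
Qed.

Lemma no_full_column_pendant x y j a b c : uniq [:: x; y; j] -> [:: x; y; j] =i I ->
  nbr e K j = [set c] -> missed e K x = [set a] -> missed e K y = [set b] ->
  a \in K -> b \in K -> c \in K -> a != b -> a != c -> b != c -> False.
Proof.
move=> uq qI Nj Mx My aK bK cK ab ac bc.
have [[xI yI] jI] : (x \in I /\ y \in I) /\ j \in I by rewrite -!qI !inE !eqxx ?orbT.
have Wx : w a = wt w K - r * w x by rewrite -(wt_missed PW xI) Mx /wt big_set1.
have Wy : w b = wt w K - r * w y by rewrite -(wt_missed PW yI) My /wt big_set1.
have Wj : r * w j = w c by rewrite -(wt_nbr PW jI) Nj /wt big_set1.
have Ec := column_eq KS PW uq qI cK; have Ea := column_eq KS PW uq qI aK.
have Eb := column_eq KS PW uq qI bK.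
rewrite !big_cons !big_nil !(missed1 Mx) // !(missed1 My) // !(nbr1 Nj) // ![c == _]eq_sym
  [b == a]eq_sym !eqxx ab ac bc (negPf ac) (negPf bc) /= in Ec Ea Eb.
have card_missed u d : missed e K u = [set d] -> d \in K -> #|nbr e K u| = k.-1.
  move=> Mu dK; have -> : nbr e K u = K :\ d.
    apply/setP => v; have /setP/(_ v) := Mu; rewrite !inE.
    by case: (v \in K); rewrite ?andbF //= andbT => <-; rewrite negbK.
  by rewrite -Kk [in RHS](cardsD1 d) dK.
have := sum_cols uq qI; rewrite !big_cons big_nil (card_missed x a) // (card_missed y b) // Nj cards1.
case def_k: k k4 => [//|k'] k4' /= Es.
have r1 : 1 < r by apply: lt_le_trans r3; rewrite ltr1n.
have bnd : k'%:R * (3 * r ^+ 2 - 2) <= (r - k'%:R + 1) * (r * (r ^+ 2 - 1)).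
  by apply: (@Gamma3_bound R r n k') => //; [rewrite -def_k kn | move: bdd; rewrite def_k].
(* The columns of [a] and [b] are {y} and {x}. Their equations and those of the rows combine to (r
   (r + 1) - 1) (w(x) - w(y)) = 0. *)
have xy : w x = w y.
  have h : (r * (r + 1) - 1) * (w x - w y) = 0.
    have : (r + 1) * (w a - w b) = w y - w x by rewrite mulrBr Ea Eb; ring.
    by rewrite Wx Wy => h; lra.
  have h0 : r * (r + 1) - 1 != 0 by rewrite lt0r_neq0 // subr_gt0 mulr_egt1 // ltrDr.
  by apply/eqP; rewrite -subr_eq0; move/eqP: h; rewrite mulf_eq0 (negPf h0).
apply: (@full_column_pendant_absurd R r (wt w K) (w x) (w c) (w j) k'%:R) => //.
- exact: (wtK_gt0 PW cK).
- have -> : (r - k'%:R) * wt w K = (r + 1) * wt w K - (k'%:R + 1) * wt w K by ring.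
  by rewrite Es -natr1 -xy -[w x *+ k']mulr_natl mulr1n; ring.
- by have h := Ea; rewrite Wx -xy in h; lra.
- have -> : (r ^+ 2 + r - 1) * w c = r * ((r + 1) * w c) - w c by ring.
  by rewrite Ec -xy -Wj; ring.
Qed.

Lemma no_twin_singletons x y j b c : uniq [:: x; y; j] -> [:: x; y; j] =i I ->
  missed e K x = [set b] -> nbr e K y = [set c; b] -> nbr e K j = [set c; b] ->
  b \in K -> c \in K -> b != c -> #|K| = 4%N -> False.
Proof.
move=> uq qI Mx Ny Nj bK cK bc K4'.
have [[xI yI] jI] : (x \in I /\ y \in I) /\ j \in I by rewrite -!qI !inE !eqxx ?orbT.
have [a aK] := @ex_notin _ K [:: b; c] ltac:(by rewrite K4'); rewrite !inE negb_or => /andP[ab ac].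
have [d dK] := @ex_notin _ K [:: b; c; a] ltac:(by rewrite K4'); rewrite !inE !negb_or => /and3P[db dc da].
have us : uniq [:: c; b; a; d].
  by rewrite /= !inE !negb_or [c == b]eq_sym bc ![_ == a]eq_sym ab ac ![_ == d]eq_sym da db dc.
have KE : wt w K = w c + w b + w a + w d.
  have subK : [:: c; b; a; d] =i K.
    apply/subset_cardP; first by rewrite (card_uniqP us) K4'.
    by apply/subsetP => v; rewrite !inE => /or4P[] /eqP->.
  rewrite /wt -(eq_bigl _ _ subK) -(big_uniq _ us) /= !big_cons big_nil.
  by rewrite addr0 !addrA.
have cb : c != b by rewrite eq_sym.
have Wx : w b = wt w K - r * w x by rewrite -(wt_missed PW xI) Mx /wt big_set1.
have Wy : r * w y = w c + w b by rewrite -(wt_nbr PW yI) Ny /wt big_setU1 ?inE // big_set1.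
have Wj : r * w j = w c + w b by rewrite -(wt_nbr PW jI) Nj /wt big_setU1 ?inE // big_set1.
have yj : w y = w j by apply: (mulfI (lt0r_neq0 r_gt0)); rewrite Wy Wj.
have nE u v : nbr e K u = [set c; b] -> v \in K -> e u v = (v == c) || (v == b).
  by move=> /setP/(_ v); rewrite !inE => + vK; rewrite vK.
have Ec := column_eq KS PW uq qI cK; have Eb := column_eq KS PW uq qI bK.
have Ea := column_eq KS PW uq qI aK; have Ed := column_eq KS PW uq qI dK.
rewrite !big_cons !big_nil !(missed1 Mx) // !(nE y) // !(nE j) // !eqxx ?orbT cb ?(negPf bc)
  ?(negPf ab) ?(negPf ac) ?(negPf db) ?(negPf dc) /= in Ec Eb Ea Ed.
have ad : w a = w d.
  have r1 : r + 1 != 0 by rewrite lt0r_neq0 // addr_gt0.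
  by apply: (mulfI r1); rewrite Ea Ed.
have kE : k = 4%N by rewrite -Kk.
have r1 : 1 < r by apply: lt_le_trans r3; rewrite ltr1n.
have bnd : 3 * (3 * r ^+ 2 - 2) <= (r - 3 + 1) * (r * (r ^+ 2 - 1)).
  by apply: (@Gamma3_bound R r n 3) => //; [rewrite -kn kE | move: bdd; rewrite kE].
apply: (@twin_singletons_absurd R r (wt w K) (w x) (w y) (w c) (w a) (w b)) => //.
- exact: (wtK_gt0 PW cK).
- by rewrite KE -ad; ring.
- by rewrite Ec -yj; ring.
- by rewrite Eb -yj; ring.
- by rewrite Ea; ring.
- by rewrite Wx subKr.
Qed.

(** If the deficiency measured against 2 is at least the smallest clique weight, the comparison
    gives H. If it is smaller, nearly all columns have size 2: without a full column all of them do,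
    and with exactly one at most two columns have size 1. *)
Lemma three_rows : hamiltonian e \/ graph_iso e (@split_rel k 3 (Gamma_cross n 3)).
Proof.
have [q [uq qI sq sw]] := sorted_listing w I; rewrite I3 in sq.
case: q uq qI sq sw => [|x [|y [|j [|? ?]]]] // uq qI _ /= /and3P[yx jy _].
have jx := le_trans jy yx.
have [a [_ [aK _ _ min_a _]]] := min_weight2 w (leq_trans (isT : 1 < 4)%N K4).
have [le_a|lt_a] := leP (w a) (\sum_(v in K) (2 - #|column e I v|%:R) * w v).
  right; apply: (three_rows_win uq qI jx jy) => a' a'K min_a'.
  exact: le_trans (min_a' a aK) le_a.
left.
have F0 v : (#|column e I v| <= 2)%N -> 0 <= (2 - #|column e I v|%:R) * w v.
  by rewrite -(ler_nat R) => le2; rewrite mulr_ge0 ?subr_ge0 // ltW.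
have F1 v : (#|column e I v| <= 1)%N -> w v <= (2 - #|column e I v|%:R) * w v.
  rewrite -(ler_nat R) => le1; rewrite ler_peMl ?(ltW (w_gt0 v)) //; lra.
have [/exists_inP[c cK /eqP c3]|/exists_inPn no3] := boolP [exists c in K, #|column e I c| == 3%N]; last first.
  have le2 v : v \in K -> (#|column e I v| <= 2)%N.
    by move=> vK; have := ks_col KS vK; rewrite leq_eqVlt (negPf (no3 v vK)).
  apply: (hamiltonian_three_pairs KS I3) => v vK; apply/eqP; rewrite eqn_leq le2 //= ltnNge.
  apply/negP => le1; move: lt_a; rewrite ltNge => /negP; apply.
  apply: le_trans (sum_ge_sub (A := [set v]) _ _ _).
  - by rewrite /wt big_set1 min_a.
  - by rewrite sub1set.
  - by move=> u /le2/F0.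
  - by move=> u; rewrite inE => /eqP->; apply: F1.
have [/exists_inP[c' c'K /andP[cc /eqP c'3]]|/exists_inPn no3] :=
  boolP [exists c' in K, (c' != c) && (#|column e I c'| == 3%N)].
  by apply: (hamiltonian_three_full KS I3 c'K cK cc c'3 c3).
have le2 v : v \in K -> v != c -> (#|column e I v| <= 2)%N.
  move=> vK vc; have := ks_col KS vK; rewrite leq_eqVlt; have := no3 v vK.
  by rewrite vc /= => /negPf->.
(* Three columns of size 1 contribute w(v1) + w(v2) + w(v3) against the loss w(c) at the full
   column. By the factor two w(v1) + w(v2) exceeds w(c), so the deficiency would exceed w(v3), hence
   the smallest weight. *)
have singles : (#|[set v in K | #|column e I v| == 1%N]| <= 2)%N.
  rewrite leqNgt; apply/negP => /card_gt2P[v1 [v2 [v3 [[]]]]].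
  rewrite !inE => /andP[K1 /eqP s1] /andP[K2 /eqP s2] /andP[K3 /eqP s3] [n12 n23 n31].
  have nc v : #|column e I v| = 1%N -> v != c by move=> s; apply: contra_eq_neq c3 => <-; rewrite s.
  have := sum_ge_sub (A := v1 |: (v2 |: [set v3])) (B := K :\ c) (F := fun v => (2 - #|column e I v|%:R) * w v).
  rewrite /wt !big_setU1 ?inE ?negb_or ?n12 ?n23 1?eq_sym ?n31 // big_set1 => ge.
  have {}ge : w v1 + (w v2 + w v3) <= \sum_(v in K :\ c) (2 - #|column e I v|%:R) * w v.
    apply: ge => [|v|v].
    - by apply/subsetP => v; rewrite !inE => /or3P[] /eqP->; rewrite ?nc ?K1 ?K2 ?K3.
    - by rewrite !inE => /andP[vc vK]; apply: F0; apply: le2.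
    - by rewrite !inE => /or3P[] /eqP->; apply: F1; rewrite ?s1 ?s2 ?s3.
  move: lt_a; rewrite (bigD1 c) //= c3 ltNge => /negP; apply.
  have -> : \sum_(i in K | i != c) (2 - #|column e I i|%:R) * w i =
      \sum_(v in K :\ c) (2 - #|column e I v|%:R) * w v.
    by apply: eq_bigl => v; rewrite !inE andbC.
  have l1 := min_a v3 K3; have l2 := w2 cK K1; have l3 := w2 cK K2.
  move: (\sum_(v in K :\ c) _) ge => Sum ge; lra.
case: (three_one_full KS I3 K4 cK c3 le2 singles) => //.
- case=> x' [y' [j' [a' [b' [[uq' qI'] Nj [Mx My] [aK' bK'] ab]]]]]; exfalso.
  have full u : u \in I -> e u c.
    move=> uI; have /eqP cI : column e I c == I.
      by rewrite eqEcard c3 I3 leqnn andbT; apply/subsetP => v; rewrite inE => /andP[].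
    by move: uI; rewrite -cI (mem_column KS) => /andP[].
  have [x'I y'I] : x' \in I /\ y' \in I by rewrite -!qI' !inE !eqxx ?orbT.
  apply: (no_full_column_pendant uq' qI' Nj Mx My aK' bK' cK ab).
    by have := full x' x'I; rewrite (missed1 Mx) // eq_sym.
  by have := full y' y'I; rewrite (missed1 My) // eq_sym.
case=> x' [y' [j' [b' [[uq' qI'] Mx [Ny Nj] [bK' bc] k4']]]]; exfalso.
exact: (no_twin_singletons uq' qI' Mx Ny Nj bK' cK bc k4').
Qed.
End ThreeRows.

Local Close Scope ring_scope.

(** * The theorem *)

Theorem theorem4 (T : finType) (e : rel T) (K I : {set T}) (n : nat)
    (e_sym : symmetric e) (e_irr : irreflexive e)
    (order_n : #|T| = n)
    (split_KI : split_partition e K I)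
    (e_conn : connected_graph e)
    (e_free : K14_free e)
    (I_ge1 : 1 <= #|I|)
    (n_ge : maxn 5 (2 * #|I|) <= n)
    (rho_ge : (rho (extremal_graph n #|I|) <= rho e)%R) :
  hamiltonian e \/ graph_iso e (extremal_graph n #|I|).
Proof.
have KI_n : #|K| + #|I| = n.
  have [KI disjKI _ _] := split_KI.
  by rewrite -order_n -cardsT -KI; apply/esym/eqP; rewrite (leq_card_setU K I).
have Kn : #|K| = n - #|I| by rewrite -KI_n addnK.
have [n5 nI] : 5 <= n /\ 2 * #|I| <= n by move: n_ge; rewrite geq_max => /andP[].
have KI_le : #|I| <= #|K| by lia.
have K3 : 3 <= #|K| by lia.
have KS := K14_split_of e_sym e_irr split_KI e_conn e_free (ltnW K3).
have [w [w_gt0 wE]] := perron e_sym e_conn (leq_trans (isT : 0 < 5) (eq_ind_r (leq 5) n5 order_n)).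
have PW := perron_weights_of KS w_gt0 wE.
have r_gt0 : (0 < rhoR e)%R.
  have := r_ge PW (leq_trans (isT : 0 < 3) K3); have : (3%:R <= #|K|%:R :> algR)%R by rewrite ler_nat.
  by move=> h1 h2; lra.
have bdd k t c : (rho (@split_rel k t c) <= rho e)%R -> rayleigh_bounded (@split_rel k t c) (rhoR e).
  by apply: rayleigh_bounded_rho; apply: split_rel_sym.
move: I_ge1 rho_ge KI_le Kn; case cI: #|I| => [//|[|[|[|[|[|t]]]]]] _.
- by move=> _ _ Kn; apply: (one_row KS erefl Kn cI); rewrite -Kn ltnW.
- rewrite /extremal_graph; have [n5E|n5E] := eqVneq n 5 => /bdd rho_ge _ Kn.
    by apply: (two_rows_small KS PW r_gt0 _ _ cI) => //; rewrite ?Kn n5E.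
  have K4 : 4 <= n - 2 by lia.
  exact: (two_rows KS PW r_gt0 erefl K4 Kn rho_ge cI).
- rewrite /extremal_graph; have [n6E|n6E] := eqVneq n 6 => /bdd rho_ge _ Kn.
    by apply: (three_rows_small KS PW r_gt0 _ _ cI) => //; rewrite ?Kn n6E.
  have K4 : 4 <= n - 3 by lia.
  exact: (three_rows KS PW r_gt0 erefl K4 Kn cI rho_ge).
- move=> /bdd rho_ge K4 Kn; rewrite Kn in K4.
  have [two|one] := leqP #|[set v in K | #|column e I v| <= 2]| 1.
    by left; apply: (hamiltonian_four KS cI _ two); rewrite Kn.
  right; apply: (four_rows KS PW r_gt0 erefl Kn cI K4 rho_ge).
  have /card_gt1P[v [v' []]] := one; rewrite !inE => /andP[vK cv] /andP[v'K cv'] vv'.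
  by exists v, v'.
- move=> /bdd rho_ge K5 Kn; rewrite Kn in K5; right.
  exact: (five_rows KS PW r_gt0 erefl Kn cI K5 rho_ge).
move=> /bdd rho_ge K6 Kn; rewrite Kn in K6; right.
exact: (six_rows KS PW r_gt0 erefl (ltn0Sn t) K6 Kn cI rho_ge).
Qed.
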